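(* Let $M^3$ be a nondegenerate positive definite affine hypersurface of $\mathbb R^4$ which admits a pointwise $SO(2)$-symmetry or a pointwise $\mathbb Z_3$-symmetry, and with the globally defined functions satisfying $a=-\eta^2+\mu_1^2$ but $a\not\equiv0$ on $M^3$. Then $M^3$ is affinely equivalent to $$F:I\times N^2\to\mathbb R^4,\qquad (t,u,v)\mapsto(\gamma_1(t)u,\ \gamma_1(t)v,\ \gamma_1(t)f(u,v)+\gamma_2(t),\ \gamma_1(t)),$$ where $\psi:N^2\to\mathbb R^3$, $(u,v)\mapsto(u,v,f(u,v))$, is an improper affine sphere with affine normal $(0,0,1)$ and $\gamma=(\gamma_1,\gamma_2):I\to\mathbb R^2$ is an affine curve. Moreover, if $M^3$ admits a pointwise $SO(2)$-symmetry, then $N^2$ is an elliptic paraboloid.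
   Context: Blaschke structure: for a nondegenerate immersed hypersurface $F:M^n\to\mathbb R^{n+1}$, with $D$ the standard flat connection and $\det$ the standard volume form, the affine (Blaschke) normal $\xi$ is the transversal field, unique up to sign, such that $D_XY=\nabla_XY+h(X,Y)\xi$, $D_X\xi=-SX$ (tangential), and $|\det(X_1,\dots,X_n,\xi)|=|\det(h(X_i,X_j))|^{1/2}$. $\nabla$ is the induced connection, $h$ the affine metric, $S$ the affine shape operator; $\hat\nabla$ is the Levi-Civita connection of $h$, and $K(X,Y)=K_XY=\nabla_XY-\hat\nabla_XY$ is the difference tensor. $h(K(X,Y),Z)$ is totally symmetric and $\operatorname{trace}K_X=0$. $M$ is positive definite if $h$ is (for suitable sign of $\xi$). Symmetry: $M^3$ admits a pointwise $\mathbb Z_3$-symmetry (resp. $SO(2)$-symmetry) if at every $p\in M$ the group of orientation-preserving linear maps of $T_pM$ preserving $h$, $S$ and $K$ is isomorphic to $\mathbb Z_3$ (resp. $SO(2)$). Functions: for such $M^3$ there is near every point a smooth $h$-orthonormal frame $e_1,e_2,e_3$ with $K_{e_1}e_1=2\mu_1e_1$, $K_{e_1}e_2=-\mu_1e_2$, $K_{e_1}e_3=-\mu_1e_3$, $K_{e_2}e_2=-\mu_1e_1+\mu_2e_2$, $K_{e_2}e_3=-\mu_2e_3$, $K_{e_3}e_3=-\mu_1e_1-\mu_2e_2$, $Se_1=\lambda e_1$, $Se_2=ae_2$, $Se_3=ae_3$. Here $\mu_1\neq0$ everywhere, and $\mu_2$ vanishes exactly in the $SO(2)$ case. The field $e_1$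 is determined up to sign and may be taken globally defined; $\eta$ is the function with $\hat\nabla_Xe_1=\eta X$ for all $X\perp e_1$. Changing the sign of $e_1$ changes the sign of both $\mu_1$ and $\eta$. An improper affine sphere is a nondegenerate hypersurface whose affine normal is constant (equivalently $S=0$). An affine curve in $\mathbb R^2$ is a smooth nondegenerate curve, $\gamma_1'\gamma_2''-\gamma_1''\gamma_2'\ne0$; $I$ is an open interval. Affinely equivalent means equal up to an affine transformation of $\mathbb R^4$ (and reparametrization).
   Formalization: M is assumed connected, and the affine equivalence with F on I×N is stated near each point of M (with one affine transformation for all of M); globally it fails, e.g. for F restricted to a ball in (t,u,v), or for a disjoint union with a≡0 on one component. *)

(* Defs.v *)
From HB Require Import structures.
From mathcomp Require Import all_boot all_order all_algebra.
From mathcomp Require Import all_classical all_reals all_analysis.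

Set Implicit Arguments.
Unset Strict Implicit.
Unset Printing Implicit Defensive.

Import Order.TTheory GRing.Theory Num.Theory.
Import numFieldNormedType.Exports.

Local Open Scope classical_set_scope.
Local Open Scope ring_scope.

(* C^oo on an open set [D]: all iterated directional derivatives, of every
   order, are Frechet differentiable at the points of [D]. *)
Definition smooth_on (R : realType) (V W : normedModType R)
    (D : set V) (f : V -> W) : Prop :=
  forall (vs : seq V) (x : V), D x ->
    differentiable (foldr (fun (v : V) (g : V -> W) => 'D_v g) f vs) x.

(* [ccoord] and [cparam] are total functions; only their restrictions to
   [cdom] and to [cim] are meaningful. *)
Record chart (R : realType) (M : topologicalType) (n : nat) := Chart {
  cdom : set M;
  ccoord : M -> 'rV[R]_n;
  cparam : 'rV[R]_n -> M }.

Definition cim (R : realType) (M : topologicalType) (n : nat)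
  (c : chart R M n) : set 'rV[R]_n := ccoord c @` cdom c.

Definition smooth_atlas (R : realType) (M : topologicalType) (n : nat)
    (A : set (chart R M n)) : Prop :=
  [/\ forall c, A c ->
        [/\ open (cdom c), open (cim c),
            forall p, cdom c p -> cparam c (ccoord c p) = p,
            forall p, cdom c p -> {for p, continuous (ccoord c)}
          & forall x, cim c x -> {for x, continuous (cparam c)}],
      forall p, exists2 c, A c & cdom c p
    & forall c d, A c -> A d ->
        smooth_on (cim c `&` cparam c @^-1` cdom d) (ccoord d \o cparam c)].

Definition smooth_manifold (R : realType) (M : topologicalType) (n : nat)
    (A : set (chart R M n)) : Prop :=
  [/\ hausdorff_space M, @second_countable M & smooth_atlas A].

(* [phi] restricts to a diffeomorphism of the open set [D] onto the open
   set [U], with inverse [tau]. *)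
Definition diffeomorphism (R : realType) (M : topologicalType) (n : nat)
    (A : set (chart R M n)) (V : normedModType R) (D : set V) (U : set M)
    (phi : V -> M) (tau : M -> V) : Prop :=
  [/\ open D /\ open U,
      set_fun D U phi /\ set_fun U D tau,
      {in D, cancel phi tau} /\ {in U, cancel tau phi},
      forall z, D z -> {for z, continuous phi}
    & forall c, A c ->
        smooth_on (D `&` phi @^-1` cdom c) (ccoord c \o phi) /\
        smooth_on (cim c `&` cparam c @^-1` U) (tau \o cparam c)].

(* [G] is a parametrized hypersurface of R^(n+1) and [xi] a transversal field
   along [G].  Tangent vectors are written in the coordinates of the parameter
   domain, so [X : 'rV_n] stands for dG(X) = 'D_X G. *)

(* The rows are xi, dG(e_1), .., dG(e_n); placing xi first makes the block
   size [1 + n] convertible to [n.+1]. *)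
Definition moving_frame (R : realType) (n : nat)
    (G xi : 'rV[R]_n -> 'rV[R]_n.+1) (x : 'rV[R]_n) : 'M[R]_(1 + n) :=
  col_mx (xi x : 'M[R]_(1, 1 + n)) (jacobian G x : 'M[R]_(n, 1 + n)).

Definition frame_coords (R : realType) (n : nat)
    (G xi : 'rV[R]_n -> 'rV[R]_n.+1) (x : 'rV[R]_n) (w : 'rV[R]_n.+1) :
    'rV[R]_(1 + n) :=
  (w : 'rV[R]_(1 + n)) *m invmx (moving_frame G xi x).

(* w = dG(tangential w) + transversal w *: xi *)
Definition transversal_part (R : realType) (n : nat)
    (G xi : 'rV[R]_n -> 'rV[R]_n.+1) (x : 'rV[R]_n) (w : 'rV[R]_n.+1) : R :=
  lsubmx (frame_coords G xi x w) 0 0.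

Definition tangential_part (R : realType) (n : nat)
    (G xi : 'rV[R]_n -> 'rV[R]_n.+1) (x : 'rV[R]_n) (w : 'rV[R]_n.+1) :
    'rV[R]_n :=
  rsubmx (frame_coords G xi x w).

(* Formula of Gauss D_X Y = nabla_X Y + h(X,Y) xi, for the constant
   (coordinate) fields X and Y. *)
Definition affine_metric (R : realType) (n : nat)
    (G xi : 'rV[R]_n -> 'rV[R]_n.+1) (x X Y : 'rV[R]_n) : R :=
  transversal_part G xi x ('D_X ('D_Y G) x).

Definition induced_connection (R : realType) (n : nat)
    (G xi : 'rV[R]_n -> 'rV[R]_n.+1) (x X Y : 'rV[R]_n) : 'rV[R]_n :=
  tangential_part G xi x ('D_X ('D_Y G) x).

(* Formula of Weingarten D_X xi = - S X. *)
Definition shape_operator (R : realType) (n : nat)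
    (G xi : 'rV[R]_n -> 'rV[R]_n.+1) (x X : 'rV[R]_n) : 'rV[R]_n :=
  - tangential_part G xi x ('D_X xi x).

Definition metric_mx (R : realType) (n : nat)
    (G xi : 'rV[R]_n -> 'rV[R]_n.+1) (x : 'rV[R]_n) : 'M[R]_n :=
  \matrix_(i, j) affine_metric G xi x (delta_mx 0 i) (delta_mx 0 j).

(* Levi-Civita connection of h on constant fields X and Y, from the Koszul
   formula
     2 h(nabla_X Y, Z) = X h(Y,Z) + Y h(X,Z) - Z h(X,Y). *)
Definition levi_civita (R : realType) (n : nat)
    (G xi : 'rV[R]_n -> 'rV[R]_n.+1) (x X Y : 'rV[R]_n) : 'rV[R]_n :=
  (\row_l (2^-1 *
     ('D_X (fun y => affine_metric G xi y Y (delta_mx 0 l) : R^o) x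
      + 'D_Y (fun y => affine_metric G xi y X (delta_mx 0 l) : R^o) x
      - 'D_(delta_mx 0 l) (fun y => affine_metric G xi y X Y : R^o) x)))
  *m invmx (metric_mx G xi x).

(* Levi-Civita covariant derivative of an arbitrary field Y along X. *)
Definition levi_civita_deriv (R : realType) (n : nat)
    (G xi : 'rV[R]_n -> 'rV[R]_n.+1) (x X : 'rV[R]_n)
    (Y : 'rV[R]_n -> 'rV[R]_n) : 'rV[R]_n :=
  'D_X Y x + levi_civita G xi x X (Y x).

Definition difference_tensor (R : realType) (n : nat)
    (G xi : 'rV[R]_n -> 'rV[R]_n.+1) (x X Y : 'rV[R]_n) : 'rV[R]_n :=
  induced_connection G xi x X Y - levi_civita G xi x X Y.

(* [G] is a nondegenerate immersed hypersurface on [D] with affine (Blaschke)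
   normal [xi].  Invertibility of the moving frame expresses at once that [G]
   is an immersion and that [xi] is transversal. *)
Definition blaschke_hypersurface (R : realType) (n : nat)
    (D : set 'rV[R]_n) (G xi : 'rV[R]_n -> 'rV[R]_n.+1) : Prop :=
  [/\ smooth_on D G, smooth_on D xi
    & forall x, D x ->
        [/\ moving_frame G xi x \in unitmx,
            metric_mx G xi x \in unitmx,
            forall X, transversal_part G xi x ('D_X xi x) = 0
          & forall X : 'I_n -> 'rV[R]_n,
              `|\det (col_mx (xi x : 'M[R]_(1, 1 + n))
                        (\matrix_(i < n) ('D_(X i) G x : 'rV[R]_(1 + n))))|
              = Num.sqrt
                  `|\det (\matrix_(i, j) affine_metric G xi x (X i) (X j))|]].

Definition positive_definite (R : realType) (n : nat)
    (D : set 'rV[R]_n) (G xi : 'rV[R]_n -> 'rV[R]_n.+1) : Prop :=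
  forall x, D x -> forall X, X != 0 -> 0 < affine_metric G xi x X X.

(* Linear maps of the tangent space act on row vectors on the right. *)
Definition symmetry_group (R : realType) (n : nat)
    (G xi : 'rV[R]_n -> 'rV[R]_n.+1) (x : 'rV[R]_n) : set 'M[R]_n :=
  [set g | [/\ 0 < \det g,
    forall X Y,
      affine_metric G xi x (X *m g) (Y *m g) = affine_metric G xi x X Y,
    forall X, shape_operator G xi x (X *m g) = shape_operator G xi x X *m g
  & forall X Y, difference_tensor G xi x (X *m g) (Y *m g)
                = difference_tensor G xi x X Y *m g]].

Definition SO2 (R : realType) : set 'M[R]_2 :=
  [set g | g *m g^T = 1%:M /\ \det g = 1].

Definition isomorphic_to_SO2 (R : realType) (n : nat) (H : set 'M[R]_n) :
    Prop :=
  exists2 phi : 'M[R]_2 -> 'M[R]_n, set_bij (@SO2 R) H phi &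
    forall g k, SO2 g -> SO2 k -> phi (g *m k) = phi g *m phi k.

Definition isomorphic_to_Z3 (R : realType) (n : nat) (H : set 'M[R]_n) :
    Prop :=
  exists2 phi : 'Z_3 -> 'M[R]_n, set_bij setT H phi &
    forall i j, phi (i + j) = phi i *m phi j.

Definition pointwise_symmetry (R : realType) (M : topologicalType)
    (A : set (chart R M 3)) (F xi : M -> 'rV[R]_4)
    (P : set 'M[R]_3 -> Prop) : Prop :=
  forall c, A c -> forall x, cim c x ->
    P (symmetry_group (F \o cparam c) (xi \o cparam c) x).

Definition SO2_symmetry (R : realType) (M : topologicalType)
    (A : set (chart R M 3)) (F xi : M -> 'rV[R]_4) : Prop :=
  pointwise_symmetry A F xi (@isomorphic_to_SO2 R 3).

Definition Z3_symmetry (R : realType) (M : topologicalType)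
    (A : set (chart R M 3)) (F xi : M -> 'rV[R]_4) : Prop :=
  pointwise_symmetry A F xi (@isomorphic_to_Z3 R 3).

Definition positive_definite_hypersurface (R : realType) (M : topologicalType)
    (n : nat) (A : set (chart R M n)) (F xi : M -> 'rV[R]_n.+1) : Prop :=
  forall c, A c ->
    blaschke_hypersurface (cim c) (F \o cparam c) (xi \o cparam c) /\
    positive_definite (cim c) (F \o cparam c) (xi \o cparam c).

(* Values at [x] of the fields [e1], [e2], [e3] and of the structure
   functions. *)
Definition adapted_frame (R : realType) (G xi : 'rV[R]_3 -> 'rV[R]_4)
    (e1 e2 e3 : 'rV[R]_3 -> 'rV[R]_3) (lambda a mu1 mu2 eta : R)
    (x : 'rV[R]_3) : Prop :=
  let h X Y := affine_metric G xi x X Y in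
  let S X := shape_operator G xi x X in
  let K X Y := difference_tensor G xi x X Y in
  [/\ [/\ h (e1 x) (e1 x) = 1, h (e2 x) (e2 x) = 1, h (e3 x) (e3 x) = 1 &
          [/\ h (e1 x) (e2 x) = 0, h (e1 x) (e3 x) = 0
            & h (e2 x) (e3 x) = 0]],
      [/\ K (e1 x) (e1 x) = (2 * mu1) *: e1 x,
          K (e1 x) (e2 x) = - mu1 *: e2 x
        & K (e1 x) (e3 x) = - mu1 *: e3 x],
      [/\ K (e2 x) (e2 x) = - mu1 *: e1 x + mu2 *: e2 x,
          K (e2 x) (e3 x) = - mu2 *: e3 x
        & K (e3 x) (e3 x) = - mu1 *: e1 x - mu2 *: e2 x],
      [/\ S (e1 x) = lambda *: e1 x, S (e2 x) = a *: e2 x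
        & S (e3 x) = a *: e3 x]
    & forall X, h X (e1 x) = 0 -> levi_civita_deriv G xi x X e1 = eta *: X].

(* [a], [mu1], [eta] are globally defined, while the frame is only local.  The
   global functions fix the local sign of [e1], on which [mu1] and [eta]
   depend. *)
Definition structure_functions (R : realType) (M : topologicalType)
    (A : set (chart R M 3)) (F xi : M -> 'rV[R]_4) (a mu1 eta : M -> R) :
    Prop :=
  forall c, A c -> forall x, cim c x ->
    exists (V : set 'rV[R]_3) (e1 e2 e3 : 'rV[R]_3 -> 'rV[R]_3)
           (lambda mu2 : 'rV[R]_3 -> R),
      [/\ open V, V x, V `<=` cim c,
          [/\ smooth_on V e1, smooth_on V e2 & smooth_on V e3]
        & forall y, V y ->
            adapted_frame (F \o cparam c) (xi \o cparam c) e1 e2 e3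
              (lambda y) (a (cparam c y)) (mu1 (cparam c y)) (mu2 y)
              (eta (cparam c y)) y].

Definition graph_surface (R : realType) (f : 'rV[R]_2 -> R) (w : 'rV[R]_2) :
    'rV[R]_3 :=
  \row_j [:: w 0 0; w 0 1; f w]`_j.

(* Nondegenerate surface [psi] whose affine normal is the constant [nu]. *)
Definition improper_affine_sphere (R : realType) (D : set 'rV[R]_2)
    (psi : 'rV[R]_2 -> 'rV[R]_3) (nu : 'rV[R]_3) : Prop :=
  blaschke_hypersurface D psi (cst nu).

Definition affine_curve (R : realType) (I : set R) (g1 g2 : R -> R) : Prop :=
  [/\ smooth_on (I : set R^o) (g1 : R^o -> R^o),
      smooth_on (I : set R^o) (g2 : R^o -> R^o)
    & forall t, I t ->
        derive1 g1 t * derive1n 2 g2 t - derive1n 2 g1 t * derive1 g2 t != 0].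

Definition cone_immersion (R : realType) (f : 'rV[R]_2 -> R) (g1 g2 : R -> R)
    (t : R) (w : 'rV[R]_2) : 'rV[R]_4 :=
  \row_j [:: g1 t * w 0 0; g1 t * w 0 1; g1 t * f w + g2 t; g1 t]`_j.

(* The surface [E] is, up to an affine transformation, part of the standard
   elliptic paraboloid z = x^2 + y^2. *)
Definition elliptic_paraboloid (R : realType) (E : set 'rV[R]_3) : Prop :=
  exists (Q : 'M[R]_3) (b : 'rV[R]_3), Q \in unitmx /\
    forall y, E y ->
      let z := y *m Q + b in z 0 2 = z 0 0 ^+ 2 + z 0 1 ^+ 2.

(* Main.v *)
(* Put sg = eta - mu1, tu = eta + mu1, so that a = - sg tu, let E_i be
   the image of e_i under dF, and let Z = xi - tu E_1.

   If mu1 vanished at a point, the symmetry group there would contain two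
   elements that do not commute.  By the integrability conditions, e_2 and e_3
   annihilate sg and a and, where sg <> 0, one has e_1 sg = 4 mu1 sg and
     D_{e_i} E_1 = sg E_i,  D_{e_i} Z = 0  (i = 2, 3),  D_{e_1} Z = - tu Z,
   while E_2 and E_3 span a distribution parallel along e_1.  Hence sg^2 solves
   a linear equation along curves and sg vanishes nowhere, since a <> 0
   somewhere.

   Thus Z has a constant direction, F - E_1 / sg is constant modulo Z, and
   span (E_2, E_3, Z) is a constant hyperplane.  In affine coordinates adapted
   to these data the leaves of span (e_2, e_3) are the sections x_4 = t, and
   (t, x_1 / t, x_2 / t) are local coordinates on M.  The third component of F
   is then t f + g_2 (t), and the Hessian of f has constant determinant because
   E_1, E_2, E_3, Z span a constant volume.  If mu2 = 0 the connection rotates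
   E_2, E_3 along a leaf, so the Hessian of f itself is constant.

   The affine coordinates are global: metric and E_1 do not depend on the chart
   or on the frame, and being in normal position is preserved along curves by
   Gronwall's inequality. *)

Require Import Defs.
From HB Require Import structures.
From mathcomp Require Import all_boot all_order all_algebra.
From mathcomp Require Import all_classical all_reals all_analysis.
From mathcomp Require Import ring lra.

Set Implicit Arguments.
Unset Strict Implicit.
Unset Printing Implicit Defensive.

Import Order.TTheory GRing.Theory Num.Theory.
Import numFieldNormedType.Exports.

Local Open Scope classical_set_scope.
Local Open Scope ring_scope.

(** * Smooth maps *)

(** The hypothesis on [a] acts through the factorization a = - sg tu. Since e_2 and e_3 annihilate
    the product and its nonzero factor [sg], they annihilate [tu], hence also [mu1]. The Codazzi
    relations e_i mu1 = 2 mu1 w_i with mu1 <> 0 then kill the components w_2, w_3 of the Levi-Civita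
    derivative of e_1 along itself. The same factorization cancels the leaf derivatives of xi
    against those of tu E_1, which is where [Z] comes from.

    No flow, integral curve or foliation is constructed. The coordinates are explicit functions,
    inverted by the inverse function theorem, and constancy is always tested on straight segments
    inside balls.

    The obstacle to patching is that frames are only local and unrelated on overlaps. But d sg = 4
    mu1 sg h(., e_1), so the global functions already determine [e1], sign included. Between two
    frames only the plane of [e2], [e3] has to be matched, and the conditions of normal position see
    that plane but no basis of it. *)

Lemma derive_foldr_rcons (R : realType) (V W : normedModType R) (f : V -> W)
    (vs : seq V) (v : V) :
  foldr (fun (v : V) (g : V -> W) => 'D_v g) f (rcons vs v) =
  foldr (fun (v : V) (g : V -> W) => 'D_v g) ('D_v f) vs.
Proof. by rewrite foldr_rcons. Qed.

Lemma smooth_on_differentiable (R : realType) (V W : normedModType R)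
    (D : set V) (f : V -> W) (x : V) :
  smooth_on D f -> D x -> differentiable f x.
Proof. by move=> /(_ [::] x). Qed.

Lemma smooth_on_derive (R : realType) (V W : normedModType R)
    (D : set V) (f : V -> W) (v : V) : smooth_on D f -> smooth_on D ('D_v f).
Proof. by move=> sf vs x Dx; rewrite -derive_foldr_rcons; exact: sf. Qed.

Lemma smooth_on_sub (R : realType) (V W : normedModType R)
    (D E : set V) (f : V -> W) : D `<=` E -> smooth_on E f -> smooth_on D f.
Proof. by move=> DE sf vs x /DE; exact: sf. Qed.

Lemma near_eq_differentiable (R : realType) (V W : normedModType R)
    (f g : V -> W) (x : V) :
  (\near x, f x = g x) -> differentiable f x -> differentiable g x.
Proof.
move=> fg /diff_locallyP [dc /eqaddoP df].
have gfx : g x = f x by rewrite (nbhs_singleton fg).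
suff H : g \o shift x = cst (g x) + 'd f x +o_ 0 id.
  have := diff_unique dc H => E.
  by apply/diff_locallyP; rewrite E; split.
apply/eqaddoP => e e0.
have fg0 : \forall h \near (0 : V), f (h + x) = g (h + x).
  move: fg; rewrite (near_shift 0 x) /=.
  by apply: filterS => h; rewrite subr0.
have := df e e0; apply: filter_app.
near=> h; rewrite !fctE /= gfx -(near fg0 h) //.
Unshelve. all: by end_near. Qed.

(* Coinduction: a class of differentiable functions closed under directional
   derivatives (up to equality on [D]) consists of smooth functions. *)
Lemma smooth_on_coind (R : realType) (V W : normedModType R) (D : set V)
    (P : set (V -> W)) : open D ->
  (forall g, P g -> (forall x, D x -> differentiable g x) /\
    forall v, exists2 g', P g' & forall x, D x -> 'D_v g x = g' x) ->
  forall f, P f -> smooth_on D f.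
Proof.
move=> oD HP f Pf vs.
suff [g Pg fg] : exists2 g, P g & forall x, D x ->
    foldr (fun (v : V) (g : V -> W) => 'D_v g) f vs x = g x.
  move=> x Dx; apply: near_eq_differentiable ((HP _ Pg).1 _ Dx).
  by near=> y; rewrite fg //; near: y; exact: open_nbhs_nbhs.
elim: vs => [|v vs [g Pg fg]] /=; first by exists f.
have [_ /(_ v)[g' Pg' gg']] := HP _ Pg.
exists g' => // x Dx; rewrite -gg' //; apply: near_eq_derive.
by near=> y; rewrite fg //; near: y; exact: open_nbhs_nbhs.
Unshelve. all: by end_near. Qed.

Lemma smooth_on_eq (R : realType) (V W : normedModType R) (D : set V)
    (f g : V -> W) : open D -> (forall x, D x -> f x = g x) ->
  smooth_on D f -> smooth_on D g.
Proof.
move=> oD fg sf.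
apply: (@smooth_on_coind _ _ _ _
  [set g | exists2 f, smooth_on D f & forall x, D x -> f x = g x]) => //;
  last by exists f.
move=> {}g [{sf fg}f sf fg]; split=> [x Dx|v].
  apply: near_eq_differentiable (smooth_on_differentiable sf Dx).
  by near=> y; rewrite fg //; near: y; exact: open_nbhs_nbhs.
exists ('D_v f); first by exists ('D_v f) => //; exact: smooth_on_derive.
move=> x Dx; apply: near_eq_derive.
by near=> y; rewrite fg //; near: y; exact: open_nbhs_nbhs.
Unshelve. all: by end_near. Qed.

Lemma smooth_on_cst (R : realType) (V W : normedModType R) (D : set V) (c : W) :
  open D -> smooth_on D (fun=> c).
Proof.
move=> oD; apply: (@smooth_on_coind _ _ _ _ [set f | exists c, f = cst c]) =>
  //;
  last by exists c.
move=> _ [{}c ->]; split=> [x _|v]; first exact: differentiable_cst.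
by exists (cst 0) => [|x _]; [exists 0|rewrite derive_cst].
Qed.

Lemma smooth_on_derivable (R : realType) (V W : normedModType R)
    (D : set V) (f : V -> W) (x v : V) :
  smooth_on D f -> D x -> derivable f x v.
Proof. by move=> sf Dx; exact/diff_derivable/(smooth_on_differentiable sf). Qed.

Lemma smooth_onD (R : realType) (V W : normedModType R) (D : set V)
    (f g : V -> W) : open D -> smooth_on D f -> smooth_on D g ->
  smooth_on D (fun x => f x + g x).
Proof.
move=> oD sf sg.
apply: (@smooth_on_coind _ _ _ _
  [set h | exists f g, [/\ smooth_on D f, smooth_on D g & h = f + g]]) => //;
  last by exists f, g.
move=> _ [{sf}f [{sg}g [sf sg ->]]]; split=> [x Dx|v].
  by apply: differentiableD; exact: smooth_on_differentiable Dx.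
exists ('D_v f + 'D_v g).
  by exists ('D_v f), ('D_v g); split=> //; exact: smooth_on_derive.
by move=> x Dx; rewrite deriveD //; exact: smooth_on_derivable Dx.
Qed.

Lemma smooth_on_sum (R : realType) (V W : normedModType R) (D : set V)
    (I : Type) (r : seq I) (P : pred I) (f : I -> V -> W) : open D ->
  (forall i, smooth_on D (f i)) ->
  smooth_on D (fun x => \sum_(i <- r | P i) f i x).
Proof.
move=> oD sf; elim: r => [|i r IH].
  apply: smooth_on_eq (smooth_on_cst 0 oD) => // x _.
  by rewrite big_nil.
have [Pi|nPi] := boolP (P i).
  apply: smooth_on_eq (smooth_onD oD (sf i) IH) => // x _.
  by rewrite big_cons Pi.
by apply: smooth_on_eq IH => // x _; rewrite big_cons (negPf nPi).
Qed.

Lemma derive_linear_comp (R : realType) (V W W' : normedModType R)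
    (L : {linear W -> W'}) (f : V -> W) (x v : V) :
  continuous L -> differentiable f x -> 'D_v (L \o f) x = L ('D_v f x).
Proof.
move=> cL df; have dL : differentiable L (f x) by exact: linear_differentiable.
rewrite deriveE; last exact: differentiable_comp.
by rewrite diff_comp //= diff_lin // deriveE.
Qed.

Lemma smooth_on_linear (R : realType) (V W W' : normedModType R) (D : set V)
    (L : {linear W -> W'}) (f : V -> W) : open D -> continuous L ->
  smooth_on D f -> smooth_on D (fun x => L (f x)).
Proof.
move=> oD cL sf; apply: (@smooth_on_coind _ _ _ _
  [set h | exists2 f, smooth_on D f & h = L \o f]) => //; last by exists f.
move=> _ [{sf}f sf ->]; split=> [x Dx|v].
  apply: differentiable_comp (smooth_on_differentiable sf Dx) _.
  exact: linear_differentiable.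
exists (L \o 'D_v f); first by exists ('D_v f) => //; exact: smooth_on_derive.
move=> x Dx; rewrite derive_linear_comp //; exact: smooth_on_differentiable Dx.
Qed.

Lemma scale_is_bilinear (R : realType) (W : normedModType R) :
  bilinear_for
    (GRing.Scale.Law.clone _ _ *:%R _) (GRing.Scale.Law.clone _ _ *:%R _)
    (fun (k : R) (w : W) => k *: w).
Proof.
split=> [u'|u] a x y /=.
- by rewrite scalerDl scalerA.
- by rewrite scalerDr !scalerA mulrC.
Qed.

(** Differentiability and Leibniz's rule come together, by viewing scaling as a continuous bilinear
    map composed with the pair of [k] and [f]. *)
Lemma is_diff_scale (R : realType) (V W : normedModType R) (k : V -> R)
    (f : V -> W) (x : V) : differentiable k x -> differentiable f x ->
  differentiable (fun y => k y *: f y) x /\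
  forall v, 'D_v (fun y => k y *: f y) x = 'D_v k x *: f x + k x *: 'D_v f x.
Proof.
pose B := fun (k : R) (w : W) => k *: w.
pose Bm := bilinear_isBilinear.Build R R W W _ _ B (@scale_is_bilinear R W).
pose BL : {bilinear R -> W -> W} := HB.pack B Bm.
move=> dk df.
have cB : continuous (fun p : R * W => BL p.1 p.2) by exact: scale_continuous.
have dp : differentiable (fun y => (k y, f y)) x by exact: differentiable_pair.
have dB := @differentiable_bilin R R W W BL (k x, f x) cB.
have E : (fun y => k y *: f y) =
    (fun p : R * W => BL p.1 p.2) \o (fun y => (k y, f y)) by [].
have dd : differentiable (fun y => k y *: f y) x.
  by rewrite E; exact: differentiable_comp.
split=> // v; rewrite deriveE // E diff_comp // diff_bilin // diff_pair //=.
by rewrite /= -!deriveE // addrC.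
Qed.

Lemma deriveZ_fun (R : realType) (V W : normedModType R) (k : V -> R)
    (f : V -> W) (x v : V) : differentiable k x -> differentiable f x ->
  'D_v (fun y => k y *: f y) x = 'D_v k x *: f x + k x *: 'D_v f x.
Proof. by move=> dk df; exact: (is_diff_scale dk df).2. Qed.

(** Single products are not closed under derivatives, but finite sums of products are: Leibniz's
    rule doubles the number of terms. This class is fed to the coinduction principle. *)
Lemma smooth_onZ (R : realType) (V W : normedModType R) (D : set V)
    (k : V -> R) (f : V -> W) : open D -> smooth_on D k -> smooth_on D f ->
  smooth_on D (fun x => k x *: f x).
Proof.
move=> oD sk sf.
pose P := [set h : V -> W | exists (n : nat) (k : 'I_n -> V -> R)
  (f : 'I_n -> V -> W), [/\ forall i, smooth_on D (k i),
    forall i, smooth_on D (f i) & h = fun x => \sum_i k i x *: f i x]].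
apply: (@smooth_on_coind _ _ _ _ P) => //; last first.
  exists 1%N, (fun=> k), (fun=> f); split=> //.
  by apply/funext => x; rewrite big_ord1.
move=> _ [n [{sk}k [{sf}f [sk sf ->]]]].
have dk i x Dx := smooth_on_differentiable (sk i) (Dx : D x).
have df i x Dx := smooth_on_differentiable (sf i) (Dx : D x).
have E : (fun x => \sum_i k i x *: f i x) = \sum_i (fun x => k i x *: f i x).
  by apply/funext => x; rewrite fct_sumE.
split=> [x Dx|v].
  rewrite E; apply: differentiable_sum => i.
  by apply: (is_diff_scale _ _).1; [exact: dk|exact: df].
exists (fun x => \sum_(i : 'I_(n + n))
    match fintype.split i with
    | inl j => 'D_v (k j) x *: f j x | inr j => k j x *: 'D_v (f j) x end).
  exists (n + n)%N,
    (fun i => match fintype.split i with inl i => 'D_v (k i) | inr i => k i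
      end),
    (fun i => match fintype.split i with inl i => f i | inr i => 'D_v (f i)
      end).
  split=> [i|i|]; try by case: fintype.split => j //; exact: smooth_on_derive.
  by apply/funext => x; apply: eq_bigr => i _; case: fintype.split.
move=> x Dx; rewrite E derive_sum => [|i]; last first.
  apply: diff_derivable; apply: (is_diff_scale _ _).1; [exact: dk|exact: df].
rewrite big_split_ord /= -big_split /=; apply: eq_bigr => i _.
rewrite (deriveZ_fun v (dk i x Dx) (df i x Dx)).
by rewrite -[lshift n i]/(unsplit (inl i)) unsplitK
  -[rshift n i]/(unsplit (inr i)) unsplitK.
Qed.

Lemma smooth_onN (R : realType) (V W : normedModType R) (D : set V)
    (f : V -> W) : open D -> smooth_on D f -> smooth_on D (fun x => - f x).
Proof.
move=> oD sf; apply: smooth_on_eq (smooth_onZ oD (smooth_on_cst (-1 : R) oD)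
  sf) => //.
by move=> x _; rewrite scaleN1r.
Qed.

Lemma smooth_onB (R : realType) (V W : normedModType R) (D : set V)
    (f g : V -> W) : open D -> smooth_on D f -> smooth_on D g ->
  smooth_on D (fun x => f x - g x).
Proof. by move=> oD sf sg; apply: smooth_onD => //; exact: smooth_onN. Qed.

Lemma smooth_onM (R : realType) (V : normedModType R) (D : set V)
    (f g : V -> R) : open D -> smooth_on D f -> smooth_on D g ->
  smooth_on D (fun x => f x * g x).
Proof. by move=> oD sf sg; exact: (smooth_onZ oD sf sg). Qed.

Lemma smooth_onX (R : realType) (V : normedModType R) (D : set V)
    (f : V -> R) (n : nat) : open D -> smooth_on D f ->
  smooth_on D (fun x => f x ^+ n).
Proof.
move=> oD sf; elim: n => [|n IH].
  by apply: smooth_on_eq (smooth_on_cst (1 : R) oD) => // x _; rewrite expr0.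
apply: smooth_on_eq (smooth_onM oD sf IH) => // x _.
by rewrite exprS.
Qed.

Lemma smooth_on_prod (R : realType) (V : normedModType R) (D : set V)
    (I : Type) (r : seq I) (f : I -> V -> R) : open D ->
  (forall i, smooth_on D (f i)) ->
  smooth_on D (fun x => \prod_(i <- r) f i x).
Proof.
move=> oD sf; elim: r => [|i r IH].
  by apply: smooth_on_eq (smooth_on_cst (1 : R) oD) => // x _; rewrite big_nil.
by apply: smooth_on_eq (smooth_onM oD (sf i) IH) => // x _; rewrite big_cons.
Qed.

(** The coinductive class consists of the functions k f^-n; the derivative of such a function is (k'
    f - n k f') f^-(n+1), of the same shape. *)
Lemma smooth_onV (R : realType) (V : normedModType R) (D : set V)
    (f : V -> R) : open D -> smooth_on D f -> (forall x, D x -> f x != 0) ->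
  smooth_on D (fun x => (f x)^-1).
Proof.
move=> oD sf f0.
pose P := [set h : V -> R | exists (k : V -> R) (n : nat),
    smooth_on D k /\ h = fun x => k x * (f x)^-1 ^+ n].
apply: (@smooth_on_coind _ _ _ _ P) => //; last first.
  exists (fun=> 1), 1%N; split; first exact: smooth_on_cst.
  by apply/funext => x; rewrite mul1r.
move=> _ [k [n [sk ->]]].
have df x Dx := smooth_on_differentiable sf (Dx : D x).
have dk x Dx := smooth_on_differentiable sk (Dx : D x).
have dV n' x (Dx : D x) : differentiable (fun y => (f y)^-1 ^+ n') x /\
    forall v, 'D_v (fun y => (f y)^-1 ^+ n') x =
      - (n'%:R * 'D_v f x * (f x)^-1 ^+ n'.+1).
  have dVx : differentiable (fun y => (f y)^-1) x.
    by apply: differentiableV; [exact: df|exact: f0].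
  elim: n' => [|n' [IH1 IH2]].
    split=> [|v]; under eq_fun do rewrite expr0;
      first exact: differentiable_cst.
    by rewrite !mul0r oppr0 [LHS]derive_cst.
  have E : (fun y => (f y)^-1 ^+ n'.+1) = fun y => (f y)^-1 *: (f y)^-1 ^+ n'.
    by apply/funext => y; rewrite exprS.
  have [H1 H2] := is_diff_scale dVx IH1.
  rewrite E; split=> // v; rewrite H2 IH2 deriveV; [|exact: f0|].
    by rewrite /GRing.scale /= -natr1 !exprS; field; exact: f0.
  exact/diff_derivable/df.
split=> [x Dx|v].
  by have [] := is_diff_scale (dk x Dx) (dV n x Dx).1.
exists (fun x => ('D_v k x * f x - n%:R * k x * 'D_v f x) * (f x)^-1 ^+ n.+1).
  exists (fun x => 'D_v k x * f x - n%:R * k x * 'D_v f x), n.+1; split=> //.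
  have sDk := smooth_on_derive v sk; have sDf := smooth_on_derive v sf.
  apply: smooth_onB => //; first exact: smooth_onM.
  by apply: smooth_onM => //; apply: smooth_onM => //; exact: smooth_on_cst.
move=> x Dx; have [_ ->] := is_diff_scale (dk x Dx) (dV n x Dx).1.
by rewrite (dV n x Dx).2 /GRing.scale /= !exprS; field; exact: f0.
Qed.

Lemma continuous_mxE (R : realType) m n (i : 'I_m) (j : 'I_n) :
  continuous (fun A : 'M[R]_(m, n) => A i j).
Proof. by move=> A; apply: differentiable_continuous;
  exact: differentiable_coord. Qed.

Lemma smooth_on_mxE (R : realType) (V : normedModType R) (D : set V) m n
    (f : V -> 'M[R]_(m, n)) (i : 'I_m) (j : 'I_n) :
  open D -> smooth_on D f -> smooth_on D (fun x => f x i j : R).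
Proof.
move=> oD sf.
pose L := fun A : 'M[R]_(m, n) => A i j.
have Ll : linear L by move=> a A B; rewrite /L !mxE.
pose dlM := GRing.isLinear.Build _ _ _ _ _ Ll.
pose dL : {linear 'M[R]_(m, n) -> R} := HB.pack L dlM.
by apply: (@smooth_on_linear _ _ _ _ _ dL) => //; exact: continuous_mxE.
Qed.

Lemma smooth_on_mx (R : realType) (V : normedModType R) (D : set V) m n
    (f : V -> 'M[R]_(m, n)) : open D ->
  (forall i j, smooth_on D (fun x => f x i j : R)) -> smooth_on D f.
Proof.
move=> oD sf.
have sS : smooth_on D (fun x => \sum_i \sum_j f x i j *: delta_mx i j).
  apply: smooth_on_sum => // i; apply: smooth_on_sum => // j.
  by apply: smooth_onZ => //; exact: smooth_on_cst.
by apply: smooth_on_eq sS => // x _; rewrite -matrix_sum_delta.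
Qed.

Lemma derive_mxE (R : realType) (V : normedModType R) m n
    (f : V -> 'M[R]_(m, n)) (x v : V) (i : 'I_m) (j : 'I_n) :
  derivable f x v -> ('D_v f x) i j = 'D_v (fun y => f y i j : R) x.
Proof. by move=> df; rewrite derive_mx // mxE. Qed.

Lemma smooth_on_mulmx (R : realType) (V : normedModType R) (D : set V) m n p
    (f : V -> 'M[R]_(m, n)) (g : V -> 'M[R]_(n, p)) : open D ->
  smooth_on D f -> smooth_on D g -> smooth_on D (fun x => f x *m g x).
Proof.
move=> oD sf sg; apply: smooth_on_mx => // i j.
have sS : smooth_on D (fun x => \sum_k f x i k * g x k j : R).
  by apply: smooth_on_sum => // k; apply: smooth_onM => //;
    exact: smooth_on_mxE.
by apply: smooth_on_eq sS => // x _; rewrite mxE.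
Qed.

Lemma derive_mulmx (R : realType) (V : normedModType R) m n p
    (f : V -> 'M[R]_(m, n)) (g : V -> 'M[R]_(n, p)) (x v : V) :
  differentiable f x -> differentiable g x ->
  'D_v (fun y => f y *m g y) x = 'D_v f x *m g x + f x *m 'D_v g x.
Proof.
move=> df dg.
have dfe i j : differentiable (fun y => f y i j : R) x.
  by apply: (@differentiable_comp _ _ _ _ f (fun A => A i j)) => //;
    exact: differentiable_coord.
have dge i j : differentiable (fun y => g y i j : R) x.
  by apply: (@differentiable_comp _ _ _ _ g (fun A => A i j)) => //;
    exact: differentiable_coord.
have E i j : (fun y => (f y *m g y) i j) =
    \sum_k (fun y => f y i k *: (g y k j : R)).
  by apply/funext => y; rewrite mxE fct_sumE.
have dE i j k : differentiable (fun y => f y i k *: (g y k j : R)) x.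
  by apply: (is_diff_scale _ _).1.
have dF : derivable (fun y => f y *m g y) x v.
  apply/derivable_mxP => i j; rewrite E; apply: derivable_sum => k.
  exact: diff_derivable.
apply/matrixP => i j; rewrite derive_mxE // E derive_sum => [|k]; last first.
  exact: diff_derivable.
rewrite !mxE -big_split /=; apply: eq_bigr => k _.
rewrite deriveZ_fun // !derive_mxE //; exact: diff_derivable.
Qed.

Lemma smooth_on_det (R : realType) (V : normedModType R) (D : set V) n
    (f : V -> 'M[R]_n) : open D -> smooth_on D f ->
  smooth_on D (fun x => \det (f x) : R).
Proof.
move=> oD sf; apply: smooth_on_sum => // s; apply: smooth_onM => //.
  exact: smooth_on_cst.
by apply: smooth_on_prod => // i; exact: smooth_on_mxE.
Qed.

(** Cramer's rule: the entries are polynomials in those of [f x], divided by the determinant. *)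
Lemma smooth_on_invmx (R : realType) (V : normedModType R) (D : set V) n
    (f : V -> 'M[R]_n) : open D -> smooth_on D f ->
  (forall x, D x -> f x \in unitmx) -> smooth_on D (fun x => invmx (f x)).
Proof.
move=> oD sf uf.
have sS : smooth_on D (fun x => (\det (f x))^-1 *: \adj (f x)).
  apply: smooth_onZ => //.
    apply: smooth_onV => //; first exact: smooth_on_det.
    by move=> x /uf; rewrite unitmxE unitfE.
  apply: smooth_on_mx => // i j.
  have sS : smooth_on D (fun x => (-1) ^+ (j + i) * \det (row' j (col' i (f
    x))) : R).
    apply: smooth_onM => //; first exact: smooth_on_cst.
    apply: smooth_on_det => //; apply: smooth_on_mx => // k l.
    apply: smooth_on_eq (smooth_on_mxE (lift j k) (lift i l) oD sf) => // x _.
    by rewrite !mxE.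
  by apply: smooth_on_eq sS => // x _; rewrite !mxE.
by apply: smooth_on_eq sS => // x Dx; rewrite /invmx uf.
Qed.

Lemma derive_dir (R : realType) (V W : normedModType R) (f : V -> W) (x : V)
    (I : Type) (r : seq I) (c : I -> R) (v : I -> V) : differentiable f x ->
  'D_(\sum_(i <- r) c i *: v i) f x = \sum_(i <- r) c i *: 'D_(v i) f x.
Proof.
move=> df; rewrite deriveE // linear_sum; apply: eq_bigr => i _.
by rewrite linearZ /= deriveE.
Qed.

Lemma derive_dirD (R : realType) (V W : normedModType R) (f : V -> W)
    (x u v : V) : differentiable f x -> 'D_(u + v) f x = 'D_u f x + 'D_v f x.
Proof. by move=> df; rewrite !deriveE // linearD. Qed.

Lemma derive_dirZ (R : realType) (V W : normedModType R) (f : V -> W)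
    (x v : V) (c : R) : differentiable f x -> 'D_(c *: v) f x = c *: 'D_v f x.
Proof. by move=> df; rewrite !deriveE // linearZ. Qed.

Lemma derive_dirN (R : realType) (V W : normedModType R) (f : V -> W)
    (x v : V) : differentiable f x -> 'D_(- v) f x = - 'D_v f x.
Proof. by move=> df; rewrite !deriveE // linearN. Qed.

Lemma derive_comp (R : realType) (V V' W : normedModType R) (f : V -> V')
    (g : V' -> W) (x v : V) :
  differentiable f x -> differentiable g (f x) ->
  'D_v (g \o f) x = 'D_('D_v f x) g (f x).
Proof.
move=> df dg; rewrite deriveE; last exact: differentiable_comp.
by rewrite diff_comp //= -deriveE // -deriveE.
Qed.

Lemma derive_rV (R : realType) (W : normedModType R) n (f : 'rV[R]_n -> W)
    (x v : 'rV[R]_n) : differentiable f x ->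
  'D_v f x = \sum_k v 0 k *: 'D_(delta_mx 0 k) f x.
Proof.
move=> df; rewrite -derive_dir //; congr ('D_ _ f x).
by rewrite [LHS]row_sum_delta.
Qed.

Lemma smooth_on_dd (R : realType) (W : normedModType R) n (D : set 'rV[R]_n)
    (X : 'rV[R]_n -> 'rV[R]_n) (f : 'rV[R]_n -> W) : open D ->
  smooth_on D X -> smooth_on D f -> smooth_on D (fun y => 'D_(X y) f y).
Proof.
move=> oD sX sf.
have sS : smooth_on D (fun y => \sum_k X y 0 k *: 'D_(delta_mx 0 k) f y).
  apply: smooth_on_sum => // k; apply: smooth_onZ => //.
    exact: smooth_on_mxE.
  exact: smooth_on_derive.
apply: smooth_on_eq sS => // x Dx; rewrite [RHS]derive_rV //.
exact: smooth_on_differentiable Dx.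
Qed.

(** The class of sums of k_i (g_i o f) is closed under derivatives by the chain rule. The middle
    space is a space of row vectors so that the direction 'D_v f x can be expanded in a finite
    basis, its coordinates joining the coefficients. *)
Lemma smooth_on_comp (R : realType) (V W : normedModType R) n
    (D : set V) (E : set 'rV[R]_n) (f : V -> 'rV[R]_n) (g : 'rV[R]_n -> W) :
  open D -> (forall x, D x -> E (f x)) -> smooth_on D f -> smooth_on E g ->
  smooth_on D (g \o f).
Proof.
move=> oD DE sf sg.
pose P := [set h : V -> W | exists (N : nat) (k : 'I_N -> V -> R)
  (g : 'I_N -> 'rV[R]_n -> W), [/\ forall i, smooth_on D (k i),
    forall i, smooth_on E (g i) & h = fun x => \sum_i k i x *: g i (f x)]].
apply: (@smooth_on_coind _ _ _ _ P) => //; last first.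
  exists 1%N, (fun _ _ => 1), (fun=> g); split=> //.
    by move=> i; exact: smooth_on_cst.
  by apply/funext => x; rewrite big_ord1 scale1r.
move=> _ [N [k [{sg}g [sk sg ->]]]].
have df x Dx := smooth_on_differentiable sf (Dx : D x).
have dk i x Dx := smooth_on_differentiable (sk i) (Dx : D x).
have dg i x (Dx : D x) := smooth_on_differentiable (sg i) (DE _ Dx).
have dgf i x (Dx : D x) : differentiable (fun x => g i (f x)) x.
  by apply: (@differentiable_comp _ _ _ _ f (g i)); [exact: df|exact: dg].
have eE : (fun x => \sum_i k i x *: g i (f x)) =
    \sum_i (fun x => k i x *: g i (f x)).
  by apply/funext => x; rewrite fct_sumE.
have dkg i x (Dx : D x) : differentiable (fun x => k i x *: g i (f x)) x.
  by apply: (is_diff_scale _ _).1; [exact: dk|exact: dgf].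
split=> [x Dx|v].
  by rewrite eE; apply: differentiable_sum => i; exact: dkg.
exists (fun x => \sum_i ('D_v (k i) x *: g i (f x) +
    \sum_j (k i x * 'D_v f x 0 j) *: 'D_(delta_mx 0 j) (g i) (f x))).
  (* Index [None] carries the term in which the coefficient is differentiated, [Some j] the one in
     which [g i] is differentiated along the basis vector [j]. *)
  pose T := ('I_N * option 'I_n)%type.
  pose kk (p : T) x := match p.2 with
    | None => 'D_v (k p.1) x | Some j => k p.1 x * 'D_v f x 0 j end.
  pose gg (p : T) := match p.2 with
    | None => g p.1 | Some j => 'D_(delta_mx 0 j) (g p.1) end.
  have skk p : smooth_on D (kk p).
    case: p => i [j|]; rewrite /kk /=; last exact: smooth_on_derive.
    apply: smooth_onM => //; apply: smooth_on_mxE => //.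
    exact: smooth_on_derive.
  have sgg p : smooth_on E (gg p).
    by case: p => i [j|]; rewrite /gg //=; exact: smooth_on_derive.
  exists #|{: T}|, (fun i => kk (enum_val i)), (fun i => gg (enum_val i)).
  split=> //; apply/funext => x.
  rewrite -(@big_enum_val _ _ _ T predT (fun p => kk p x *: gg p (f x))) /=.
  rewrite -(pair_bigA _ (fun i o => kk (i, o) x *: gg (i, o) (f x))) /=.
  apply: eq_bigr => i _.
  rewrite (bigD1 None) //= (reindex_omap Some id) /=; last by case.
  by congr (_ + _); apply: eq_big => // j; rewrite eqxx.
move=> x Dx; rewrite eE derive_sum => [|i]; last exact/diff_derivable/dkg.
apply: eq_bigr => i _; rewrite deriveZ_fun; [|exact: dk|exact: dgf].
congr (_ + _); rewrite (derive_comp _ (df x Dx) (dg i x Dx)).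
rewrite derive_rV; last exact: dg.
by rewrite scaler_sumr; apply: eq_bigr => j _; rewrite scalerA.
Qed.

(** * Gronwall's inequality and Schwarz's theorem *)

Lemma is_derive_line (R : realType) (V W : normedModType R) (f : V -> W)
    (x v : V) (s : R) : differentiable f (x + s *: v) ->
  is_derive s (1 : R) (fun s => f (x + s *: v)) ('D_v f (x + s *: v)).
Proof.
move=> df; set l := fun s : R => x + s *: v.
have [dl Dl] : is_diff_def (Phantom _ (nbhs s)) l ( *:%R^~ v).
  have -> : l = cst x + ( *:%R^~ v) by apply/funext.
  rewrite -[( *:%R^~ v) in X in is_diff_def _ _ X]add0r.
  exact: is_diffD.
have E : (fun s => f (x + s *: v)) = f \o l by [].
have dfl : differentiable (f \o l) s by exact: differentiable_comp.
rewrite E; split; first exact: diff_derivable.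
by rewrite derive_comp // (deriveE _ dl) Dl /= scale1r.
Qed.

Lemma mean_value_line (R : realType) (V : normedModType R) (f : V -> R)
    (x v : V) :
  (forall s : R, 0 <= s <= 1 -> differentiable f (x + s *: v)) ->
  exists2 s, 0 < s < 1 & f (x + v) - f x = 'D_v f (x + s *: v).
Proof.
move=> df.
have [s||] := @MVT R (fun s => f (x + s *: v))
  (fun s => 'D_v f (x + s *: v)) 0 1 ltr01.
- rewrite in_itv /= => /andP[s0 s1]; apply: is_derive_line; apply: df.
  by rewrite !ltW.
- apply: derivable_within_continuous; move=> s; rewrite in_itv /= => s01.
  by case: (is_derive_line (df s s01)).
move=> s; rewrite in_itv /= => s01;
  rewrite subr0 mulr1 scale1r scale0r addr0 => ->.
by exists s.
Qed.

(** Multiplied by exp(- C s), the function [m] is nonincreasing along the segment, so a nonpositive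
    initial value gives a nonpositive final one. *)
Lemma gronwall_line (R : realType) (V : normedModType R) (m : V -> R)
    (x v : V) (C : R) :
  (forall s : R, 0 <= s <= 1 -> differentiable m (x + s *: v)) ->
  (forall s : R, 0 <= s <= 1 -> 'D_v m (x + s *: v) <= C * m (x + s *: v)) ->
  m x <= 0 -> m (x + v) <= 0.
Proof.
move=> dm Dm m0.
pose g (s : R) := m (x + s *: v) * expR (- C * s).
have ide (s : R) : is_derive s (1 : R) (fun s => expR (- C * s))
    (- C * expR (- C * s)).
  have lin : is_derive s (1 : R) (fun s => - C * s) (- C).
    have := @is_deriveZ R R R id (- C) s 1 1 _.
    by rewrite /GRing.scale /= mulr1; apply.
  have := @is_derive1_comp R expR (fun s => - C * s) s _ _
    (is_derive_expR (- C * s)) lin.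
  by rewrite /= mulrC.
have gd (s : R) : 0 <= s <= 1 -> is_derive s (1 : R) g
    (('D_v m (x + s *: v) - C * m (x + s *: v)) * expR (- C * s)).
  move=> s01; have h1 := is_derive_line (dm s s01).
  have := is_deriveM h1 (ide s); rewrite /GRing.scale /= => H.
  by apply: is_derive_eq; lra.
have g10 : g 1 <= g 0.
  apply: (@ler0_derive1_nincr R g 0 1) => //.
  - move=> s; rewrite in_itv /= => /andP[s0 s1].
    have s01 : 0 <= s <= 1 by rewrite !ltW.
    by case: (gd s s01).
  - move=> s; rewrite in_itv /= => /andP[s0 s1].
    have s01 : 0 <= s <= 1 by rewrite !ltW.
    rewrite derive1E (@derive_val _ _ _ _ _ _ _ (gd s s01)).
    by rewrite mulr_le0_ge0 ?expR_ge0 // subr_le0; exact: Dm.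
  - by apply: derivable_within_continuous; move=> s;
      rewrite in_itv /= => /gd [].
have : m (x + v) * expR (- C * 1) <= 0.
  by apply: le_trans m0; move: g10;
    rewrite /g mulr0 expR0 mulr1 scale0r addr0 scale1r.
by rewrite pmulr_lle0 // expR_gt0.
Qed.

Lemma derive0_line (R : realType) (V : normedModType R) (f : V -> R)
    (x v : V) :
  (forall s : R, 0 <= s <= 1 -> differentiable f (x + s *: v)) ->
  (forall s : R, 0 <= s <= 1 -> 'D_v f (x + s *: v) = 0) ->
  f (x + v) = f x.
Proof.
move=> df Df; have [s /andP[s0 s1]] := mean_value_line df.
by rewrite Df ?ltW // => /eqP; rewrite subr_eq0 => /eqP.
Qed.

Lemma ball_line (R : realType) (V : normedModType R) (c x y : V) (r s : R) :
  ball c r x -> ball c r y -> 0 <= s <= 1 -> ball c r (x + s *: (y - x)).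
Proof.
rewrite -!ball_normE /= => cx cy /andP[s0 s1].
have -> : c - (x + s *: (y - x)) = (1 - s) *: (c - x) + s *: (c - y).
  rewrite scalerBl scale1r addrAC -addrA -scalerBr.
  have -> : c - y - (c - x) = - (y - x).
    by rewrite [RHS]opprB [- (c - x)]opprB addrC addrA subrK.
  by rewrite scalerN opprD addrA.
rewrite (le_lt_trans (ler_normD _ _)) // !normrZ !ger0_norm ?subr_ge0 //.
have -> : r = (1 - s) * r + s * r by lra.
(* For s < 1 the strict inequality comes from the weight 1 - s; at s = 1 this weight vanishes and
   the bound on [y] gives it directly. *)
have [-> |s1'] := eqVneq s 1; first by rewrite subrr !mul0r !add0r !mul1r.
apply: ltr_leD.
  by rewrite ltr_pM2l // subr_gt0 lt_neqAle s1'.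
by rewrite ler_wpM2l // ltW.
Qed.

Lemma derive_shiftE (R : realType) (V W : normedModType R) (f : V -> W)
    (x v w : V) : differentiable f (x + w) ->
  differentiable (fun y => f (y + w)) x /\
  'D_v (fun y => f (y + w)) x = 'D_v f (x + w).
Proof.
move=> df.
have [ds Ds] : is_diff_def (Phantom _ (nbhs x)) (fun y : V => y + w) id.
  have -> : (fun y : V => y + w) = id + cst w by apply/funext.
  rewrite -[id in X in is_diff_def _ _ X]addr0.
  exact: is_diffD.
have E : (fun y => f (y + w)) = f \o (fun y => y + w) by [].
rewrite E; split; first exact: differentiable_comp.
by rewrite derive_comp // (deriveE _ ds) Ds.
Qed.

(* The second difference of [f] is symmetric in [u] and [v], and two uses of
   the mean value theorem turn it into a mixed derivative. *)
Lemma second_difference (R : realType) (V : normedModType R) (D : set V)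
    (f : V -> R) (x u v : V) (r : R) : open D -> smooth_on D f ->
  ball x r `<=` D -> `|u| + `|v| < r ->
  exists2 p, ball x r p &
    f (x + u + v) - f (x + u) - (f (x + v) - f x) = 'D_v ('D_u f) p.
Proof.
move=> oD sf BD uvr.
have inB (s t : R) : 0 <= s <= 1 -> 0 <= t <= 1 -> ball x r (x + s *: u + t *:
  v).
  move=> /andP[s0 s1] /andP[t0 t1].
  rewrite -ball_normE /= -addrA opprD addNKr normrN.
  apply: le_lt_trans uvr; apply: (le_trans (ler_normD _ _)).
  by rewrite !normrZ !ger0_norm // lerD // ler_piMl.
have z01 : 0 <= (0 : R) <= 1 by rewrite lexx ler01.
have o01 : 0 <= (1 : R) <= 1 by rewrite lexx ler01.
have dfD y : ball x r y -> differentiable f y.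
  by move=> /BD; exact: smooth_on_differentiable.
pose g y := f (y + v) - f y.
have dg (s : R) : 0 <= s <= 1 -> differentiable g (x + s *: u) /\
    'D_u g (x + s *: u) = 'D_u f (x + s *: u + v) - 'D_u f (x + s *: u).
  move=> s01.
  have d1 : differentiable f (x + s *: u + v).
    by apply: dfD; have := inB s 1 s01 o01; rewrite scale1r.
  have d2 : differentiable f (x + s *: u).
    by apply: dfD; have := inB s 0 s01 z01; rewrite scale0r addr0.
  have [d3 E3] := derive_shiftE u d1.
  have -> : g = (fun y => f (y + v)) - f by [].
  split; first exact: differentiableB.
  by rewrite deriveB ?E3 //; exact: diff_derivable.
have [s s01] := @mean_value_line _ _ g x u (fun s h => (dg s h).1).
rewrite {1 2}/g => gE; have s01' : 0 <= s <= 1 by case/andP: s01 => *;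
  rewrite !ltW.
have [|t t01 E] := @mean_value_line _ _ ('D_u f) (x + s *: u) v.
  move=> t t01.
  apply: smooth_on_differentiable (BD _ (inB s t s01' t01)).
  exact: smooth_on_derive.
have t01' : 0 <= t <= 1 by case/andP: t01 => *; rewrite !ltW.
exists (x + s *: u + t *: v); first exact: inB.
by rewrite -E -(dg s s01').2 -gE; lra.
Qed.

(** Mean value arguments give equal values at two different unknown points; continuity lets both
    points shrink to [x]. *)
Lemma continuous_meet (R : realType) (V : normedModType R) (f g : V -> R)
    (x : V) : {for x, continuous f} -> {for x, continuous g} ->
  (forall r, 0 < r ->
     exists p q, [/\ ball x r p, ball x r q & f p = g q]) -> f x = g x.
Proof.
move=> cf cg H; apply/eqP; rewrite -subr_eq0 -normr_le0;
  apply/ler_addgt0Pr => e e0.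
have e20 : 0 < e / 2 by rewrite divr_gt0.
move/cvgrPdist_lt : cf => /(_ _ e20) /nbhs_ballP [r1 /= r10 h1].
move/cvgrPdist_lt : cg => /(_ _ e20) /nbhs_ballP [r2 /= r20 h2].
have [|p [q [Bp Bq E]]] := H (Num.min r1 r2); first by rewrite lt_min r10.
have /h1 /= Fp : ball x r1 p by apply: le_ball Bp; rewrite ge_min lexx.
have /h2 /= Gq : ball x r2 q by apply: le_ball Bq; rewrite ge_min lexx orbT.
have -> : f x - g x = (f x - f p) - (g x - g q) by rewrite E; lra.
by rewrite add0r (splitr e) (le_trans (ler_normB _ _)) // lerD // ltW.
Qed.

Lemma derive2Z (R : realType) (V W : normedModType R) (D : set V)
    (f : V -> W) (h : R) (w z : V) (y : V) : open D -> smooth_on D f -> D y ->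
  'D_(h *: w) ('D_(h *: z) f) y = h ^+ 2 *: 'D_w ('D_z f) y.
Proof.
move=> oD sf Dy.
have dz := smooth_on_differentiable (smooth_on_derive z sf) Dy.
transitivity ('D_(h *: w) (h \*: 'D_z f) y).
  apply: near_eq_derive; near=> y'; apply: derive_dirZ.
  apply: (smooth_on_differentiable sf); near: y'.
  exact: open_nbhs_nbhs.
rewrite deriveZ; last exact: diff_derivable.
by rewrite derive_dirZ // scalerA expr2.
Unshelve. all: by end_near. Qed.

(** One second difference, read in the two orders, equals each mixed derivative at some point of an
    arbitrarily small ball. The increments are scaled by [h] to stay in the ball, and the factor h^2
    cancels. *)
Lemma schwarz_scalar (R : realType) (V : normedModType R) (D : set V)
    (f : V -> R) (x u v : V) : open D -> smooth_on D f -> D x ->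
  'D_u ('D_v f) x = 'D_v ('D_u f) x.
Proof.
move=> oD sf Dx.
apply: (@continuous_meet _ _ ('D_u ('D_v f)) ('D_v ('D_u f))).
- apply: differentiable_continuous; apply: smooth_on_differentiable Dx.
  by do 2 apply: smooth_on_derive.
- apply: differentiable_continuous; apply: smooth_on_differentiable Dx.
  by do 2 apply: smooth_on_derive.
move=> r' r'0.
have /nbhs_ballP[r'' /= r''0 Dr''] := open_nbhs_nbhs (conj oD Dx).
pose r := Num.min r' r''.
have r0 : 0 < r by rewrite lt_min r'0.
have Br' : ball x r `<=` ball x r' by apply: le_ball; rewrite ge_min lexx.
have BD : ball x r `<=` D.
  by move=> y By; apply: Dr''; apply: le_ball By; rewrite ge_min lexx orbT.
(* The summand 1 keeps the denominator positive when both directions vanish. *)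
pose h := r / (2 * (`|u| + `|v| + 1)).
have uv0 : 0 < `|u| + `|v| + 1 by rewrite ltr_wpDl // addr_ge0.
have h0 : 0 < h by rewrite divr_gt0 // mulr_gt0.
have hlt : `|h *: u| + `|h *: v| < r.
  have -> : `|h *: u| + `|h *: v| = h * (`|u| + `|v|).
    by rewrite mulrDr normrZ gtr0_norm //; congr (_ + _);
      rewrite normrZ gtr0_norm.
  have Er : r = h * (2 * (`|u| + `|v| + 1)) by rewrite divfK // gt_eqF //
    mulr_gt0.
  rewrite [ltRHS]Er ltr_pM2l //; have := normr_ge0 u; have := normr_ge0 v; lra.
have [p Bp Ep] := second_difference oD sf BD hlt.
have hlt' : `|h *: v| + `|h *: u| < r by rewrite addrC.
have [q Bq Eq] := second_difference oD sf BD hlt'.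
exists q, p; split; [exact: Br'|exact: Br'|].
apply: (@mulfI _ (h ^+ 2)); first by rewrite expf_neq0 // gt_eqF.
have Sq := etrans Eq (derive2Z h u v oD sf (BD _ Bq)).
have Sp := etrans Ep (derive2Z h v u oD sf (BD _ Bp)).
apply: (etrans (esym Sq)); apply: etrans Sp.
by rewrite [x + _ + _]addrAC; ring.
Qed.

Lemma schwarz (R : realType) (V : normedModType R) (D : set V) m n
    (f : V -> 'M[R]_(m, n)) (x u v : V) : open D -> smooth_on D f -> D x ->
  'D_u ('D_v f) x = 'D_v ('D_u f) x.
Proof.
move=> oD sf Dx; apply/matrixP => i j.
have E w z : ('D_w ('D_z f) x) i j = 'D_w ('D_z (fun y => f y i j : R)) x.
  rewrite derive_mxE; last first.
    by apply: smooth_on_derivable Dx; exact: smooth_on_derive.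
  apply: near_eq_derive; near=> y; apply: derive_mxE.
  apply: smooth_on_derivable sf _; near: y; exact: open_nbhs_nbhs.
exact: (etrans (E u v) (etrans
  (schwarz_scalar u v oD (smooth_on_mxE i j oD sf) Dx) (esym (E v u)))).
Unshelve. all: by end_near. Qed.

Lemma smooth_on_id (R : realType) (V : normedModType R) (D : set V) :
  open D -> smooth_on D (id : V -> V).
Proof.
move=> oD; apply: (@smooth_on_coind _ _ _ _
  [set f | f = id \/ exists c, f = cst c]) => //; last by left.
move=> _ [->|[c ->]]; split=> [x _|v].
- by have [] := is_diff_id x.
- by exists (cst v) => [|x _]; [right; exists v|rewrite derive_id].
- exact: differentiable_cst.
- by exists (cst 0) => [|x _]; [right; exists 0|rewrite derive_cst].
Qed.

Lemma smooth_on_continuous (R : realType) (V W : normedModType R) (D : set V)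
    (f : V -> W) (x : V) : smooth_on D f -> D x -> {for x, continuous f}.
Proof.
by move=> sf Dx; apply: differentiable_continuous;
  exact: smooth_on_differentiable Dx.
Qed.

Lemma mx_entry_le_norm (R : realType) m n (A : 'M[R]_(m, n)) i j :
  `|A i j| <= `|A|.
Proof.
rewrite [leRHS]/Num.Def.normr/= mx_normrE.
exact: (le_bigmax _ (fun ij => `|A ij.1 ij.2|) (i, j)).
Qed.

Lemma mx_norm_le (R : realType) m n (A : 'M[R]_(m, n)) (e : R) : 0 <= e ->
  (forall i j, `|A i j| <= e) -> `|A| <= e.
Proof.
move=> e0 H; rewrite [leLHS]/Num.Def.normr/= mx_normrE.
by apply: bigmax_le => // -[i j] _ /=.
Qed.

Lemma mulmxr_lipschitz (R : realType) m n p (A : 'M[R]_(n, p)) :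
  exists2 k : R, 0 < k & forall v : 'M[R]_(m, n), `|v *m A| <= k * `|v|.
Proof.
have c : continuous (mulmxr A : 'M[R]_(m, n) -> 'M[R]_(m, p)).
  move=> v; apply: (@smooth_on_continuous _ _ _ setT) => //.
  apply: smooth_on_mulmx; [exact: openT|exact/smooth_on_id/openT|].
  exact/smooth_on_cst/openT.
by have [k k0 H] := linear_lipschitz c; exists k.
Qed.

Lemma smooth_on_jacobian (R : realType) n p (D : set 'rV[R]_n)
    (f : 'rV[R]_n -> 'rV[R]_p) : open D -> smooth_on D f ->
  smooth_on D (jacobian f).
Proof.
move=> oD sf; apply: smooth_on_mx => // i j.
apply: smooth_on_eq (smooth_on_mxE 0 j oD (smooth_on_derive (delta_mx 0 i) sf))
  => //.
move=> x Dx; rewrite /jacobian mxE deriveE //.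
exact: smooth_on_differentiable Dx.
Qed.

(** * The inverse function theorem *)

Lemma derive_mulmxr (R : realType) (V : normedModType R) m n p
    (f : V -> 'M[R]_(m, n)) (A : 'M[R]_(n, p)) (x v : V) :
  differentiable f x -> 'D_v (fun y => f y *m A) x = 'D_v f x *m A.
Proof.
move=> df; rewrite derive_mulmx //.
have -> : 'D_v (fun=> A) x = 0 by exact: derive_cst.
by rewrite mulmx0 addr0.
Qed.

(** The displacement |k y - y| attains its minimum on the compact ball. Applying [k] to a minimizer
    would at least halve the displacement, so the minimum is 0. *)
Lemma contraction_fixed_point (R : realType) n (c : 'rV[R]_n) (r : R)
    (k : 'rV[R]_n -> 'rV[R]_n) : 0 < r ->
  (forall y, `|y - c| <= r -> {for y, continuous k}) ->
  (forall y, `|y - c| <= r -> `|k y - c| <= r) ->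
  (forall y z, `|y - c| <= r -> `|z - c| <= r ->
     `|k y - k z| <= 2^-1 * `|y - z|) ->
  exists2 y, `|y - c| <= r & k y = y.
Proof.
move=> r0 ck sk lk.
set B := [set y | `|y - c| <= r].
have B0 : B !=set0 by exists c; rewrite /B /= subrr normr0 ltW.
have cB : compact B.
  have EB : B = closed_ball c r.
    by rewrite closed_ballE //; apply/seteqP; split=> y;
      rewrite /B /closed_ball_ /= distrC.
  apply: bounded_closed_compact; last by rewrite EB; exact: closed_ball_closed.
  exists (r + `|c|); split; first by rewrite num_real.
  move=> M rM y By /=; apply: le_trans (ltW rM).
  rewrite -[y](subrK c); apply: le_trans (ler_normD _ _) _.
  by rewrite lerD2r.
have cf : {within B, continuous (fun y => `|k y - y|)}.
  apply: continuous_in_subspaceT => y; rewrite inE => By.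
  have cy : {for y, continuous (fun y : 'rV[R]_n => k y - y)}.
    by apply: (@continuousB _ _ _ k id); [exact: ck|exact: id].
  exact: continuous_comp cy (@norm_continuous _ _ _).
have [y yB miny] := EVT_min_rV B0 cB cf.
rewrite inE in yB; exists y => //; apply/eqP; rewrite -subr_eq0 -normr_le0.
have kB : B (k y) by exact: sk.
have := miny (k y); rewrite inE => /(_ kB) h1.
have := lk _ _ kB yB.
by move=> h2; have := le_trans h1 h2; lra.
Qed.

Lemma differentiable_of_bound (R : realType) (V W : normedModType R)
    (f : V -> W) (z : V) (L : {linear V -> W}) : continuous L ->
  (forall e, 0 < e ->
     \forall h \near (0 : V), `|f (h + z) - (f z + L h)| <= e * `|h|) ->
  differentiable f z /\ forall v, 'D_v f z = L v.
Proof.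
move=> cL H.
have E : f \o shift z = cst (f z) + L +o_ 0 id by apply/eqaddoP => e /H.
have dE := diff_unique cL E.
have dd : differentiable f z by apply/diff_locallyP; rewrite dE; split.
by split=> // v; rewrite deriveE // dE.
Qed.

(** Newton's map y - T y P, with P the inverse Jacobian at [x], has small derivative near [x].
    Solving T y = z is then a fixed point problem for a contraction with factor 1/2. *)
Lemma inverse_function (R : realType) n (D : set 'rV[R]_n)
    (T : 'rV[R]_n -> 'rV[R]_n) (x : 'rV[R]_n) :
  open D -> D x -> smooth_on D T ->
  (forall y, D y -> jacobian T y \in unitmx) ->
  exists (U W : set 'rV[R]_n) (phi : 'rV[R]_n -> 'rV[R]_n),
    [/\ open U /\ open W, U x /\ U `<=` D,
        forall y, U y -> W (T y) /\ phi (T y) = y,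
        forall z, W z -> U (phi z) /\ T (phi z) = z
      & smooth_on W phi].
Proof.
move=> oD Dx sT uJ.
set P := invmx (jacobian T x).
have dT y : D y -> differentiable T y by exact: smooth_on_differentiable.
pose S y := y - T y *m P.
pose E y : 'M[R]_n := 1%:M - jacobian T y *m P.
have sJ := smooth_on_jacobian oD sT.
have sE : smooth_on D E.
  apply: smooth_onB => //; first exact: smooth_on_cst.
  by apply: smooth_on_mulmx => //; exact: smooth_on_cst.
have sS : smooth_on D S.
  apply: smooth_onB => //; first exact: smooth_on_id.
  by apply: smooth_on_mulmx => //; exact: smooth_on_cst.
have DS v y : D y -> 'D_v S y = v *m E y.
  move=> Dy; have -> : S = id - (fun y => T y *m P) by [].
  have sTP : smooth_on D (fun y => T y *m P).
    by apply: smooth_on_mulmx => //; exact: smooth_on_cst.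
  rewrite deriveB //; last exact: smooth_on_derivable Dy.
  rewrite derive_id derive_mulmxr; last exact: dT.
  rewrite deriveEjacobian; last exact: dT.
  by rewrite /E mulmxBr mulmx1 mulmxA.
have Ex : E x = 0 by rewrite /E /P mulmxV ?subrr //; exact: uJ.
(* An entry of v E is a sum of [n] products, so this bound on the entries of E gives the factor 1/2
   in the sup norm; [n.+1] avoids dividing by 0 when n = 0. *)
pose e : R := (2 * n.+1%:R)^-1.
have e0 : 0 < e by rewrite invr_gt0 mulr_gt0.
have : \forall y \near x, D y /\ `|E y| < e.
  have cE := smooth_on_continuous sE Dx.
  move/cvgrPdist_lt : cE => /(_ _ e0) cE.
  near=> y; split; first by near: y; exact: open_nbhs_nbhs.
  have : `|E x - E y| < e by near: y; exact: cE.
  by rewrite Ex sub0r normrN.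
move=> /nbhs_ballP[r' /= r'0 Hr'].
pose r := r' / 2.
have r0 : 0 < r by rewrite divr_gt0.
have clB y : `|y - x| <= r -> D y /\ `|E y| < e.
  move=> yr; apply: Hr'; rewrite -ball_normE /= distrC.
  by apply: le_lt_trans yr _; rewrite /r; lra.
have lipS y z : `|y - x| <= r -> `|z - x| <= r ->
    `|S y - S z| <= 2^-1 * `|y - z|.
  move=> yr zr; apply: mx_norm_le => [|i j]; first by rewrite mulr_ge0.
  have inB (s : R) : 0 <= s <= 1 -> `|z + s *: (y - z) - x| <= r.
    move=> /andP[s0 s1].
    have -> : z + s *: (y - z) - x = (1 - s) *: (z - x) + s *: (y - x).
      by apply/rowP => l; rewrite !mxE; ring.
    rewrite (le_trans (ler_normD _ _)) // !normrZ !ger0_norm ?subr_ge0 //.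
    have -> : r = (1 - s) * r + s * r by lra.
    by apply: lerD; apply: ler_wpM2l => //; rewrite subr_ge0.
  have dS w : D w -> differentiable (fun y => S y i j : R) w.
    move=> Dw; apply: smooth_on_differentiable Dw.
    exact: smooth_on_mxE.
  have [s s01|s s01] := @mean_value_line _ _ (fun y => S y i j : R) z (y - z).
    by apply: dS; have [] := clB _ (inB s s01).
  have /inB sB : 0 <= s <= 1 by case/andP: s01 => *; rewrite !ltW.
  have [Dw Ew] := clB _ sB.
  rewrite subrKC [(S y - S z) i j]mxE [(- S z) i j]mxE => ->.
  rewrite -derive_mxE; last exact: smooth_on_derivable sS Dw.
  rewrite DS // mxE.
  apply: (@le_trans _ _ (\sum_(k < n) `|y - z| * e)).
    apply: (le_trans (ler_norm_sum _ _ _)); apply: ler_sum => k _.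
    rewrite normrM; apply: ler_pM => //.
      exact: mx_entry_le_norm.
    by apply: le_trans (ltW Ew); exact: mx_entry_le_norm.
  rewrite sumr_const card_ord -[leLHS]mulr_natr -[leLHS]mulrA [leRHS]mulrC
    ler_wpM2l //.
  rewrite /e mulrC ler_pdivrMr ?mulr_gt0 // mulrA mulVf // mul1r ler_nat.
  exact: leqnSn.
(* Half of the radius is used up by the contraction, and the other half is left for the shift by z -
   T x. *)
pose W := [set z | `|(z - T x) *m P| < r / 2].
have [k k0 Pk] := mulmxr_lipschitz 1 P.
have ex_phi z : W z -> exists y, `|y - x| < r /\ T y = z.
  move=> Wz.
  have kx y : S y + z *m P - x = (S y - S x) + (z - T x) *m P.
    rewrite /S mulmxBl; move: (T y *m P) (T x *m P) (z *m P) => A B C.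
    by apply/rowP => j; rewrite !mxE; ring.
  have lek y : `|y - x| <= r -> `|S y + z *m P - x| < r.
    move=> yr; rewrite kx (le_lt_trans (ler_normD _ _)) //.
    have xr : `|x - x| <= r by rewrite subrr normr0 ltW.
    have h1 := lipS _ _ yr xr; move: Wz; rewrite /W /= => h2.
    have h3 : 2^-1 * `|y - x| <= 2^-1 * r by rewrite ler_wpM2l.
    have := le_trans h1 h3; lra.
  have [|||y yr ky] := @contraction_fixed_point R n x r (fun y => S y + z *m P)
    r0.
  - move=> y yr; have [Dy _] := clB _ yr.
    apply: (@smooth_on_continuous _ _ _ D) => //.
    by apply: smooth_onD => //; exact: smooth_on_cst.
  - by move=> y /lek /ltW.
  - move=> y y' yr y'r.
    have -> : S y + z *m P - (S y' + z *m P) = S y - S y'.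
      by rewrite opprD addrACA subrr addr0.
    exact: lipS.
  exists y; split; first by have := lek _ yr; rewrite ky.
  apply: (can_inj (mulmxK (uJ _ Dx : jacobian T x \in unitmx))).
  have PK : P *m jacobian T x = 1%:M by rewrite /P mulVmx //; exact: uJ.
  suff : T y *m P = z *m P.
    move=> /(congr1 (fun A => A *m jacobian T x *m jacobian T x)).
    by rewrite -[T y *m P *m _]mulmxA -[z *m P *m _]mulmxA PK !mulmx1.
  move: ky; rewrite /S => /rowP ky; apply/rowP => j; have := ky j.
  by move: (T y *m P) (z *m P) => A B; rewrite !mxE => h; lra.
have injB y y' : `|y - x| <= r -> `|y' - x| <= r -> T y = T y' -> y = y'.
  move=> yr y'r ET; apply/eqP; rewrite -subr_eq0 -normr_le0.
  have := lipS _ _ yr y'r; rewrite /S ET.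
  have -> : y - T y' *m P - (y' - T y' *m P) = y - y'.
    by rewrite opprB addrA subrK.
  by lra.
(* A choice of preimage, with the junk value 0 when there is none; [injB] makes the choice unique on
   the ball. *)
pose phi z := if pselect (exists y, `|y - x| < r /\ T y = z) is left h
  then sval (cid h) else 0.
have phiP z : W z -> `|phi z - x| < r /\ T (phi z) = z.
  move=> Wz; rewrite /phi; case: pselect => [h|nh];
    first exact: (svalP (cid h)).
  by case: nh; exact: ex_phi.
pose U := [set y | `|y - x| < r /\ W (T y)].
have UD y : U y -> D y by move=> [/ltW /clB []].
have oW : open W.
  rewrite openE => z Wz.
  have cz : {for z, continuous (fun z : 'rV[R]_n => (z - T x) *m P)}.
    apply: (@smooth_on_continuous _ _ _ setT) => //.
    have oT := @openT 'rV[R]_n.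
    apply: smooth_on_mulmx => //; last exact: smooth_on_cst.
    by apply: smooth_onB => //; [exact: smooth_on_id|exact: smooth_on_cst].
  have cn := continuous_comp cz (@norm_continuous _ _ _).
  by apply: (cn [set t | t < r / 2]); apply: open_nbhs_nbhs; split => //;
    exact: open_lt.
have oU : open U.
  rewrite openE => y [yr WTy].
  have Dy : D y by apply: UD.
  have cT := smooth_on_continuous sT Dy.
  apply: filterI.
    have : nbhs y (ball x r).
      apply: open_nbhs_nbhs; split; first exact: ball_open.
      by rewrite -ball_normE /= distrC.
    by apply: filterS => w; rewrite -ball_normE /= distrC.
  by apply: (cT W); apply: open_nbhs_nbhs; split.
have phiU z : W z -> U (phi z).
  by move=> Wz; have [h1 h2] := phiP z Wz; split; rewrite // h2.
have Tphi z : W z -> T (phi z) = z by move=> /phiP [].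
have phiT y : U y -> phi (T y) = y.
  move=> [yr WTy]; have [h1 h2] := phiP _ WTy.
  by apply: injB; rewrite // ltW.
have lipphi z z' : W z -> W z' -> `|phi z - phi z'| <= 2 * k * `|z - z'|.
  move=> Wz Wz'; have [h1 h2] := phiP _ Wz; have [h3 h4] := phiP _ Wz'.
  have := lipS _ _ (ltW h1) (ltW h3); rewrite /S h2 h4.
  have -> : phi z - z *m P - (phi z' - z' *m P) = (phi z - phi z') - (z - z')
    *m P.
    rewrite mulmxBl; move: (z *m P) (z' *m P) => A B.
    by apply/rowP => j; rewrite !mxE; ring.
  move=> h5; have h6 := Pk (z - z').
  have h7 : `|phi z - phi z'| <= `|phi z - phi z' - (z - z') *m P| + `|(z - z')
    *m P|.
    by rewrite -{1}[phi z - phi z'](subrK ((z - z') *m P)) ler_normD.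
  have h8 := lerD h5 h6; have h9 := le_trans h7 h8.
  by rewrite -mulrA; lra.
have dphi z : W z -> differentiable phi z /\
    forall v, 'D_v phi z = v *m invmx (jacobian T (phi z)).
  move=> Wz; set y := phi z; set Q := invmx (jacobian T y).
  have Uy : U y := phiU _ Wz; have Dy := UD _ Uy.
  have [q q0 Qq] := mulmxr_lipschitz 1 Q.
  have cQ : continuous (mulmxr Q : 'rV[R]_n -> 'rV[R]_n).
    move=> v; apply: (@smooth_on_continuous _ _ _ setT) => //.
    apply: smooth_on_mulmx; [exact: openT|exact/smooth_on_id/openT|].
    exact/smooth_on_cst/openT.
  apply: (differentiable_of_bound cQ) => ep ep0.
  (* The error of [phi] is the remainder of [T] times Q. With [q] bounding Q and [2 * k] the
     Lipschitz constant of [phi], this tolerance for [T] becomes exactly [ep]. *)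
  pose d := ep / (q * (2 * k)).
  have qk0 : 0 < q * (2 * k) by rewrite !mulr_gt0.
  have d0 : 0 < d by rewrite divr_gt0.
  have /diff_locallyP [_ /eqaddoP /(_ d d0)] := dT y Dy.
  move=> /nbhs_ballP [s /= s0 Hs].
  have Wh : \forall h \near (0 : 'rV[R]_n), W (h + z).
    have : \forall z' \near z, W z' by exact: open_nbhs_nbhs.
    by rewrite (near_shift 0 z) /=; apply: filterS => h; rewrite subr0.
  near=> h.
  have Whz : W (h + z) by near: h.
  have lh := lipphi _ _ Whz Wz; rewrite addrK in lh.
  set kk := phi (h + z) - phi z in lh.
  have kks : ball (0 : 'rV[R]_n) s kk.
    rewrite -ball_normE /= sub0r normrN; apply: le_lt_trans lh _.
    rewrite mulrC -ltr_pdivlMr ?mulr_gt0 //; near: h.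
    apply/nbhs_ballP; exists (s / (2 * k)) => /=;
      first by rewrite divr_gt0 // mulr_gt0.
    by move=> w; rewrite -ball_normE /= sub0r normrN.
  have := Hs _ kks; rewrite !fctE /= => Hk.
  have ky : kk + y = phi (h + z) by rewrite /kk subrK.
  rewrite ky !Tphi // in Hk.
  rewrite /= -/y.
  have E1 : 'd T y kk = kk *m jacobian T y.
    by rewrite -deriveE ?deriveEjacobian //; exact: dT.
  rewrite E1 in Hk.
  have E2 : phi (h + z) - (y + h *m Q) = - ((h + z - (z + kk *m jacobian T y))
    *m Q).
    rewrite mulmxBl mulmxDl [(z + _) *m Q]mulmxDl -mulmxA mulmxV ?uJ // mulmx1
      /kk -/y.
    move: (h *m Q) (z *m Q) => A B.
    by apply/rowP => j; rewrite !mxE; ring.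
  rewrite E2 normrN (le_trans (Qq _)) //.
  apply: (@le_trans _ _ (q * (d * (2 * k * `|h|)))).
    rewrite ler_wpM2l ?(ltW q0) // (le_trans Hk) // ler_wpM2l ?(ltW d0) //.
  rewrite /d le_eqVlt; apply/orP; left; apply/eqP; field.
  by rewrite !gt_eqF.
exists U, W, phi; split=> //.
- by split=> //; split=> /=; rewrite /W /= subrr ?mul0mx normr0 ?divr_gt0.
- by move=> y Uy; split; [case: Uy|exact: phiT].
- by move=> z Wz; split; [exact: phiU|exact: Tphi].
(* The class is that of the g o phi with g smooth on [U]: its derivative is again of this form, with
   g replaced by its derivative along the field v times the inverse Jacobian. *)
apply: (@smooth_on_coind _ _ _ _
  [set f | exists2 g, smooth_on U g & f = g \o phi]) => //; last first.
  by exists id => //; exact: smooth_on_id.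
move=> _ [g sg ->]; split=> [z Wz|v].
  apply: differentiable_comp; first exact: (dphi z Wz).1.
  by apply: smooth_on_differentiable sg _; exact: phiU.
exists ((fun y => 'D_(v *m invmx (jacobian T y)) g y) \o phi).
  eexists; last reflexivity.
  apply: (@smooth_on_dd _ _ _ _ (fun y => v *m invmx (jacobian T y))) => //.
  apply: smooth_on_mulmx => //; first exact: smooth_on_cst.
  apply: smooth_on_invmx => //; first exact: smooth_on_sub sJ.
  by move=> y /UD; exact: uJ.
move=> z Wz; rewrite derive_comp; [|exact: (dphi z Wz).1|].
  by rewrite (dphi z Wz).2.
by apply: smooth_on_differentiable sg _; exact: phiU.
Unshelve. all: by end_near. Qed.

(** * Hypersurfaces in coordinates *)

(* A sealed copy of ['D_v f x]: unification never unfolds it to a limit. *)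
HB.lock Definition dd (R : realType) (V W : normedModType R) (v : V)
  (f : V -> W) (x : V) : W := derive f x v.

Lemma ddE (R : realType) (V W : normedModType R) (v : V) (f : V -> W) :
  dd v f = 'D_v f.
Proof. by apply/funext => x; rewrite unlock. Qed.

(** * Rules of calculus for the sealed directional derivative *)

Section DirectionalCalculus.
Variables (R : realType) (V : normedModType R) (D : set V).
Hypothesis oD : open D.

Lemma smooth_dd (W : normedModType R) (v : V) (f : V -> W) :
  smooth_on D f -> smooth_on D (dd v f).
Proof. by rewrite ddE; exact: smooth_on_derive. Qed.

Lemma dd_eq (W : normedModType R) (f g : V -> W) (x v : V) : D x ->
  (forall y, D y -> f y = g y) -> dd v f x = dd v g x.
Proof.
move=> Dx fg; rewrite !ddE; apply: near_eq_derive; near=> y; apply: fg.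
by near: y; exact: open_nbhs_nbhs.
Unshelve. all: by end_near. Qed.

Lemma dd_cst (W : normedModType R) (c : W) (x v : V) : dd v (fun=> c) x = 0.
Proof. by rewrite ddE; exact: derive_cst. Qed.

Lemma ddD (W : normedModType R) (f g : V -> W) (x v : V) :
  smooth_on D f -> smooth_on D g -> D x ->
  dd v (fun y => f y + g y) x = dd v f x + dd v g x.
Proof using oD.
by move=> sf sg Dx; rewrite !ddE; apply: deriveD; exact: smooth_on_derivable Dx.
Qed.

Lemma ddN (W : normedModType R) (f : V -> W) (x v : V) :
  smooth_on D f -> D x -> dd v (fun y => - f y) x = - dd v f x.
Proof using oD.
by move=> sf Dx; rewrite !ddE; apply: deriveN; exact: smooth_on_derivable Dx.
Qed.

Lemma ddB (W : normedModType R) (f g : V -> W) (x v : V) :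
  smooth_on D f -> smooth_on D g -> D x ->
  dd v (fun y => f y - g y) x = dd v f x - dd v g x.
Proof using oD.
by move=> sf sg Dx; rewrite !ddE; apply: deriveB; exact: smooth_on_derivable Dx.
Qed.

Lemma ddZ (W : normedModType R) (k : V -> R) (f : V -> W) (x v : V) :
  smooth_on D k -> smooth_on D f -> D x ->
  dd v (fun y => k y *: f y) x = dd v k x *: f x + k x *: dd v f x.
Proof using oD.
by move=> sk sf Dx; rewrite !ddE; apply: deriveZ_fun;
  exact: smooth_on_differentiable Dx.
Qed.

Lemma ddM (f g : V -> R) (x v : V) : smooth_on D f -> smooth_on D g -> D x ->
  dd v (fun y => f y * g y) x = dd v f x * g x + f x * dd v g x.
Proof using oD. by move=> sf sg Dx; exact: ddZ. Qed.

Lemma ddV (f : V -> R) (x v : V) : smooth_on D f -> D x -> f x != 0 ->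
  dd v (fun y => (f y)^-1) x = - (f x) ^- 2 * dd v f x.
Proof using oD.
by move=> sf Dx fx0; rewrite !ddE deriveV //; exact: smooth_on_derivable Dx.
Qed.

Lemma dd_sum (W : normedModType R) (I : Type) (r : seq I) (f : I -> V -> W)
    (x v : V) : (forall i, smooth_on D (f i)) -> D x ->
  dd v (fun y => \sum_(i <- r) f i y) x = \sum_(i <- r) dd v (f i) x.
Proof.
move=> sf Dx; elim: r => [|i r IH].
  rewrite big_nil -[RHS](dd_cst (0 : W) x v).
  by apply: dd_eq => // y _; rewrite big_nil.
rewrite big_cons -IH -ddD //; last exact: smooth_on_sum.
by apply: dd_eq => // y _; rewrite big_cons.
Qed.

Lemma dd_dirD (W : normedModType R) (f : V -> W) (x u v : V) :
  smooth_on D f -> D x -> dd (u + v) f x = dd u f x + dd v f x.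
Proof.
move=> sf Dx; rewrite !ddE; apply: derive_dirD.
exact: smooth_on_differentiable Dx.
Qed.

Lemma dd_dirZ (W : normedModType R) (f : V -> W) (x v : V) (c : R) :
  smooth_on D f -> D x -> dd (c *: v) f x = c *: dd v f x.
Proof.
move=> sf Dx; rewrite !ddE; apply: derive_dirZ.
exact: smooth_on_differentiable Dx.
Qed.

Lemma dd_dirN (W : normedModType R) (f : V -> W) (x v : V) :
  smooth_on D f -> D x -> dd (- v) f x = - dd v f x.
Proof.
move=> sf Dx; rewrite !ddE; apply: derive_dirN.
exact: smooth_on_differentiable Dx.
Qed.

Lemma dd_dir0 (W : normedModType R) (f : V -> W) (x : V) : dd 0 f x = 0.
Proof. by rewrite ddE derive0. Qed.

Lemma dd_mulmx m n p (f : V -> 'M[R]_(m, n)) (g : V -> 'M[R]_(n, p)) (x v : V) :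
  smooth_on D f -> smooth_on D g -> D x ->
  dd v (fun y => f y *m g y) x = dd v f x *m g x + f x *m dd v g x.
Proof using oD.
by move=> sf sg Dx; rewrite !ddE; apply: derive_mulmx;
  exact: smooth_on_differentiable Dx.
Qed.

Lemma dd_mulmxr m n p (f : V -> 'M[R]_(m, n)) (A : 'M[R]_(n, p)) (x v : V) :
  smooth_on D f -> D x -> dd v (fun y => f y *m A) x = dd v f x *m A.
Proof using oD.
by move=> sf Dx; rewrite !ddE; apply: derive_mulmxr;
  exact: smooth_on_differentiable Dx.
Qed.

Lemma dd_mxE m n (f : V -> 'M[R]_(m, n)) (x v : V) i j :
  smooth_on D f -> D x -> dd v (fun y => f y i j : R) x = dd v f x i j.
Proof using oD.
by move=> sf Dx; rewrite !ddE derive_mxE //; exact: smooth_on_derivable Dx.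
Qed.

Lemma dd_comm m n (f : V -> 'M[R]_(m, n)) (x u v : V) :
  smooth_on D f -> D x -> dd u (dd v f) x = dd v (dd u f) x.
Proof. by move=> sf Dx; rewrite !ddE; exact: schwarz oD sf Dx. Qed.

End DirectionalCalculus.

Section FieldCalculus.
Variables (R : realType) (n : nat) (D : set 'rV[R]_n).
Hypothesis oD : open D.

Lemma dd_rV (W : normedModType R) (f : 'rV[R]_n -> W) (x v : 'rV[R]_n) :
  smooth_on D f -> D x -> dd v f x = \sum_k v 0 k *: dd (delta_mx 0 k) f x.
Proof.
move=> sf Dx; rewrite ddE derive_rV; last exact: smooth_on_differentiable Dx.
by apply: eq_bigr => k _; rewrite ddE.
Qed.

Lemma dd_jacobian p (f : 'rV[R]_n -> 'rV[R]_p) (x v : 'rV[R]_n) :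
  smooth_on D f -> D x -> dd v f x = v *m jacobian f x.
Proof.
by move=> sf Dx; rewrite ddE deriveEjacobian //;
  exact: smooth_on_differentiable Dx.
Qed.

Lemma smooth_ddf (W : normedModType R) (X : 'rV[R]_n -> 'rV[R]_n)
    (f : 'rV[R]_n -> W) : smooth_on D X -> smooth_on D f ->
  smooth_on D (fun y => dd (X y) f y).
Proof.
move=> sX sf; apply: smooth_on_eq (smooth_on_dd oD sX sf) => // y _.
by rewrite ddE.
Qed.

(** The second derivative along a varying field is the one along the field frozen at [x], plus a
    first derivative along the variation of the field. *)
Lemma dd_field (W : normedModType R) (X Y : 'rV[R]_n -> 'rV[R]_n)
    (f : 'rV[R]_n -> W) (x : 'rV[R]_n) : D x -> smooth_on D X -> smooth_on D Y
      -> smooth_on D f ->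
  dd (X x) (fun y => dd (Y y) f y) x =
  dd (dd (X x) Y x) f x + dd (X x) (dd (Y x) f) x.
Proof.
move=> Dx sX sY sf.
have sk k : smooth_on D (dd (delta_mx 0 k) f) by exact: smooth_dd.
have sYk k : smooth_on D (fun y => Y y 0 k : R) by exact: smooth_on_mxE.
have sc k : smooth_on D (fun=> Y x 0 k : R) by exact: smooth_on_cst.
have -> : dd (X x) (fun y => dd (Y y) f y) x =
    dd (X x) (fun y => \sum_k Y y 0 k *: dd (delta_mx 0 k) f y) x.
  by apply: (dd_eq oD) => // y Dy; exact: dd_rV.
have -> : dd (X x) (dd (Y x) f) x =
    dd (X x) (fun y => \sum_k Y x 0 k *: dd (delta_mx 0 k) f y) x.
  by apply: (dd_eq oD) => // y Dy; exact: dd_rV.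
rewrite (dd_sum oD) //; last by move=> k; exact: smooth_onZ.
rewrite (dd_sum oD) //; last by move=> k; exact: smooth_onZ.
rewrite [X in X + _]dd_rV // -big_split /=; apply: eq_bigr => k _.
by rewrite (ddZ oD) // (ddZ oD) // dd_cst scale0r add0r (dd_mxE oD).
Qed.

Lemma commutator_field m p (X Y : 'rV[R]_n -> 'rV[R]_n)
    (f : 'rV[R]_n -> 'M[R]_(m, p)) (x : 'rV[R]_n) : D x ->
  smooth_on D X -> smooth_on D Y -> smooth_on D f ->
  dd (X x) (fun y => dd (Y y) f y) x - dd (Y x) (fun y => dd (X y) f y) x =
  dd (dd (X x) Y x - dd (Y x) X x) f x.
Proof.
move=> Dx sX sY sf.
rewrite (dd_field Dx sX sY sf) (dd_field Dx sY sX sf) (dd_comm oD (X x) (Y x)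
  sf Dx).
by rewrite opprD addrACA subrr addr0 (dd_dirD _ _ sf Dx) (dd_dirN _ sf Dx).
Qed.

End FieldCalculus.

(** * Formulas of Gauss, Weingarten and Koszul *)

Section Hypersurface.
Variables (R : realType) (n : nat) (D : set 'rV[R]_n)
  (G xi : 'rV[R]_n -> 'rV[R]_n.+1).
Hypotheses (oD : open D) (hB : blaschke_hypersurface D G xi).

Let sG : smooth_on D G. Proof. by case: hB. Qed.
Let sxi : smooth_on D xi. Proof. by case: hB. Qed.

Let tv := transversal_part G xi.
Let tg := tangential_part G xi.

Lemma moving_frame_unit x : D x -> moving_frame G xi x \in unitmx.
Proof. by case: hB => _ _ H /H []. Qed.

Lemma metric_mx_unit x : D x -> metric_mx G xi x \in unitmx.
Proof. by case: hB => _ _ H /H []. Qed.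

Lemma transversal_part_lin x (a b : R) u v :
  tv x (a *: u + b *: v) = a * tv x u + b * tv x v.
Proof.
by rewrite /tv /transversal_part /frame_coords mulmxDl -!scalemxAl !mxE.
Qed.

Lemma tangential_part_lin x (a b : R) u v :
  tg x (a *: u + b *: v) = a *: tg x u + b *: tg x v.
Proof.
rewrite /tg /tangential_part /frame_coords mulmxDl -!scalemxAl.
by apply/rowP => i; rewrite !mxE.
Qed.

Lemma frame_decomp x w : D x -> w = dd (tg x w) G x + tv x w *: xi x.
Proof.
move=> Dx; rewrite (dd_jacobian _ sG Dx).
have : frame_coords G xi x w *m moving_frame G xi x = w.
  by rewrite /frame_coords mulmxKV // moving_frame_unit.
rewrite /tv /tg /transversal_part /tangential_part.
rewrite -{1}[frame_coords G xi x w]hsubmxK /moving_frame mul_row_col addrC => E.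
rewrite -{1}E; congr (_ + _).
by rewrite [X in X *m _]mx11_scalar mul_scalar_mx.
Qed.

Lemma frame_coordsE x X (c : R) : D x ->
  frame_coords G xi x (dd X G x + c *: xi x) = row_mx c%:M X.
Proof.
move=> Dx; rewrite (dd_jacobian _ sG Dx).
rewrite /frame_coords; have Mu := moving_frame_unit Dx.
apply: (canLR (mulmxK Mu)); rewrite /moving_frame mul_row_col mul_scalar_mx.
by rewrite addrC.
Qed.

Lemma transversal_partE x X (c : R) : D x -> tv x (dd X G x + c *: xi x) = c.
Proof.
move=> Dx; rewrite /tv /transversal_part frame_coordsE // row_mxKl mxE eqxx.
by rewrite mulr1n.
Qed.

Lemma tangential_partE x X (c : R) : D x -> tg x (dd X G x + c *: xi x) = X.
Proof. by move=> Dx; rewrite /tg /tangential_part frame_coordsE // row_mxKr.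
  Qed.

Lemma dd_inj x X Y : D x -> dd X G x = dd Y G x -> X = Y.
Proof.
move=> Dx E; have := tangential_partE X 0 Dx.
by rewrite E tangential_partE.
Qed.

Lemma smooth_on_moving_frame : smooth_on D (moving_frame G xi).
Proof.
apply: smooth_on_mx => // i j.
have sJ := smooth_on_jacobian oD sG.
rewrite -[i]splitK; case: (fintype.split i) => k /=.
  apply: smooth_on_eq (smooth_on_mxE k j oD sxi) => // x _.
  by rewrite /moving_frame col_mxEu.
apply: smooth_on_eq (smooth_on_mxE k j oD sJ) => // x _.
by rewrite /moving_frame col_mxEd.
Qed.

Lemma smooth_on_frame_coords (f : 'rV[R]_n -> 'rV[R]_n.+1) :
  smooth_on D f -> smooth_on D (fun x => frame_coords G xi x (f x)).
Proof.
move=> sf; apply: smooth_on_mulmx => //.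
apply: smooth_on_invmx => //; first exact: smooth_on_moving_frame.
exact: moving_frame_unit.
Qed.

Lemma smooth_on_transversal_part (f : 'rV[R]_n -> 'rV[R]_n.+1) :
  smooth_on D f -> smooth_on D (fun x => tv x (f x) : R).
Proof.
move=> sf; rewrite /tv /transversal_part.
apply: smooth_on_eq (smooth_on_mxE 0 (lshift n 0) oD (smooth_on_frame_coords
  sf)) => //.
by move=> x _; rewrite [RHS]mxE.
Qed.

(* [h], [lc] and [K] are variables rather than the constants they stand for,
   so that conversion cannot unfold them. *)
Variables (h : 'rV[R]_n -> 'rV[R]_n -> 'rV[R]_n -> R)
  (lc K : 'rV[R]_n -> 'rV[R]_n -> 'rV[R]_n -> 'rV[R]_n).
Hypotheses (hE : forall x X Y, affine_metric G xi x X Y = h x X Y)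
  (lcE : forall x X Y, levi_civita G xi x X Y = lc x X Y)
  (KE : forall x X Y, difference_tensor G xi x X Y = K x X Y).

Let h_dd x X Y : h x X Y = tv x (dd X (dd Y G) x).
Proof. by rewrite -hE /affine_metric !ddE. Qed.

Lemma metric_sym x X Y : D x -> h x X Y = h x Y X.
Proof. by move=> Dx; rewrite !h_dd (dd_comm oD X Y sG Dx). Qed.

Lemma metric_linl x X Y Z (a b : R) : D x ->
  h x (a *: X + b *: Y) Z = a * h x X Z + b * h x Y Z.
Proof.
move=> Dx; have s := smooth_dd Z sG.
rewrite !h_dd (dd_dirD _ _ s Dx) (dd_dirZ X a s Dx) (dd_dirZ Y b s Dx).
exact: transversal_part_lin.
Qed.

Lemma metricDl x X Y Z : D x -> h x (X + Y) Z = h x X Z + h x Y Z.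
Proof. by move=> Dx; have := metric_linl X Y Z 1 1 Dx;
  rewrite !scale1r !mul1r. Qed.

Lemma metricZl x X Z (c : R) : D x -> h x (c *: X) Z = c * h x X Z.
Proof.
by move=> Dx; have := metric_linl X 0 Z c 0 Dx; rewrite scale0r mul0r !addr0.
Qed.

Lemma metricDr x X Y Z : D x -> h x Z (X + Y) = h x Z X + h x Z Y.
Proof. by move=> Dx; rewrite !(metric_sym Z) // metricDl. Qed.

Lemma metricZr x X Z (c : R) : D x -> h x Z (c *: X) = c * h x Z X.
Proof. by move=> Dx; rewrite !(metric_sym Z) // metricZl. Qed.

Lemma metric_sumr x Z (I : Type) (r : seq I) (c : I -> R)
    (v : I -> 'rV[R]_n) : D x ->
  h x Z (\sum_(i <- r) c i *: v i) = \sum_(i <- r) c i * h x Z (v i).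
Proof.
move=> Dx; elim: r => [|i r IH].
  rewrite !big_nil; have := metricZr 0 Z 0 Dx.
  by rewrite scale0r mul0r.
by rewrite !big_cons -IH metricDr // metricZr.
Qed.

Lemma metric_mxE x X Y : D x ->
  h x X Y = (X *m metric_mx G xi x *m Y^T) 0 0.
Proof.
move=> Dx; rewrite {1}[Y]row_sum_delta metric_sumr // mxE.
apply: eq_bigr => j _; rewrite [Y^T j 0]mxE mulrC; congr (_ * _).
rewrite metric_sym // {1}[X]row_sum_delta metric_sumr // mxE.
by apply: eq_bigr => i _; rewrite mxE hE metric_sym.
Qed.

Lemma metric_inj x X Y : D x -> (forall Z, h x X Z = h x Y Z) -> X = Y.
Proof.
move=> Dx H; apply: (can_inj (mulmxK (metric_mx_unit Dx))).
apply/rowP => j; have := H (delta_mx 0 j); rewrite !metric_mxE // trmx_delta.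
by rewrite -!colE !mxE.
Qed.

Lemma smooth_on_metric X Y : smooth_on D (fun x => h x X Y : R).
Proof.
apply: smooth_on_eq (smooth_on_transversal_part (smooth_dd X (smooth_dd Y sG)))
  => //.
Qed.

Lemma smooth_on_metric_mx : smooth_on D (metric_mx G xi).
Proof.
apply: smooth_on_mx => // i j.
apply: smooth_on_eq (smooth_on_metric (delta_mx 0 i) (delta_mx 0 j)) => // x _.
by rewrite mxE hE.
Qed.

Lemma levi_civita_dd x X Y : lc x X Y = (\row_l (2^-1 *
     (dd X (fun y => h y Y (delta_mx 0 l) : R) x
      + dd Y (fun y => h y X (delta_mx 0 l) : R) x
      - dd (delta_mx 0 l) (fun y => h y X Y : R) x)))
  *m invmx (metric_mx G xi x).
Proof.
(* Abstracting over the derivative and the metric allows both to be exchanged for [dd] and [h] under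
   the binders. *)
pose L (d : 'rV[R]_n -> ('rV[R]_n -> R) -> 'rV[R]_n -> R)
    (g : 'rV[R]_n -> 'rV[R]_n -> 'rV[R]_n -> R) := (\row_l (2^-1 *
     (d X (fun y => g y Y (delta_mx 0 l)) x + d Y (fun y => g y X (delta_mx 0
       l)) x
      - d (delta_mx 0 l) (fun y => g y X Y) x))) *m invmx (metric_mx G xi x).
have -> : lc x X Y = L (fun v f y => derive f y v) (affine_metric G xi).
  by rewrite -lcE.
have -> : affine_metric G xi = h by do 3 apply/funext => ?.
have -> : (fun v f y => derive f y v) = @dd R 'rV[R]_n R :> ('rV[R]_n ->
  ('rV[R]_n -> R) -> 'rV[R]_n -> R).
  by apply/funext => v; apply/funext => f; rewrite ddE.
by [].
Qed.

Let K_dd x X Y : K x X Y = tg x (dd X (dd Y G) x) - lc x X Y.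
Proof. by rewrite -KE -lcE /difference_tensor /induced_connection !ddE. Qed.

(** The definition of the connection tests only against coordinate vectors; both sides are linear in
    Z. *)
Lemma koszul x X Y Z : D x ->
  h x (lc x X Y) Z = 2^-1 *
    (dd X (fun y => h y Y Z : R) x + dd Y (fun y => h y X Z : R) x
     - dd Z (fun y => h y X Y : R) x).
Proof.
move=> Dx; have sh U W : smooth_on D (fun y => h y U W : R) by exact:
  smooth_on_metric.
have sc (c : R) : smooth_on D (fun=> c) by exact: smooth_on_cst.
have ex U W : dd U (fun y => h y W Z : R) x =
    \sum_l Z 0 l * dd U (fun y => h y W (delta_mx 0 l) : R) x.
  transitivity (dd U (fun y => \sum_l Z 0 l * h y W (delta_mx 0 l)) x).
    by apply: (dd_eq oD) => // y Dy; rewrite {1}[Z]row_sum_delta metric_sumr.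
  rewrite (dd_sum oD) => [|l|//]; last exact: smooth_onM.
  by apply: eq_bigr => l _; rewrite (ddM oD) // dd_cst mul0r add0r.
rewrite metric_mxE // levi_civita_dd mulmxKV ?metric_mx_unit // mxE.
rewrite (ex X) (ex Y) (dd_rV Z (sh X Y) Dx).
rewrite -big_split /= -sumrB mulr_sumr; apply: eq_bigr => l _.
by rewrite !mxE /GRing.scale /=; ring.
Qed.

Lemma levi_civita_sym x X Y : D x -> lc x X Y = lc x Y X.
Proof.
move=> Dx; apply: (metric_inj Dx) => Z; rewrite !koszul //; congr (_ * (_ - _)).
  by rewrite addrC.
by apply: (dd_eq oD) => // y Dy; exact: metric_sym.
Qed.

(** Compatibility of the connection with the metric. The product rule on Y g Z^T reduces it to
    constant fields, for which two instances of Koszul's formula add up to the derivative of h(Y,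
    Z). *)
Lemma dd_metric_field x X (Y Z : 'rV[R]_n -> 'rV[R]_n) : D x ->
  smooth_on D Y -> smooth_on D Z ->
  dd X (fun y => h y (Y y) (Z y) : R) x =
  h x (dd X Y x + lc x X (Y x)) (Z x) + h x (Y x) (dd X Z x + lc x X (Z x)).
Proof.
move=> Dx sY sZ.
have sg := smooth_on_metric_mx.
have sT (U : 'rV[R]_n -> 'rV[R]_n) : smooth_on D U -> smooth_on D (fun y => (U
  y)^T).
  move=> sU; apply: smooth_on_mx => // i j.
  by apply: smooth_on_eq (smooth_on_mxE j i oD sU) => // y _; rewrite mxE.
have DT (U : 'rV[R]_n -> 'rV[R]_n) : smooth_on D U ->
    dd X (fun y => (U y)^T) x = (dd X U x)^T.
  move=> sU; apply/matrixP => i j; rewrite mxE -(dd_mxE oD) //; last exact: sT.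
  rewrite -(dd_mxE oD) //.
  by apply: (dd_eq oD) => // y _; rewrite mxE.
have prod (U W : 'rV[R]_n -> 'rV[R]_n) : smooth_on D U -> smooth_on D W ->
    dd X (fun y => h y (U y) (W y) : R) x = h x (dd X U x) (W x) +
    (U x *m dd X (metric_mx G xi) x *m (W x)^T) 0 0 + h x (U x) (dd X W x).
  move=> sU sW; have sWT := sT _ sW.
  have sUg : smooth_on D (fun y => U y *m metric_mx G xi y) by exact:
    smooth_on_mulmx.
  have sUgW : smooth_on D (fun y => U y *m metric_mx G xi y *m (W y)^T).
    exact: smooth_on_mulmx.
  transitivity (dd X (fun y => (U y *m metric_mx G xi y *m (W y)^T) 0 0 : R) x).
    by apply: (dd_eq oD) => // y Dy; exact: metric_mxE.
  rewrite (dd_mxE oD) // (dd_mulmx oD) // (dd_mulmx oD) // DT // !metric_mxE //.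
  by rewrite mulmxDl mxE [X in X + _]mxE.
have cstE (U W : 'rV[R]_n) : dd X (fun y => h y U W : R) x =
    (U *m dd X (metric_mx G xi) x *m W^T) 0 0.
  rewrite (prod (fun=> U) (fun=> W)); try exact: smooth_on_cst.
  rewrite !dd_cst; have h0l V : h x 0 V = 0.
    by have := metricZl 0 V 0 Dx; rewrite scale0r mul0r.
  by rewrite (metric_sym U) // !h0l add0r addr0.
rewrite prod // metricDl // metricDr // -cstE.
rewrite (metric_sym (Y x) (lc x X (Z x))) // !koszul //.
have sw U V W : dd U (fun y => h y V W : R) x = dd U (fun y => h y W V : R) x.
  by apply: (dd_eq oD) => // y Dy; exact: metric_sym.
rewrite (sw X (Z x) (Y x)) (sw (Y x) X (Z x)) (sw (Z x) X (Y x)).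
by rewrite (sw (Z x) (Y x) X) (sw (Y x) (Z x) X); lra.
Qed.

(** Gauss's formula for a varying field, with the induced connection split into its Levi-Civita part
    and the difference tensor. *)
Lemma dd_tangent_field x X (Y : 'rV[R]_n -> 'rV[R]_n) : D x ->
  smooth_on D Y ->
  dd X (fun y => dd (Y y) G y) x =
  dd (dd X Y x + lc x X (Y x) + K x X (Y x)) G x + h x X (Y x) *: xi x.
Proof.
move=> Dx sY.
have sX : smooth_on D (fun=> X) by exact: smooth_on_cst.
rewrite (dd_field oD Dx sX sY sG).
rewrite {1}(frame_decomp (dd X (dd (Y x) G) x) Dx) addrA -h_dd; congr (_ + _).
rewrite -(dd_dirD _ _ sG Dx); congr (dd _ G x).
by rewrite K_dd -addrA subrKC.
Qed.

Lemma difference_tensor_sym x X Y : D x -> K x X Y = K x Y X.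
Proof.
by move=> Dx; rewrite !K_dd levi_civita_sym // (dd_comm oD X Y sG Dx).
Qed.

Lemma levi_civita_linl x (a b : R) X Y Z : D x ->
  lc x (a *: X + b *: Y) Z = a *: lc x X Z + b *: lc x Y Z.
Proof.
move=> Dx; apply: (metric_inj Dx) => U.
have sh V W : smooth_on D (fun y => h y V W : R) by exact: smooth_on_metric.
have sc (c : R) : smooth_on D (fun=> c) by exact: smooth_on_cst.
have shc (c : R) V W : smooth_on D (fun y => c * h y V W : R) by exact:
  smooth_onM.
have E V W : dd V (fun y => h y (a *: X + b *: Y) W : R) x =
    a * dd V (fun y => h y X W : R) x + b * dd V (fun y => h y Y W : R) x.
  transitivity (dd V (fun y => a * h y X W + b * h y Y W) x).
    by apply: (dd_eq oD) => // y Dy; exact: metric_linl.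
  by rewrite (ddD oD) // !(ddM oD) // !dd_cst !mul0r !add0r.
rewrite metric_linl // !koszul // !E (dd_dirD _ _ (sh Z U) Dx).
rewrite (dd_dirZ X a (sh Z U) Dx) (dd_dirZ Y b (sh Z U) Dx) /GRing.scale /=.
by ring.
Qed.

Lemma difference_tensor_linl x (a b : R) X Y Z : D x ->
  K x (a *: X + b *: Y) Z = a *: K x X Z + b *: K x Y Z.
Proof.
move=> Dx; rewrite !K_dd levi_civita_linl //; have s := smooth_dd Z sG.
rewrite (dd_dirD _ _ s Dx) (dd_dirZ X a s Dx) (dd_dirZ Y b s Dx).
rewrite tangential_part_lin.
by apply/rowP => i; rewrite !mxE; ring.
Qed.

Lemma dd_normal x X : D x -> dd X xi x = - dd (shape_operator G xi x X) G x.
Proof.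
move=> Dx; rewrite {1}(frame_decomp (dd X xi x) Dx).
have -> : tv x (dd X xi x) = 0 by rewrite ddE; case: hB => _ _ /(_ x Dx) [].
have -> : shape_operator G xi x X = - tg x (dd X xi x) by rewrite ddE.
by rewrite scale0r addr0 (dd_dirN _ sG Dx) opprK.
Qed.

End Hypersurface.

(** * The adapted frame *)

(** Entries indexed by natural numbers make iterated Laplace expansion a computation: [bump j] skips
    the deleted column, and [ring] can finish. *)
Lemma det_expand_nat (R : comNzRingType) n (f : nat -> nat -> R) :
  \det (\matrix_(i < n.+1, j < n.+1) f i j) =
  \sum_(j < n.+1) f 0 j * ((-1) ^+ j *
     \det (\matrix_(i < n, k < n) f i.+1 (bump j k))).
Proof.
rewrite (expand_det_row _ ord0); apply: eq_bigr => j _.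
rewrite mxE /cofactor add0n; congr (_ * (_ * \det _)).
by apply/matrixP => i k; rewrite !mxE.
Qed.

Definition rows4 (R : pzRingType) (a b c d : 'rV[R]_4) : 'M[R]_4 :=
  \matrix_(i < 4) [:: a; b; c; d]`_i.

Lemma det_rows4 (R : comNzRingType) (a b c d : 'rV[R]_4) :
  let x (u : 'rV[R]_4) k := u 0 (inord k) in
  \det (rows4 a b c d) = \sum_(j < 4) x a j * ((-1) ^+ j *
    \sum_(k < 3) x b (bump j k) * ((-1) ^+ k *
    \sum_(l < 2) x c (bump j (bump k l)) * ((-1) ^+ l *
      x d (bump j (bump k (bump l 0)))))).
Proof.
move=> x; pose f i j := x ([:: a; b; c; d]`_i) j.
have -> : rows4 a b c d = \matrix_(i < 4, j < 4) f i j.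
  by apply/matrixP => i j; rewrite !mxE /f /x inord_val.
rewrite det_expand_nat; apply: eq_bigr => j _; congr (_ * (_ * _)).
rewrite (det_expand_nat 2 (fun i k => f i.+1 (bump j k))).
apply: eq_bigr => k _; congr (_ * (_ * _)).
rewrite (det_expand_nat 1 (fun i l => f i.+2 (bump j (bump k l)))).
apply: eq_bigr => l _; congr (_ * (_ * _)).
by rewrite (det_expand_nat 0 (fun i m => f i.+3 (bump j (bump k (bump l m)))))
  big_ord1 det_mx00 expr0 !mulr1.
Qed.

Lemma rows4_mul (R : pzRingType) (a b c d : 'rV[R]_4) (Q : 'M[R]_4) :
  rows4 a b c d *m Q = rows4 (a *m Q) (b *m Q) (c *m Q) (d *m Q).
Proof.
apply/row_matrixP => i; rewrite row_mul /rows4 !rowK.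
by case: i => [[|[|[|[|//]]]] ?].
Qed.

(* [E1], [E2], [E3] are the images of the frame [e1], [e2], [e3], and
   [Z = xi - (eta + mu1) E1]; [sg = eta - mu1] and [tu = eta + mu1]. *)
Record cone_frame (R : realType) (D : set 'rV[R]_3)
    (G Z E1 E2 E3 : 'rV[R]_3 -> 'rV[R]_4) (e1 e2 e3 : 'rV[R]_3 -> 'rV[R]_3)
    (sg tu mu1 mu2 rho al be : 'rV[R]_3 -> R) (vol : R) : Prop := ConeFrame {
  cf_open : open D;
  cf_smooth : [/\ smooth_on D G, smooth_on D Z & [/\ smooth_on D E1,
    smooth_on D E2 & smooth_on D E3]];
  cf_smooth_fun : [/\ smooth_on D sg, smooth_on D tu, smooth_on D mu1
    & smooth_on D mu2];
  cf_sg_neq0 : forall y, D y -> sg y != 0;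
  cf_tuE : forall y, D y -> tu y = sg y + 2 * mu1 y;
  cf_frame : exists2 B : 'rV[R]_3 -> 'M[R]_3, smooth_on D B &
    forall y X, D y -> X = (X *m B y) 0 0 *: e1 y + (X *m B y) 0 1 *: e2 y
      + (X *m B y) 0 2 *: e3 y;
  cf_vol : forall y, D y -> `|\det (rows4 (E2 y) (E3 y) (Z y) (E1 y))| = vol;
  cf_E : forall y, D y -> [/\ dd (e1 y) G y = E1 y, dd (e2 y) G y = E2 y
    & dd (e3 y) G y = E3 y];
  cf_dE1 : forall y, D y -> [/\
    dd (e1 y) E1 y = (2 * mu1 y + tu y) *: E1 y + Z y,
    dd (e2 y) E1 y = sg y *: E2 y & dd (e3 y) E1 y = sg y *: E3 y];
  cf_dE2 : forall y, D y -> [/\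
    dd (e1 y) E2 y = - mu1 y *: E2 y + rho y *: E3 y,
    dd (e2 y) E2 y = mu2 y *: E2 y + al y *: E3 y + Z y
    & dd (e3 y) E2 y = (be y - mu2 y) *: E3 y];
  cf_dE3 : forall y, D y -> [/\
    dd (e1 y) E3 y = - rho y *: E2 y - mu1 y *: E3 y,
    dd (e2 y) E3 y = - al y *: E2 y - mu2 y *: E3 y
    & dd (e3 y) E3 y = - (be y + mu2 y) *: E2 y + Z y];
  cf_dZ : forall y, D y -> [/\ dd (e1 y) Z y = - tu y *: Z y,
    dd (e2 y) Z y = 0 & dd (e3 y) Z y = 0];
  cf_dsg : forall y, D y -> [/\ dd (e1 y) sg y = 4 * mu1 y * sg y,
    dd (e2 y) sg y = 0 & dd (e3 y) sg y = 0] }.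

Section AdaptedFrame.
Variables (R : realType) (D : set 'rV[R]_3) (G xi : 'rV[R]_3 -> 'rV[R]_4)
  (e1 e2 e3 : 'rV[R]_3 -> 'rV[R]_3) (lambda a mu1 mu2 eta : 'rV[R]_3 -> R).
Hypotheses (oD : open D) (hB : blaschke_hypersurface D G xi)
  (se1 : smooth_on D e1) (se2 : smooth_on D e2) (se3 : smooth_on D e3)
  (hA : forall y, D y -> adapted_frame G xi e1 e2 e3 (lambda y) (a y) (mu1 y)
     (mu2 y) (eta y) y).
Variables (h : 'rV[R]_3 -> 'rV[R]_3 -> 'rV[R]_3 -> R)
  (lc K : 'rV[R]_3 -> 'rV[R]_3 -> 'rV[R]_3 -> 'rV[R]_3).
Hypotheses (hE : forall x X Y, affine_metric G xi x X Y = h x X Y)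
  (lcE : forall x X Y, levi_civita G xi x X Y = lc x X Y)
  (KE : forall x X Y, difference_tensor G xi x X Y = K x X Y).

Let E1 := fun y => dd (e1 y) G y.
Let E2 := fun y => dd (e2 y) G y.
Let E3 := fun y => dd (e3 y) G y.

Let sG : smooth_on D G. Proof. by case: hB. Qed.
Let sxi : smooth_on D xi. Proof. by case: hB. Qed.

Let hsym y X Y : D y -> h y X Y = h y Y X.
Proof. by move=> Dy; exact: (metric_sym oD hB hE X Y Dy). Qed.
Let hDl y X Y Z : D y -> h y (X + Y) Z = h y X Z + h y Y Z.
Proof. by move=> Dy; exact: (metricDl hB hE X Y Z Dy). Qed.
Let hZl y X Z c : D y -> h y (c *: X) Z = c * h y X Z.
Proof. by move=> Dy; exact: (metricZl hB hE X Z c Dy). Qed.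

Let orthonormal y : D y ->
  [/\ [/\ h y (e1 y) (e1 y) = 1, h y (e1 y) (e2 y) = 0 & h y (e1 y) (e3 y) = 0],
      [/\ h y (e2 y) (e1 y) = 0, h y (e2 y) (e2 y) = 1 & h y (e2 y) (e3 y) = 0]
    & [/\ h y (e3 y) (e1 y) = 0, h y (e3 y) (e2 y) = 0 & h y (e3 y) (e3 y) =
      1]].
Proof.
move=> Dy; case: (hA Dy); rewrite !hE => -[h11 h22 h33 [h12 h13 h23]] _ _ _ _.
by split; split=> //; rewrite hsym.
Qed.

(** Orthonormality says that the frame matrix has the right inverse g Ef^T. For square matrices this
    is also a left inverse, which is the expansion. *)
Lemma orthonormal_expand y X : D y ->
  X = h y X (e1 y) *: e1 y + h y X (e2 y) *: e2 y + h y X (e3 y) *: e3 y.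
Proof.
move=> Dy; have [[h11 h12 h13] [h21 h22 h23] [h31 h32 h33]] := orthonormal Dy.
pose Ef : 'M[R]_3 := \matrix_(i, j) ([:: e1 y; e2 y; e3 y]`_i) 0 j.
pose g := metric_mx G xi y.
have rowE i : row i Ef = [:: e1 y; e2 y; e3 y]`_i.
  by apply/rowP => j; rewrite !mxE.
have gE U W : h y U W = (U *m g *m W^T) 0 0 by exact: (metric_mxE oD hB hE).
have ON : Ef *m (g *m Ef^T) = 1%:M.
  apply/matrixP => i j; rewrite mulmxA.
  have -> : (Ef *m g *m Ef^T) i j = h y (row i Ef) (row j Ef).
    rewrite gE -row_mul [LHS]mxE [RHS]mxE; apply: eq_bigr => k _.
    by rewrite !mxE.
  rewrite !rowE !mxE.
  by case: i => [[|[|[|//]]] ?]; case: j => [[|[|[|//]]] ?].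
have XE : X = X *m (g *m Ef^T) *m Ef.
  by rewrite -mulmxA (mulmx1C ON) mulmx1.
have cE k : (X *m (g *m Ef^T)) 0 k = h y X (row k Ef).
  rewrite gE mulmxA [LHS]mxE [RHS]mxE; apply: eq_bigr => l _.
  by rewrite !mxE.
rewrite {1}XE mulmx_sum_row !big_ord_recl big_ord0 addr0 !cE !rowE /= addrA.
by [].
Qed.

Let coef (e : 'rV[R]_3 -> 'rV[R]_3) (f : 'rV[R]_3 -> 'rV[R]_4) y : R :=
  h y (tangential_part G xi y (f y)) (e y).

Let combE c1 c2 c3 y : D y -> c1 *: E1 y + c2 *: E2 y + c3 *: E3 y =
  dd (c1 *: e1 y + c2 *: e2 y + c3 *: e3 y) G y.
Proof.
move=> Dy; rewrite !(dd_dirD _ _ sG Dy).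
by rewrite !(dd_dirZ _ _ sG Dy).
Qed.

Let tangential_comb c1 c2 c3 c0 y : D y ->
  tangential_part G xi y (c1 *: E1 y + c2 *: E2 y + c3 *: E3 y + c0 *: xi y) =
  c1 *: e1 y + c2 *: e2 y + c3 *: e3 y.
Proof. by move=> Dy; rewrite combE // (tangential_partE hB). Qed.

Let h_comb c1 c2 c3 y : D y ->
  [/\ h y (c1 *: e1 y + c2 *: e2 y + c3 *: e3 y) (e1 y) = c1,
      h y (c1 *: e1 y + c2 *: e2 y + c3 *: e3 y) (e2 y) = c2
    & h y (c1 *: e1 y + c2 *: e2 y + c3 *: e3 y) (e3 y) = c3].
Proof.
move=> Dy; have [[h11 h12 h13] [h21 h22 h23] [h31 h32 h33]] := orthonormal Dy.
by rewrite !hDl // !hZl // h11 h12 h13 h21 h22 h23 h31 h32 h33; split; ring.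
Qed.

(** All integrability conditions below are obtained by expanding a commutator in E1, E2, E3, xi and
    reading off coefficients with this lemma. *)
Lemma frame_indep y c1 c2 c3 c0 : D y ->
  c1 *: E1 y + c2 *: E2 y + c3 *: E3 y + c0 *: xi y = 0 ->
  [/\ c1 = 0, c2 = 0, c3 = 0 & c0 = 0].
Proof.
move=> Dy E.
have t0 : c1 *: e1 y + c2 *: e2 y + c3 *: e3 y = 0.
  rewrite -(tangential_comb c1 c2 c3 c0 Dy) E.
  by have := tangential_comb 0 0 0 0 Dy; rewrite !scale0r !addr0.
have [k1 k2 k3] := h_comb c1 c2 c3 Dy.
have h0 V : h y 0 V = 0 by have := hZl 0 V 0 Dy; rewrite scale0r mul0r.
move: k1 k2 k3; rewrite t0 !h0 => <- <- <-; split=> //.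
have := transversal_partE hB (c1 *: e1 y + c2 *: e2 y + c3 *: e3 y) c0 Dy.
rewrite -combE // E.
by have := transversal_partE hB 0 0 Dy; rewrite dd_dir0 scale0r addr0 => -> <-.
Qed.

Let smooth_coef e f : smooth_on D e -> smooth_on D f -> smooth_on D (coef e f).
Proof.
move=> se sf.
have st : smooth_on D (fun y => tangential_part G xi y (f y)).
  have sc := smooth_on_frame_coords oD hB sf.
  apply: smooth_on_mx => // i j.
  apply: smooth_on_eq (smooth_on_mxE i (rshift 1 j) oD sc) => // y _.
  by rewrite /tangential_part [RHS]mxE.
have sT : smooth_on D (fun y => (e y)^T).
  apply: smooth_on_mx => // i j.
  by apply: smooth_on_eq (smooth_on_mxE j i oD se) => // y _; rewrite mxE.
have sg := smooth_on_metric_mx oD hB hE.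
have sm := smooth_on_mulmx oD (smooth_on_mulmx oD st sg) sT.
apply: smooth_on_eq (smooth_on_mxE 0 0 oD sm) => // y Dy.
by rewrite /coef (metric_mxE oD hB hE).
Qed.

Let sE1 : smooth_on D E1. Proof. exact: smooth_ddf. Qed.
Let sE2 : smooth_on D E2. Proof. exact: smooth_ddf. Qed.
Let sE3 : smooth_on D E3. Proof. exact: smooth_ddf. Qed.

Let lcd X (Y : 'rV[R]_3 -> 'rV[R]_3) y := dd X Y y + lc y X (Y y).

(** Differentiating the constant h(Y, Z) shows that the connection coefficients of the frame are
    skew. *)
Let lcd_skew (Y Z : 'rV[R]_3 -> 'rV[R]_3) (c : R) X y : D y ->
  smooth_on D Y -> smooth_on D Z -> (forall y, D y -> h y (Y y) (Z y) = c) ->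
  h y (lcd X Y y) (Z y) = - h y (lcd X Z y) (Y y).
Proof.
move=> Dy sY sZ hc; have := dd_metric_field oD hB hE lcE X Dy sY sZ.
rewrite (dd_eq oD (g := fun=> c)) // dd_cst -/(lcd X Y y) -/(lcd X Z y).
by rewrite (hsym (Y y)) // => H; lra.
Qed.

(** These and [eta] are the only free connection coefficients: the derivatives of [e1] along the
    leaf are given by [eta], and skewness yields the rest. [rho], [al], [be] are the rotation rates
    of [e2], [e3] along [e1], [e2], [e3]. *)
Let w2 y := h y (lcd (e1 y) e1 y) (e2 y).
Let w3 y := h y (lcd (e1 y) e1 y) (e3 y).
Let rho y := h y (lcd (e1 y) e2 y) (e3 y).
Let al y := h y (lcd (e2 y) e2 y) (e3 y).
Let be y := h y (lcd (e3 y) e2 y) (e3 y).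
Let sg y := eta y - mu1 y.
Let tu y := eta y + mu1 y.

Let h_const : (forall y, D y -> h y (e1 y) (e1 y) = 1) /\
  (forall y, D y -> h y (e2 y) (e2 y) = 1) /\
  (forall y, D y -> h y (e3 y) (e3 y) = 1) /\
  (forall y, D y -> h y (e1 y) (e2 y) = 0) /\
  (forall y, D y -> h y (e1 y) (e3 y) = 0) /\
  (forall y, D y -> h y (e2 y) (e3 y) = 0).
Proof. by do !split; move=> y /orthonormal [[? ? ?] [? ? ?] [? ? ?]]. Qed.

Let lcd_e1 y : D y -> lcd (e2 y) e1 y = eta y *: e2 y /\
  lcd (e3 y) e1 y = eta y *: e3 y.
Proof.
move=> Dy; have [_ [h21 _ _] [h31 _ _]] := orthonormal Dy.
have L X : h y X (e1 y) = 0 -> lcd X e1 y = eta y *: X.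
  have [_ _ _ _ /(_ X)] := hA Dy; rewrite hE => H /H <-.
  by rewrite /lcd ddE -lcE.
by split; exact: L.
Qed.

Let skew0 X Y y : D y -> smooth_on D Y -> (forall y, D y -> h y (Y y) (Y y) =
  1) ->
  h y (lcd X Y y) (Y y) = 0.
Proof. by move=> Dy sY hY; have := lcd_skew X Dy sY sY hY; lra. Qed.

Let lcd_e y : D y ->
  [/\ [/\ lcd (e1 y) e1 y = w2 y *: e2 y + w3 y *: e3 y,
          lcd (e1 y) e2 y = - w2 y *: e1 y + rho y *: e3 y
        & lcd (e1 y) e3 y = - w3 y *: e1 y - rho y *: e2 y],
      lcd (e2 y) e2 y = - eta y *: e1 y + al y *: e3 y /\
      lcd (e2 y) e3 y = - al y *: e2 y
    & lcd (e3 y) e2 y = be y *: e3 y /\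
      lcd (e3 y) e3 y = - eta y *: e1 y - be y *: e2 y].
Proof.
move=> Dy; have [h11 [h22 [h33 [h12 [h13 h23]]]]] := h_const.
have [[k11 k12 k13] [k21 k22 k23] [k31 k32 k33]] := orthonormal Dy.
have [l21 l31] := lcd_e1 Dy.
have s12 X := lcd_skew X Dy se1 se2 h12.
have s13 X := lcd_skew X Dy se1 se3 h13.
have s23 X := lcd_skew X Dy se2 se3 h23.
have z1 X := skew0 X Dy se1 h11.
have z2 X := skew0 X Dy se2 h22.
have z3 X := skew0 X Dy se3 h33.
have g212 : h y (lcd (e2 y) e2 y) (e1 y) = - eta y.
  by have := s12 (e2 y); rewrite l21 hZl // k22; lra.
have g213 : h y (lcd (e2 y) e3 y) (e1 y) = 0.
  by have := s13 (e2 y); rewrite l21 hZl // k23; lra.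
have g312 : h y (lcd (e3 y) e2 y) (e1 y) = 0.
  by have := s12 (e3 y); rewrite l31 hZl // k32; lra.
have g313 : h y (lcd (e3 y) e3 y) (e1 y) = - eta y.
  by have := s13 (e3 y); rewrite l31 hZl // k33; lra.
have x X := orthonormal_expand X Dy.
split; [split|split|split].
- by rewrite {1}(x (lcd (e1 y) e1 y)) z1 scale0r add0r.
- rewrite {1}(x (lcd (e1 y) e2 y)) z2 scale0r addr0.
  by have := s12 (e1 y) => s; rewrite /w2 s opprK.
- rewrite {1}(x (lcd (e1 y) e3 y)) z3 scale0r addr0 -scaleNr.
  have s := s13 (e1 y); have s' := s23 (e1 y).
  by rewrite /w3 /rho s s' !opprK.
- by rewrite {1}(x (lcd (e2 y) e2 y)) z2 scale0r addr0 g212.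
- rewrite {1}(x (lcd (e2 y) e3 y)) z3 g213 !scale0r addr0 add0r.
  by have s := s23 (e2 y); rewrite /al s opprK.
- by rewrite {1}(x (lcd (e3 y) e2 y)) z2 g312 !scale0r !add0r.
- rewrite {1}(x (lcd (e3 y) e3 y)) z3 g313 scale0r addr0 -scaleNr.
  by have s := s23 (e3 y); rewrite /be s opprK.
Qed.

Let dd_E X (e : 'rV[R]_3 -> 'rV[R]_3) y : D y -> smooth_on D e ->
  dd X (fun y => dd (e y) G y) y =
  dd (lcd X e y + K y X (e y)) G y + h y X (e y) *: xi y.
Proof. exact: (dd_tangent_field oD hB hE lcE KE). Qed.

Let K_e y : D y ->
  [/\ [/\ K y (e1 y) (e1 y) = (2 * mu1 y) *: e1 y,
          K y (e1 y) (e2 y) = - mu1 y *: e2 y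
        & K y (e1 y) (e3 y) = - mu1 y *: e3 y],
      [/\ K y (e2 y) (e1 y) = - mu1 y *: e2 y,
          K y (e2 y) (e2 y) = - mu1 y *: e1 y + mu2 y *: e2 y
        & K y (e2 y) (e3 y) = - mu2 y *: e3 y]
    & [/\ K y (e3 y) (e1 y) = - mu1 y *: e3 y,
          K y (e3 y) (e2 y) = - mu2 y *: e3 y
        & K y (e3 y) (e3 y) = - mu1 y *: e1 y - mu2 y *: e2 y]].
Proof.
move=> Dy; case: (hA Dy); rewrite !KE => _ [k11 k12 k13] [k22 k23 k33] _ _.
have ks := difference_tensor_sym oD hB hE lcE KE.
by split; split=> //; rewrite ks.
Qed.

(** Gauss's formula with the connection and K added up. The combination eta - mu1 arises in the leaf
    derivatives of E1, and - (eta + mu1) as the E1 component of those of E2 and E3; this is the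
    origin of [sg] and [tu]. *)
Lemma frame_equations y : D y ->
  [/\ [/\ dd (e1 y) E1 y = (2 * mu1 y) *: E1 y + w2 y *: E2 y + w3 y *: E3 y +
    xi y,
          dd (e2 y) E1 y = sg y *: E2 y
        & dd (e3 y) E1 y = sg y *: E3 y],
      [/\ dd (e1 y) E2 y = - w2 y *: E1 y - mu1 y *: E2 y + rho y *: E3 y,
          dd (e2 y) E2 y = - tu y *: E1 y + mu2 y *: E2 y + al y *: E3 y + xi y
        & dd (e3 y) E2 y = (be y - mu2 y) *: E3 y],
      [/\ dd (e1 y) E3 y = - w3 y *: E1 y - rho y *: E2 y - mu1 y *: E3 y,
          dd (e2 y) E3 y = - al y *: E2 y - mu2 y *: E3 y
        & dd (e3 y) E3 y = - tu y *: E1 y - (be y + mu2 y) *: E2 y + xi y]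
    & [/\ dd (e1 y) xi y = - lambda y *: E1 y,
          dd (e2 y) xi y = - a y *: E2 y
        & dd (e3 y) xi y = - a y *: E3 y]].
Proof.
move=> Dy.
have [[h11 h12 h13] [h21 h22 h23] [h31 h32 h33]] := orthonormal Dy.
have [[k11 k12 k13] [k21 k22 k23] [k31 k32 k33]] := K_e Dy.
have [[l11 l12 l13] [l22 l23] [l32 l33]] := lcd_e Dy.
have [l21 l31] := lcd_e1 Dy.
have key X (e : 'rV[R]_3 -> 'rV[R]_3) c1 c2 c3 c0 : smooth_on D e ->
    lcd X e y + K y X (e y) = c1 *: e1 y + c2 *: e2 y + c3 *: e3 y ->
    h y X (e y) = c0 ->
    dd X (fun y => dd (e y) G y) y =
    c1 *: E1 y + c2 *: E2 y + c3 *: E3 y + c0 *: xi y.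
  by move=> se E hc; rewrite dd_E // E hc combE.
have S X : dd X xi y = - dd (shape_operator G xi y X) G y by exact: (dd_normal
  hB).
have [_ _ _ [S1 S2 S3] _] := hA Dy.
split; split.
- rewrite (key (e1 y) e1 (2 * mu1 y) (w2 y) (w3 y) 1) ?scale1r // l11 k11.
  by move: (e1 y) (e2 y) (e3 y) => x1 x2 x3; apply/rowP => j; rewrite !mxE;
    ring.
- rewrite (key (e2 y) e1 0 (sg y) 0 0) ?scale0r ?addr0 ?add0r // l21 k21 /sg.
  by move: (e1 y) (e2 y) (e3 y) => x1 x2 x3; apply/rowP => j; rewrite !mxE;
    ring.
- rewrite (key (e3 y) e1 0 0 (sg y) 0) ?scale0r ?addr0 ?add0r // l31 k31 /sg.
  by move: (e1 y) (e2 y) (e3 y) => x1 x2 x3; apply/rowP => j; rewrite !mxE;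
    ring.
- rewrite (key (e1 y) e2 (- w2 y) (- mu1 y) (rho y) 0) ?scale0r ?addr0 ?scaleNr
    //.
  rewrite l12 k12; move: (e1 y) (e2 y) (e3 y) => x1 x2 x3.
  by apply/rowP => j; rewrite !mxE; ring.
- rewrite (key (e2 y) e2 (- tu y) (mu2 y) (al y) 1) ?scale1r // l22 k22 /tu.
  by move: (e1 y) (e2 y) (e3 y) => x1 x2 x3; apply/rowP => j; rewrite !mxE;
    ring.
- rewrite (key (e3 y) e2 0 0 (be y - mu2 y) 0) ?scale0r ?addr0 ?add0r // l32
    k32.
  by move: (e1 y) (e2 y) (e3 y) => x1 x2 x3; apply/rowP => j; rewrite !mxE;
    ring.
- rewrite (key (e1 y) e3 (- w3 y) (- rho y) (- mu1 y) 0) ?scale0r ?addr0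
    ?scaleNr //.
  rewrite l13 k13; move: (e1 y) (e2 y) (e3 y) => x1 x2 x3.
  by apply/rowP => j; rewrite !mxE; ring.
- rewrite (key (e2 y) e3 0 (- al y) (- mu2 y) 0) ?scale0r ?addr0 ?add0r
    ?scaleNr //.
  rewrite l23 k23; move: (e1 y) (e2 y) (e3 y) => x1 x2 x3.
  by apply/rowP => j; rewrite !mxE; ring.
- rewrite (key (e3 y) e3 (- tu y) (- (be y + mu2 y)) 0 1) ?scale1r ?scale0r
    ?addr0 ?scaleNr //.
  rewrite l33 k33 /tu; move: (e1 y) (e2 y) (e3 y) => x1 x2 x3.
  by apply/rowP => j; rewrite !mxE; ring.
- by rewrite S S1 (dd_dirZ _ _ sG Dy) scaleNr.
- by rewrite S S2 (dd_dirZ _ _ sG Dy) scaleNr.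
- by rewrite S S3 (dd_dirZ _ _ sG Dy) scaleNr.
Qed.

Let coef_comb f y c1 c2 c3 c0 : D y ->
  f y = c1 *: E1 y + c2 *: E2 y + c3 *: E3 y + c0 *: xi y ->
  [/\ coef e1 f y = c1, coef e2 f y = c2 & coef e3 f y = c3].
Proof.
by move=> Dy fE; rewrite /coef fE tangential_comb //; exact: h_comb.
Qed.

Let sde (e : 'rV[R]_3 -> 'rV[R]_3) (f : 'rV[R]_3 -> 'rV[R]_4) :
  smooth_on D e -> smooth_on D f -> smooth_on D (fun y => dd (e y) f y).
Proof. exact: smooth_ddf. Qed.

(** Smoothness of these functions is not assumed: each is, up to a constant factor, a frame
    coefficient of a derivative of E1, E2 or xi (for [eta], the sum of two such functions). *)
Lemma smooth_structure : [/\ smooth_on D mu1, smooth_on D mu2, smooth_on D eta,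
  smooth_on D a & [/\ smooth_on D lambda, smooth_on D w2 & smooth_on D w3]].
Proof.
have via (f : 'rV[R]_3 -> R) (e e' : 'rV[R]_3 -> 'rV[R]_3) (H : 'rV[R]_3 ->
  'rV[R]_4) (c : R) :
    smooth_on D e -> smooth_on D e' -> smooth_on D H ->
    (forall y, D y -> c * coef e (fun y => dd (e' y) H y) y = f y) -> smooth_on
      D f.
  move=> se se' sH E.
  have s : smooth_on D (fun y => c * coef e (fun y => dd (e' y) H y) y).
    by apply: smooth_onM => //; [exact: smooth_on_cst|apply: smooth_coef => //;
      exact: sde].
  exact: smooth_on_eq s.
have x1 (x : 'rV[R]_4) : 1 *: x = x by rewrite scale1r.
have x0 (x : 'rV[R]_4) : 0 *: x = 0 by rewrite scale0r.
have smu1 : smooth_on D mu1.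
  apply: (via mu1 e1 e1 E1 (2^-1)) => // y Dy;
    have [[q _ _] _ _ _] := frame_equations Dy.
  have [|-> _ _] := @coef_comb (fun y => dd (e1 y) E1 y) y (2 * mu1 y) (w2 y)
    (w3 y) 1 Dy.
    by rewrite q scale1r.
  by rewrite mulrA mulVf // mul1r.
have ssg : smooth_on D sg.
  apply: (via sg e2 e2 E1 1) => // y Dy;
    have [[_ q _] _ _ _] := frame_equations Dy.
  have [|_ -> _] := @coef_comb (fun y => dd (e2 y) E1 y) y 0 (sg y) 0 0 Dy.
    by rewrite q !x0 add0r !addr0.
  by rewrite mul1r.
split=> //.
- apply: (via mu2 e2 e2 E2 1) => // y Dy;
    have [_ [_ q _] _ _] := frame_equations Dy.
  have [|_ -> _] := @coef_comb (fun y => dd (e2 y) E2 y) y (- tu y) (mu2 y) (al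
    y) 1 Dy.
    by rewrite q scale1r.
  by rewrite mul1r.
- apply: smooth_on_eq (smooth_onD oD ssg smu1) => // y _.
  by rewrite /sg subrK.
- apply: (via a e2 e2 xi (-1)) => // y Dy;
    have [_ _ _ [_ q _]] := frame_equations Dy.
  have [|_ -> _] := @coef_comb (fun y => dd (e2 y) xi y) y 0 (- a y) 0 0 Dy.
    by rewrite q !x0 add0r !addr0.
  by rewrite mulN1r opprK.
split.
- apply: (via lambda e1 e1 xi (-1)) => // y Dy;
    have [_ _ _ [q _ _]] := frame_equations Dy.
  have [|-> _ _] := @coef_comb (fun y => dd (e1 y) xi y) y (- lambda y) 0 0 0
    Dy.
    by rewrite q !x0 !addr0.
  by rewrite mulN1r opprK.
- apply: (via w2 e2 e1 E1 1) => // y Dy;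
    have [[q _ _] _ _ _] := frame_equations Dy.
  have [|_ -> _] := @coef_comb (fun y => dd (e1 y) E1 y) y (2 * mu1 y) (w2 y)
    (w3 y) 1 Dy.
    by rewrite q scale1r.
  by rewrite mul1r.
- apply: (via w3 e3 e1 E1 1) => // y Dy;
    have [[q _ _] _ _ _] := frame_equations Dy.
  have [|_ _ ->] := @coef_comb (fun y => dd (e1 y) E1 y) y (2 * mu1 y) (w2 y)
    (w3 y) 1 Dy.
    by rewrite q scale1r.
  by rewrite mul1r.
Qed.

Let Z := fun y => xi y - tu y *: E1 y.

(** As [G] is an immersion, the bracket of two fields is determined by its action on [G], and the
    coefficients found there apply to every other map. *)
Let field_comm (u v : 'rV[R]_3 -> 'rV[R]_3) c1 c2 c3 (f : 'rV[R]_3 -> 'rV[R]_4)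
  y :
  D y -> smooth_on D u -> smooth_on D v -> smooth_on D f ->
  dd (u y) (fun z => dd (v z) G z) y - dd (v y) (fun z => dd (u z) G z) y =
    c1 *: E1 y + c2 *: E2 y + c3 *: E3 y ->
  dd (u y) (fun z => dd (v z) f z) y - dd (v y) (fun z => dd (u z) f z) y =
    c1 *: dd (e1 y) f y + c2 *: dd (e2 y) f y + c3 *: dd (e3 y) f y.
Proof.
move=> Dy su sv sf; rewrite (commutator_field oD Dy su sv sG) combE // =>
  /(dd_inj hB Dy) E.
rewrite (commutator_field oD Dy su sv sf) E !(dd_dirD _ _ sf Dy).
by rewrite !(dd_dirZ _ _ sf Dy).
Qed.

Let comm12 (f : 'rV[R]_3 -> 'rV[R]_4) y : D y -> smooth_on D f ->
  dd (e1 y) (fun z => dd (e2 z) f z) y - dd (e2 y) (fun z => dd (e1 z) f z) y =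
  - w2 y *: dd (e1 y) f y + - eta y *: dd (e2 y) f y + rho y *: dd (e3 y) f y.
Proof.
move=> Dy sf; apply: field_comm => //; rewrite -/E1 -/E2.
have [[_ q1 _] [q2 _ _] _ _] := frame_equations Dy.
rewrite q1 q2 /sg; move: (E1 y) (E2 y) (E3 y) => x1 x2 x3.
by apply/rowP => j; rewrite !mxE; ring.
Qed.

Let comm13 (f : 'rV[R]_3 -> 'rV[R]_4) y : D y -> smooth_on D f ->
  dd (e1 y) (fun z => dd (e3 z) f z) y - dd (e3 y) (fun z => dd (e1 z) f z) y =
  - w3 y *: dd (e1 y) f y + - rho y *: dd (e2 y) f y + - eta y *: dd (e3 y) f y.
Proof.
move=> Dy sf; apply: field_comm => //; rewrite -/E1 -/E3.
have [[_ _ q1] _ [q2 _ _] _] := frame_equations Dy.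
rewrite q1 q2 /sg; move: (E1 y) (E2 y) (E3 y) => x1 x2 x3.
by apply/rowP => j; rewrite !mxE; ring.
Qed.

Let comm23 (f : 'rV[R]_3 -> 'rV[R]_4) y : D y -> smooth_on D f ->
  dd (e2 y) (fun z => dd (e3 z) f z) y - dd (e3 y) (fun z => dd (e2 z) f z) y =
  0 *: dd (e1 y) f y + - al y *: dd (e2 y) f y + - be y *: dd (e3 y) f y.
Proof.
move=> Dy sf; apply: field_comm => //; rewrite -/E2 -/E3.
have [_ [_ _ q1] [_ q2 _] _] := frame_equations Dy.
rewrite q1 q2; move: (E1 y) (E2 y) (E3 y) => x1 x2 x3.
by apply/rowP => j; rewrite !mxE; ring.
Qed.

Let smu1 : smooth_on D mu1. Proof. by case: smooth_structure. Qed.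
Let smu2 : smooth_on D mu2. Proof. by case: smooth_structure. Qed.
Let seta : smooth_on D eta. Proof. by case: smooth_structure. Qed.
Let sa : smooth_on D a. Proof. by case: smooth_structure. Qed.
Let slam : smooth_on D lambda. Proof. by case: smooth_structure => _ _ _ _ [].
  Qed.
Let sw2 : smooth_on D w2. Proof. by case: smooth_structure => _ _ _ _ []. Qed.
Let sw3 : smooth_on D w3. Proof. by case: smooth_structure => _ _ _ _ []. Qed.
Let ssg : smooth_on D sg. Proof. exact: smooth_onB. Qed.
Let stu : smooth_on D tu. Proof. exact: smooth_onD. Qed.

Let eq_sub0 (u v : 'rV[R]_4) : u = v -> u - v = 0.
Proof. by move=> ->; rewrite subrr. Qed.

(** The bracket of e2 and e3 applied to E1 and to xi: the connection terms cancel and only the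
    derivatives of [sg], respectively [a], survive as coefficients of E2 and E3. *)
Lemma leafwise_constant y : D y ->
  [/\ dd (e2 y) sg y = 0, dd (e3 y) sg y = 0, dd (e2 y) a y = 0
    & dd (e3 y) a y = 0].
Proof.
move=> Dy.
have [[q11 q21 q31] [q12 q22 q32] [q13 q23 q33] [r1 r2 r3]] := frame_equations
  Dy.
have [s2 s3] : dd (e2 y) sg y = 0 /\ dd (e3 y) sg y = 0.
  have := comm23 Dy sE1.
  have -> : dd (e2 y) (fun z => dd (e3 z) E1 z) y =
      dd (e2 y) (fun z => sg z *: E3 z) y.
    by apply: (dd_eq oD) => // z /frame_equations [[]].
  have -> : dd (e3 y) (fun z => dd (e2 z) E1 z) y =
      dd (e3 y) (fun z => sg z *: E2 z) y.
    by apply: (dd_eq oD) => // z /frame_equations [[]].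
  rewrite !(ddZ oD) // q32 q23 q11 q21 q31 => /eq_sub0 E.
  have [|_ k2 k3 _] := @frame_indep y 0 (- dd (e3 y) sg y) (dd (e2 y) sg y) 0
    Dy.
    rewrite -[RHS]E; move: (E1 y) (E2 y) (E3 y) (xi y) => x1 x2 x3 x0.
    by apply/rowP => j; rewrite !mxE; ring.
  by rewrite k3 -[dd (e3 y) sg y]opprK k2 oppr0.
have [a2 a3] : dd (e2 y) a y = 0 /\ dd (e3 y) a y = 0.
  have sma : smooth_on D (fun z => - a z) by exact: smooth_onN.
  have := comm23 Dy sxi.
  have -> : dd (e2 y) (fun z => dd (e3 z) xi z) y =
      dd (e2 y) (fun z => - a z *: E3 z) y.
    by apply: (dd_eq oD) => // z /frame_equations [_ _ _ []].
  have -> : dd (e3 y) (fun z => dd (e2 z) xi z) y =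
      dd (e3 y) (fun z => - a z *: E2 z) y.
    by apply: (dd_eq oD) => // z /frame_equations [_ _ _ []].
  rewrite !(ddZ oD) // !(ddN oD) // q32 q23 r1 r2 r3 => /eq_sub0 E.
  have [|_ k2 k3 _] := @frame_indep y 0 (dd (e3 y) a y) (- dd (e2 y) a y) 0 Dy.
    rewrite -[RHS]E; move: (E1 y) (E2 y) (E3 y) (xi y) => x1 x2 x3 x0.
    by apply/rowP => j; rewrite !mxE; ring.
  by rewrite k2 -[dd (e2 y) a y]opprK k3 oppr0.
by [].
Qed.

(** The brackets of e1 with e2 and e3 applied to E1. The E1 coefficient gives the leaf derivatives
    of [mu1], since tu - sg = 2 mu1; the E2 coefficient of the first bracket gives the derivative of
    [sg] along [e1]. *)
Lemma codazzi_e1 y : D y ->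
  [/\ dd (e2 y) mu1 y = 2 * mu1 y * w2 y, dd (e3 y) mu1 y = 2 * mu1 y * w3 y
    & dd (e1 y) sg y = 3 * mu1 y * sg y - a y - eta y * sg y + dd (e2 y) w2 y
        + w2 y * mu2 y - w3 y * al y - w2 y ^+ 2].
Proof.
move=> Dy.
have [[q11 q21 q31] [q12 q22 q32] [q13 q23 q33] [r1 r2 r3]] := frame_equations
  Dy.
have [s2 s3 _ _] := leafwise_constant Dy.
have s2mu : smooth_on D (fun z => 2 * mu1 z).
  by apply: smooth_onM => //; exact: smooth_on_cst.
have sA : smooth_on D (fun z => (2 * mu1 z) *: E1 z) by exact: smooth_onZ.
have sB : smooth_on D (fun z => w2 z *: E2 z) by exact: smooth_onZ.
have sC : smooth_on D (fun z => w3 z *: E3 z) by exact: smooth_onZ.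
have sAB := smooth_onD oD sA sB.
have sABC := smooth_onD oD sAB sC.
have d11 X : dd X (fun z => dd (e1 z) E1 z) y =
    (2 * dd X mu1 y) *: E1 y + (2 * mu1 y) *: dd X E1 y +
    (dd X w2 y *: E2 y + w2 y *: dd X E2 y) +
    (dd X w3 y *: E3 y + w3 y *: dd X E3 y) + dd X xi y.
  have -> : dd X (fun z => dd (e1 z) E1 z) y =
     dd X (fun z => (2 * mu1 z) *: E1 z + w2 z *: E2 z + w3 z *: E3 z + xi z) y.
    by apply: (dd_eq oD) => // z /frame_equations [[]].
  rewrite (ddD oD X sABC sxi Dy) (ddD oD X sAB sC Dy) (ddD oD X sA sB Dy).
  rewrite !(ddZ oD) //; last exact: smooth_on_cst.
  by rewrite dd_cst scale0r add0r.
have [m2 S1] : dd (e2 y) mu1 y = 2 * mu1 y * w2 y /\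
    dd (e1 y) sg y = 3 * mu1 y * sg y - a y - eta y * sg y + dd (e2 y) w2 y
        + w2 y * mu2 y - w3 y * al y - w2 y ^+ 2.
  have := comm12 Dy sE1.
  have -> : dd (e1 y) (fun z => dd (e2 z) E1 z) y =
      dd (e1 y) (fun z => sg z *: E2 z) y.
    by apply: (dd_eq oD) => // z /frame_equations [[]].
  rewrite d11 (ddZ oD) // q11 q21 q31 q12 q22 q23 r2 => /eq_sub0 E.
  have [|k1 k2 _ _] := @frame_indep y
    (- sg y * w2 y - 2 * dd (e2 y) mu1 y + tu y * w2 y + 2 * mu1 y * w2 y)
    (dd (e1 y) sg y - sg y * mu1 y - 2 * mu1 y * sg y - dd (e2 y) w2 y
      - w2 y * mu2 y + w3 y * al y + a y + w2 y ^+ 2 + eta y * sg y)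
    (- dd (e2 y) w3 y - w2 y * al y + w3 y * mu2 y + w2 y * w3 y) 0 Dy.
    rewrite -[RHS]E; move: (E1 y) (E2 y) (E3 y) (xi y) => x1 x2 x3 x0.
    by apply/rowP => j; rewrite !mxE; ring.
  split; first by move: k1; rewrite /tu /sg; lra.
  by move: k2; lra.
have m3 : dd (e3 y) mu1 y = 2 * mu1 y * w3 y.
  have := comm13 Dy sE1.
  have -> : dd (e1 y) (fun z => dd (e3 z) E1 z) y =
      dd (e1 y) (fun z => sg z *: E3 z) y.
    by apply: (dd_eq oD) => // z /frame_equations [[]].
  rewrite d11 (ddZ oD) // q11 q21 q31 q13 q32 q33 r3 => /eq_sub0 E.
  have [|k1 _ _ _] := @frame_indep y
    (- sg y * w3 y - 2 * dd (e3 y) mu1 y + tu y * w3 y + 2 * mu1 y * w3 y)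
    (- sg y * rho y - dd (e3 y) w2 y + w3 y * (be y + mu2 y) + w2 y * w3 y +
      rho y * sg y)
    (dd (e1 y) sg y - sg y * mu1 y - 2 * mu1 y * sg y - w2 y * (be y - mu2 y)
       - dd (e3 y) w3 y + a y + w3 y ^+ 2 + eta y * sg y) 0 Dy.
    rewrite -[RHS]E; move: (E1 y) (E2 y) (E3 y) (xi y) => x1 x2 x3 x0.
    by apply/rowP => j; rewrite !mxE; ring.
  by move: k1; rewrite /tu /sg; lra.
by [].
Qed.

(** * Consequences of a = - sg tu where [sg] does not vanish *)

Hypotheses (ha : forall y, D y -> a y = - eta y ^+ 2 + mu1 y ^+ 2)
  (hmu1 : forall y, D y -> mu1 y != 0) (hsg : forall y, D y -> sg y != 0).

Let aE y : D y -> a y = - (sg y * tu y).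
Proof. by move=> Dy; rewrite ha // /sg /tu; ring. Qed.

Let dd_a X y : D y -> dd X a y = - (dd X sg y * tu y + sg y * dd X tu y).
Proof.
move=> Dy; rewrite (dd_eq oD (g := fun z => - (sg z * tu z))) //.
by rewrite (ddN oD) ?(ddM oD) //; exact: smooth_onM.
Qed.

Let dd_sgE X y : D y -> dd X sg y = dd X eta y - dd X mu1 y.
Proof. by move=> Dy; rewrite /sg (ddB oD). Qed.

Let dd_tuE X y : D y -> dd X tu y = dd X eta y + dd X mu1 y.
Proof. by move=> Dy; rewrite /tu (ddD oD). Qed.

(** In a = - sg tu both the product and the nonzero factor [sg] are constant along the leaf
    directions. *)
Let tu_leaf y : D y -> dd (e2 y) tu y = 0 /\ dd (e3 y) tu y = 0.
Proof.
move=> Dy; have [s2 s3 a2 a3] := leafwise_constant Dy.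
have := dd_a (e2 y) Dy; have := dd_a (e3 y) Dy;
  rewrite s2 s3 a2 a3 !mul0r !add0r.
move=> /esym/eqP; rewrite oppr_eq0 mulf_eq0 (negPf (hsg Dy)) /= => /eqP ->.
move=> /esym/eqP; rewrite oppr_eq0 mulf_eq0 (negPf (hsg Dy)) /= => /eqP ->.
by [].
Qed.

(** Now 2 mu1 = tu - sg is constant along the leaf directions, so the Codazzi relations read 2 mu1 w
    = 0 with mu1 <> 0. *)
Let w_eq0 y : D y -> w2 y = 0 /\ w3 y = 0.
Proof.
move=> Dy; have [s2 s3 _ _] := leafwise_constant Dy.
have [t2 t3] := tu_leaf Dy; have [m2 m3 _] := codazzi_e1 Dy.
rewrite dd_sgE // in s2; rewrite dd_sgE // in s3.
rewrite dd_tuE // in t2; rewrite dd_tuE // in t3.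
have z2 : dd (e2 y) mu1 y = 0 by lra.
have z3 : dd (e3 y) mu1 y = 0 by lra.
have mu0 : 2 * mu1 y != 0 by rewrite mulf_neq0 // hmu1.
move: m2 m3; rewrite z2 z3 => /esym/eqP;
  rewrite mulf_eq0 (negPf mu0) /= => /eqP ->.
by move=> /esym/eqP; rewrite mulf_eq0 (negPf mu0) /= => /eqP ->.
Qed.

Lemma dd_sg_e1 y : D y -> dd (e1 y) sg y = 4 * mu1 y * sg y.
Proof.
move=> Dy; have [_ _ ->] := codazzi_e1 Dy; have [-> ->] := w_eq0 Dy.
rewrite (dd_eq oD (g := fun=> 0)) //; last by move=> z /w_eq0 [].
by rewrite dd_cst aE // /tu /sg; ring.
Qed.

(** Read as a linear equation, this propagates the nonvanishing of [sg]; read as a formula for the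
    1-form h(., e1), it recovers [e1] from [sg] and [mu1]. *)
Lemma dd_sg X y : D y -> dd X sg y = 4 * mu1 y * sg y * h y X (e1 y).
Proof.
move=> Dy; have [s2 s3 _ _] := leafwise_constant Dy.
rewrite {1}(orthonormal_expand X Dy) !(dd_dirD _ _ ssg Dy) !(dd_dirZ _ _ ssg
  Dy).
by rewrite s2 s3 dd_sg_e1 // /GRing.scale /=; ring.
Qed.

(** The E2 coefficient of the bracket of e1 and e2 on xi involves the derivative of a = - sg tu;
    with that of [sg] known, division by [sg] isolates that of [tu]. *)
Let dd_tu_e1 y : D y ->
  dd (e1 y) tu y = - lambda y - sg y * tu y - 4 * mu1 y * tu y.
Proof.
move=> Dy.
have [[q11 q21 q31] [q12 q22 q32] [q13 q23 q33] [r1 r2 r3]] := frame_equations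
  Dy.
have [z2 z3] := w_eq0 Dy.
have sma : smooth_on D (fun z => - a z) by exact: smooth_onN.
have sml : smooth_on D (fun z => - lambda z) by exact: smooth_onN.
have := comm12 Dy sxi.
have -> : dd (e1 y) (fun z => dd (e2 z) xi z) y =
    dd (e1 y) (fun z => - a z *: E2 z) y.
  by apply: (dd_eq oD) => // z /frame_equations [_ _ _ []].
have -> : dd (e2 y) (fun z => dd (e1 z) xi z) y =
    dd (e2 y) (fun z => - lambda z *: E1 z) y.
  by apply: (dd_eq oD) => // z /frame_equations [_ _ _ []].
rewrite !(ddZ oD) // !(ddN oD) // q12 q21 r1 r2 r3 z2 => /eq_sub0 E.
have [|_ k2 _ _] := @frame_indep y (dd (e2 y) lambda y)
  (- dd (e1 y) a y + a y * mu1 y + lambda y * sg y - eta y * a y) 0 0 Dy.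
  rewrite -[RHS]E; move: (E1 y) (E2 y) (E3 y) (xi y) => x1 x2 x3 x0.
  by apply/rowP => j; rewrite !mxE; ring.
move: k2; rewrite dd_a // dd_sg_e1 // aE // => k2.
apply: (@mulfI _ (sg y)); first exact: hsg.
have e : eta y = sg y + mu1 y by rewrite /sg subrK.
by move: k2; rewrite {1}e; lra.
Qed.

(** Along e2 the derivative is (- a - tu sg) E2 = 0, and likewise along e3. Along e1 the formula for
    the derivative of [tu] leaves tu^2 E1 - tu xi. *)
Lemma dd_Z y : D y ->
  [/\ dd (e1 y) Z y = - tu y *: Z y, dd (e2 y) Z y = 0 & dd (e3 y) Z y = 0].
Proof.
move=> Dy.
have [[q11 q21 q31] [q12 q22 q32] [q13 q23 q33] [r1 r2 r3]] := frame_equations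
  Dy.
have [z2 z3] := w_eq0 Dy; have [t2 t3] := tu_leaf Dy.
have stE : smooth_on D (fun z => tu z *: E1 z) by exact: smooth_onZ.
have dZ X : dd X Z y = dd X xi y - (dd X tu y *: E1 y + tu y *: dd X E1 y).
  by rewrite /Z (ddB oD) // (ddZ oD).
rewrite !dZ q11 q21 q31 r1 r2 r3 z2 z3 t2 t3 dd_tu_e1 // aE // /Z.
have -> : tu y = sg y + 2 * mu1 y by rewrite /sg /tu; ring.
move: (E1 y) (E2 y) (E3 y) (xi y) => x1 x2 x3 x0.
by split; apply/rowP => j; rewrite !mxE; ring.
Qed.

(** The Blaschke volume condition on an orthonormal frame; passing from xi to Z is a shear by E1,
    and the reordering of the rows is an even permutation. *)
Let frame_volume y : D y -> `|\det (rows4 (E2 y) (E3 y) (Z y) (E1 y))| = 1.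
Proof.
move=> Dy; case: hB => _ _ /(_ y Dy) [_ _ _ /(_ (fun i => [:: e1 y; e2 y;
  e3 y]`_i))].
have [[h11 h12 h13] [h21 h22 h23] [h31 h32 h33]] := orthonormal Dy.
have -> : (\matrix_(i < 3, j < 3) affine_metric G xi y [:: e1 y; e2 y; e3 y]`_i
    [:: e1 y; e2 y; e3 y]`_j) = 1%:M.
  apply/matrixP => i j; rewrite !mxE hE.
  by case: i => [[|[|[|//]]] ?]; case: j => [[|[|[|//]]] ?].
rewrite det1 normr1 sqrtr1.
have -> : col_mx (xi y : 'M[R]_(1, 1 + 3)) (\matrix_(i < 3)
    ('D_([:: e1 y; e2 y; e3 y]`_i) G y : 'rV[R]_(1 + 3))) =
    rows4 (xi y) (E1 y) (E2 y) (E3 y).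
  apply/row_matrixP => i; rewrite [RHS]rowK.
  rewrite -[i]splitK; case: (fintype.split i) => k /=.
    have -> : k = 0 by apply: val_inj; case: k => [[]].
    by rewrite rowKu; apply/rowP => j; rewrite mxE.
  have dE v : 'D_v G y = dd v G y by rewrite ddE.
  rewrite rowKd rowK dE.
  by case: k => [[|[|[|//]]] ?].
move=> <-; congr (`|_|); rewrite !det_rows4 /=.
rewrite !big_ord_recl !big_ord0 /= /bump /= /Z.
rewrite !mxE.
rewrite !exprS !expr0.
by ring.
Qed.

Lemma cone_frame_of_adapted :
  cone_frame D G Z E1 E2 E3 e1 e2 e3 sg tu mu1 mu2 rho al be 1.
Proof.
have w0 := w_eq0.
split=> //.
- by split=> //; apply: smooth_onB => //; exact: smooth_onZ.
- by move=> y Dy; rewrite /tu /sg; ring.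
- exists (fun y => metric_mx G xi y *m (\matrix_(i < 3, j < 3) ([:: e1 y;
    e2 y; e3 y]`_i) 0 j)^T).
    apply: smooth_on_mulmx => //; first exact: (smooth_on_metric_mx oD hB hE).
    apply: smooth_on_mx => // i j.
    case: j => [[|[|[|//]]] ?].
    + by apply: smooth_on_eq (smooth_on_mxE 0 i oD se1) => // y _; rewrite !mxE.
    + by apply: smooth_on_eq (smooth_on_mxE 0 i oD se2) => // y _; rewrite !mxE.
    + by apply: smooth_on_eq (smooth_on_mxE 0 i oD se3) => // y _; rewrite !mxE.
  move=> y X Dy.
  have E k : (X *m (metric_mx G xi y *m (\matrix_(i < 3, j < 3) ([:: e1 y;
    e2 y; e3 y]`_i) 0 j)^T)) 0 k
      = h y X [:: e1 y; e2 y; e3 y]`_k.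
    rewrite (metric_mxE oD hB hE) // mulmxA [LHS]mxE [RHS]mxE.
    by apply: eq_bigr => l _; rewrite !mxE.
  by rewrite !E /=; exact: orthonormal_expand.
- move=> y Dy; have [z2 z3] := w0 y Dy.
  have [[q11 q21 q31] _ _ _] := frame_equations Dy.
  split=> //; rewrite q11 z2 z3 /Z;
    move: (E1 y) (E2 y) (E3 y) (xi y) => x1 x2 x3 x0.
  by apply/rowP => j; rewrite !mxE; ring.
- move=> y Dy; have [z2 z3] := w0 y Dy.
  have [_ [q12 q22 q32] _ _] := frame_equations Dy.
  rewrite q12 q22 q32 z2 /Z; move: (E1 y) (E2 y) (E3 y) (xi y) => x1 x2 x3 x0.
  by split=> //; apply/rowP => j; rewrite !mxE; ring.
- move=> y Dy; have [z2 z3] := w0 y Dy.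
  have [_ _ [q13 q23 q33] _] := frame_equations Dy.
  rewrite q13 q23 q33 z3 /Z; move: (E1 y) (E2 y) (E3 y) (xi y) => x1 x2 x3 x0.
  by split=> //; apply/rowP => j; rewrite !mxE; ring.
- exact: dd_Z.
- move=> y Dy; have [s2 s3 _ _] := leafwise_constant Dy.
  by rewrite dd_sg_e1.
Qed.

End AdaptedFrame.

(** * The pointwise symmetry group *)

(** Unit rows and determinant 1 force (u00 - u11)^2 + (u01 + u10)^2 = 2 - 2 = 0, so elements have
    the form of complex numbers. *)
Lemma SO2_commutative (R : realType) (g k : 'M[R]_2) :
  SO2 g -> SO2 k -> g *m k = k *m g.
Proof.
have form (u : 'M[R]_2) : SO2 u -> u 1 1 = u 0 0 /\ u 1 0 = - u 0 1.
  move=> [uu du]; have E i j := congr1 (fun A : 'M[R]_2 => A i j) uu.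
  have := E 0 0; have := E 1 1; rewrite !mxE !big_ord_recl !big_ord0 /= !mxE.
  move: du; rewrite (expand_det_row _ 0) !big_ord_recl big_ord0 /cofactor
    !det_mx11.
  rewrite !mxE /=.
  have -> : lift (0 : 'I_2) 0 = 1 by apply: val_inj.
  have -> : lift (1 : 'I_2) 0 = 0 by apply: val_inj.
  rewrite /= expr0 expr1 => d r1 r0.
  have : (u 0 0 - u 1 1) ^+ 2 + (u 0 1 + u 1 0) ^+ 2 = 0 by nra.
  move/eqP; rewrite paddr_eq0 ?sqr_ge0 // !sqrf_eq0 => /andP[/eqP p /eqP q].
  by split; lra.
move=> /form [g1 g2] /form [k1 k2]; apply/matrixP => i j.
rewrite !mxE !big_ord_recl !big_ord0 /=.
have -> : lift (0 : 'I_2) 0 = 1 by apply: val_inj.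
have o2 (l : 'I_2) : l = 0 \/ l = 1.
  by case: l => [[|[|//]] ?]; [left|right]; apply: val_inj.
by case: (o2 i) => ->; case: (o2 j) => ->; rewrite ?g1 ?g2 ?k1 ?k2; ring.
Qed.

Section TensorSymmetry.
Variables (R : realType) (h : 'rV[R]_3 -> 'rV[R]_3 -> R)
  (S : 'rV[R]_3 -> 'rV[R]_3) (K : 'rV[R]_3 -> 'rV[R]_3 -> 'rV[R]_3)
  (e1 e2 e3 : 'rV[R]_3) (lambda a mu1 mu2 : R).
Hypotheses (hsym : forall X Y, h X Y = h Y X)
  (hlin : forall b c X Y Z, h (b *: X + c *: Y) Z = b * h X Z + c * h Y Z)
  (Slin : forall b c X Y, S (b *: X + c *: Y) = b *: S X + c *: S Y)
  (Ksym : forall X Y, K X Y = K Y X)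
  (Klin : forall b c X Y Z, K (b *: X + c *: Y) Z = b *: K X Z + c *: K Y Z).
Hypotheses
  (hE : [/\ h e1 e1 = 1, h e2 e2 = 1, h e3 e3 = 1 &
            [/\ h e1 e2 = 0, h e1 e3 = 0 & h e2 e3 = 0]])
  (KE1 : [/\ K e1 e1 = (2 * mu1) *: e1, K e1 e2 = - mu1 *: e2
           & K e1 e3 = - mu1 *: e3])
  (KE2 : [/\ K e2 e2 = - mu1 *: e1 + mu2 *: e2, K e2 e3 = - mu2 *: e3
           & K e3 e3 = - mu1 *: e1 - mu2 *: e2])
  (SE : [/\ S e1 = lambda *: e1, S e2 = a *: e2 & S e3 = a *: e3])
  (expand : forall X, X = h X e1 *: e1 + h X e2 *: e2 + h X e3 *: e3).

Let H : set 'M[R]_3 := [set g | [/\ 0 < \det g,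
    forall X Y, h (X *m g) (Y *m g) = h X Y,
    forall X, S (X *m g) = S X *m g
  & forall X Y, K (X *m g) (Y *m g) = K X Y *m g]].

Let comb (x1 x2 x3 : 'rV[R]_3) (p : R * R * R) :=
  p.1.1 *: x1 + p.1.2 *: x2 + p.2 *: x3.

Let combE X : exists p, X = comb e1 e2 e3 p.
Proof. by exists (h X e1, h X e2, h X e3); exact: expand. Qed.

Let h_comb x1 x2 x3 p Z : h (comb x1 x2 x3 p) Z =
  p.1.1 * h x1 Z + p.1.2 * h x2 Z + p.2 * h x3 Z.
Proof.
rewrite /comb; have := hlin 1 p.2 (p.1.1 *: x1 + p.1.2 *: x2) x3 Z.
by rewrite scale1r => ->; rewrite hlin mul1r.
Qed.

Let K_comb x1 x2 x3 p Z : K (comb x1 x2 x3 p) Z =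
  comb (K x1 Z) (K x2 Z) (K x3 Z) p.
Proof.
rewrite /comb; have := Klin 1 p.2 (p.1.1 *: x1 + p.1.2 *: x2) x3 Z.
by rewrite scale1r => ->; rewrite Klin scale1r.
Qed.

Let S_comb x1 x2 x3 p : S (comb x1 x2 x3 p) = comb (S x1) (S x2) (S x3) p.
Proof.
rewrite /comb; have := Slin 1 p.2 (p.1.1 *: x1 + p.1.2 *: x2) x3.
by rewrite scale1r => ->; rewrite Slin scale1r.
Qed.

Let mul_comb x1 x2 x3 p (g : 'M[R]_3) :
  comb x1 x2 x3 p *m g = comb (x1 *m g) (x2 *m g) (x3 *m g) p.
Proof. by rewrite /comb !mulmxDl !scalemxAl. Qed.

Let indep p q : comb e1 e2 e3 p = comb e1 e2 e3 q -> p = q.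
Proof.
case: hE => h11 h22 h33 [h12 h13 h23] E.
have E1 := congr1 (h^~ e1) E; have E2 := congr1 (h^~ e2) E.
have E3 := congr1 (h^~ e3) E; move: E1 E2 E3; rewrite !h_comb.
rewrite (hsym e2 e1) (hsym e3 e1) (hsym e3 e2) h11 h22 h33 h12 h13 h23.
rewrite !(mulr0, mulr1, addr0, add0r).
by case: p q {E} => [[? ?] ?] [[? ?] ?] /= -> -> ->.
Qed.

Let Ef : 'M[R]_3 := \matrix_(i < 3) [:: e1; e2; e3]`_i.

Let Ef_unit : Ef \in unitmx.
Proof.
rewrite -row_free_unit -kermx_eq0; apply/eqP/row_matrixP => i; rewrite row0.
set v := row i _; have vE : v *m Ef = 0.
  by rewrite /v -row_mul mulmx_ker row0.
have E : comb e1 e2 e3 (v 0 0, v 0 1, v 0 2) = comb e1 e2 e3 (0, 0, 0).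
  rewrite [RHS]/comb !scale0r !addr0 -vE mulmx_sum_row !big_ord_recl big_ord0.
  rewrite addr0 !rowK /comb /= addrA.
  by congr (_ *: _ + _ *: _ + _ *: _); congr (v _ _); apply: val_inj.
case: (indep E) => z0 z1 z2; apply/rowP => -[[|[|[|//]]] ?]; rewrite [RHS]mxE.
- by rewrite -[RHS]z0; congr (v _ _); apply: val_inj.
- by rewrite -[RHS]z1; congr (v _ _); apply: val_inj.
- by rewrite -[RHS]z2; congr (v _ _); apply: val_inj.
Qed.

Let frame_map (A : nat -> nat -> R) : exists2 g : 'M[R]_3,
  \det g = \det (\matrix_(i < 3, j < 3) A i j) &
  forall i : 'I_3, [:: e1; e2; e3]`_i *m g =
    \sum_(j < 3) A i j *: [:: e1; e2; e3]`_j.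
Proof.
exists (invmx Ef *m (\matrix_(i < 3, j < 3) A i j) *m Ef).
  rewrite !det_mulmx mulrC mulrA -det_mulmx mulmxV //.
  by rewrite det1 mul1r.
move=> i; have -> : [:: e1; e2; e3]`_i = row i Ef by rewrite rowK.
rewrite -row_mul !mulmxA mulmxV // mul1mx row_mul mulmx_sum_row.
by apply: eq_bigr => j _; rewrite !mxE rowK.
Qed.

(** By bilinearity, a linear map is a symmetry as soon as the image frame satisfies the same
    structure relations as the original one. *)
Lemma frame_symmetry (f1 f2 f3 : 'rV[R]_3) (g : 'M[R]_3) :
  0 < \det g -> [/\ e1 *m g = f1, e2 *m g = f2 & e3 *m g = f3] ->
  [/\ h f1 f1 = 1, h f2 f2 = 1, h f3 f3 = 1 &
            [/\ h f1 f2 = 0, h f1 f3 = 0 & h f2 f3 = 0]] ->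
  [/\ K f1 f1 = (2 * mu1) *: f1, K f1 f2 = - mu1 *: f2
           & K f1 f3 = - mu1 *: f3] ->
  [/\ K f2 f2 = - mu1 *: f1 + mu2 *: f2, K f2 f3 = - mu2 *: f3
           & K f3 f3 = - mu1 *: f1 - mu2 *: f2] ->
  [/\ S f1 = lambda *: f1, S f2 = a *: f2 & S f3 = a *: f3] -> H g.
Proof.
move=> dg [g1 g2 g3] [q11 q22 q33 [q12 q13 q23]] [l11 l12 l13] [l22 l23 l33].
move=> [s1 s2 s3].
case: hE => h11 h22 h33 [h12 h13 h23]; case: KE1 => k11 k12 k13.
case: KE2 => k22 k23 k33; case: SE => t1 t2 t3.
split=> // [X Y|X|X Y].
- have [p ->] := combE X; have [q ->] := combE Y.
  rewrite !mul_comb g1 g2 g3 !h_comb ![h _ (comb _ _ _ _)]hsym !h_comb.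
  rewrite ![h f2 f1]hsym ![h f3 f1]hsym ![h f3 f2]hsym.
  rewrite ![h e2 e1]hsym ![h e3 e1]hsym ![h e3 e2]hsym.
  by rewrite h11 h22 h33 h12 h13 h23 q11 q22 q33 q12 q13 q23.
- have [p ->] := combE X.
  rewrite !mul_comb g1 g2 g3 !S_comb !mul_comb s1 s2 s3 t1 t2 t3.
  by rewrite -!scalemxAl g1 g2 g3.
- have [p ->] := combE X; have [q ->] := combE Y.
  rewrite !mul_comb g1 g2 g3 !K_comb ![K _ (comb _ _ _ _)]Ksym !K_comb.
  rewrite ![K f2 f1]Ksym ![K f3 f1]Ksym ![K f3 f2]Ksym.
  rewrite ![K e2 e1]Ksym ![K e3 e1]Ksym ![K e3 e2]Ksym.
  rewrite !mul_comb k11 k22 k33 k12 k13 k23 l11 l22 l33 l12 l13 l23.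
  by rewrite !mulmxDl !mulNmx -!scalemxAl g1 g2 g3.
Qed.

(** Cosine and ([s3]) sine of a third of a turn. *)
Let c3 : R := - 2^-1.
Let s3 : R := Num.sqrt 3 / 2.

Let s3_sq : s3 ^+ 2 = 3 / 4.
Proof. by rewrite /s3 expr_div_n sqr_sqrtr //; congr (_ / _); ring. Qed.

Let s3_neq0 : s3 != 0.
Proof. by rewrite mulf_neq0 ?invr_eq0 // sqrtr_eq0 -ltNge. Qed.

Let lin2 (b c : R) X Y Z : h Z (b *: X + c *: Y) = b * h Z X + c * h Z Y.
Proof. by rewrite hsym hlin !(hsym Z). Qed.
Let Klin2 (b c : R) X Y Z : K Z (b *: X + c *: Y) = b *: K Z X + c *: K Z Y.
Proof. by rewrite Ksym Klin !(Ksym Z). Qed.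

(** On the plane of e2, e3 the cubic form of K is mu2 (y^3 - 3 y z^2), the real part of mu2 (y + i
    z)^3, so a third of a turn about e1 is always a symmetry. *)
Lemma order3_symmetry : exists2 g, H g & [/\ e1 *m g = e1,
  e2 *m g = c3 *: e2 + s3 *: e3 & e3 *m g = - s3 *: e2 + c3 *: e3].
Proof.
pose A i j : R := (nth [::] [:: [:: 1; 0; 0]; [:: 0; c3; s3];
  [:: 0; - s3; c3]] i)`_j.
have [g dg gE] := frame_map A.
have G1 := gE 0; have G2 := gE 1; have G3 := gE 2.
rewrite /= !big_ord_recl big_ord0 /A /= scale1r !scale0r !addr0 in G1.
rewrite /= !big_ord_recl big_ord0 /A /= scale0r !addr0 add0r in G2.
rewrite /= !big_ord_recl big_ord0 /A /= scale0r !addr0 add0r in G3.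
case: hE => h11 h22 h33 [h12 h13 h23]; case: KE1 => k11 k12 k13.
case: KE2 => k22 k23 k33; case: SE => t1 t2 t3.
have cc : c3 ^+ 2 = 4^-1 by rewrite /c3 sqrrN exprVn; congr (_^-1); ring.
have ss := s3_sq.
have ce : c3 = - 2^-1 by [].
exists g => //; apply: (frame_symmetry _ (And3 G1 G2 G3)).
- rewrite dg (det_expand_nat 2 A).
  rewrite !big_ord_recl big_ord0 /A /= !mul0r !addr0 expr0 !mul1r.
  rewrite (det_expand_nat 1 (fun i j => A i.+1 (bump 0 j))).
  rewrite !big_ord_recl big_ord0 !det_mx11 !mxE /= expr0 expr1.
  by rewrite /bump /A /=; nra.
- rewrite !hlin !lin2 ![h e3 e2]hsym h11 h22 h33 h12 h13 h23.
  by split=> //; [nra|nra|split; [lra|lra|nra]].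
- rewrite !Klin2 k11 k12 k13; move: (e2) (e3) => x2 x3.
  by split=> //; apply/rowP => j; rewrite !mxE; ring.
- rewrite !Klin !Klin2 ![K e3 e2]Ksym k22 k23 k33;
    move: (e1) (e2) (e3) => x1 x2 x3.
  have q1 : s3 * s3 = 3 / 4 by rewrite -expr2.
  have q j : [/\ s3 * s3 * (mu1 * x1 0 j) = 3 / 4 * (mu1 * x1 0 j),
      s3 * s3 * (mu2 * x2 0 j) = 3 / 4 * (mu2 * x2 0 j)
    & s3 * s3 * (mu2 * x3 0 j) = 3 / 4 * (mu2 * x3 0 j)] by rewrite q1.
  by split; apply/rowP => j; have [u v w] := q j; rewrite !mxE ce; lra.
- rewrite !Slin t1 t2 t3; move: (e2) (e3) => x2 x3.
  by split=> //; apply/rowP => j; rewrite !mxE; ring.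
Qed.

(** With mu1 = 0 only mu2 (y^3 - 3 y z^2) remains of K. It ignores the e1 coordinate and is even in
    z, so the half turn about e2 preserves it. *)
Lemma flip_symmetry : mu1 = 0 -> exists2 g, H g &
  e2 *m g = e2 /\ e3 *m g = - e3.
Proof.
move=> m0.
pose A i j : R := (nth [::] [:: [:: -1; 0; 0]; [:: 0; 1; 0];
  [:: 0; 0; -1]] i)`_j.
have [g dg gE] := frame_map A.
have G1 := gE 0; have G2 := gE 1; have G3 := gE 2.
rewrite /= !big_ord_recl big_ord0 /A /= scaleN1r !scale0r !addr0 in G1.
rewrite /= !big_ord_recl big_ord0 /A /= scale1r !scale0r !addr0 add0r in G2.
rewrite /= !big_ord_recl big_ord0 /A /= scaleN1r !scale0r !addr0 !add0r in G3.
case: hE => h11 h22 h33 [h12 h13 h23]; case: KE1 => k11 k12 k13.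
case: KE2 => k22 k23 k33; case: SE => t1 t2 t3.
have hN X Y : h (- X) Y = - h X Y.
  by have := hlin (-1) 0 X 0 Y; rewrite scaler0 addr0 scaleN1r mul0r addr0
    mulN1r.
have KN X Y : K (- X) Y = - K X Y.
  by have := Klin (-1) 0 X 0 Y; rewrite scaler0 addr0 !scaleN1r scale0r addr0.
have SN X : S (- X) = - S X.
  by have := Slin (-1) 0 X 0; rewrite scaler0 addr0 !scaleN1r scale0r addr0.
have hNr X Y : h Y (- X) = - h Y X by rewrite hsym hN hsym.
have KNr X Y : K Y (- X) = - K Y X by rewrite Ksym KN Ksym.
exists g => //; apply: (frame_symmetry _ (And3 G1 G2 G3)).
- rewrite dg (det_expand_nat 2 A).
  rewrite !big_ord_recl big_ord0 /A /= !mul0r !addr0 expr0 !mul1r.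
  rewrite (det_expand_nat 1 (fun i j => A i.+1 (bump 0 j))).
  rewrite !big_ord_recl big_ord0 !det_mx11 !mxE /= expr0 expr1.
  by rewrite /bump /A /=; lra.
- rewrite !hN !hNr h11 h22 h33 h12 h13 h23 !opprK oppr0.
  by split.
- rewrite !KN !KNr k11 k12 k13 m0 !opprK; move: (e1) (e2) (e3) => x1 x2 x3.
  by split; apply/rowP => j; rewrite !mxE; ring.
- rewrite !KN !KNr k22 k23 k33 m0 !opprK; move: (e1) (e2) (e3) => x1 x2 x3.
  by split; apply/rowP => j; rewrite !mxE; ring.
- rewrite !SN t1 t2 t3; move: (e1) (e2) (e3) => x1 x2 x3.
  by split; apply/rowP => j; rewrite !mxE; ring.
Qed.

(** The half turn and the third of a turn send e2, composed in the two orders, to vectors whose e3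
    components differ in sign. *)
Lemma symmetry_mu1_neq0 :
  (forall g k, H g -> H k -> g *m k = k *m g) -> mu1 != 0.
Proof.
move=> Hc; apply/negP => /eqP /flip_symmetry [k Hk [k2 k3]].
have [g Hg [_ g2 _]] := order3_symmetry.
have := congr1 (mulmx e2) (Hc g k Hg Hk).
rewrite !mulmxA g2 k2 g2 mulmxDl -!scalemxAl k2 k3 => /addrI /eqP.
rewrite scalerN eq_sym -subr_eq0 opprK -scalerDl scaler_eq0.
have -> : (s3 + s3 == 0) = false.
  by have := s3_neq0; rewrite -mulr2n mulrn_eq0 => /negPf ->.
move=> /= /eqP e0; case: hE => _ _ + _; rewrite e0.
have := hlin 0 0 0 0 0; rewrite !scale0r addr0 !mul0r addr0 => ->.
by move/eqP; rewrite eq_sym oner_eq0.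
Qed.

(** A nontrivial involution commuting with the third of a turn can only be the half turn about e1;
    it reverses e2, whereas K(e2, e2) is quadratic, so mu2 = - mu2. *)
Lemma symmetry_mu2_eq0 (k : 'M[R]_3) :
  (forall g, H g -> g *m k = k *m g) -> mu1 != 0 ->
  H k -> k *m k = 1%:M -> k <> 1%:M -> mu2 = 0.
Proof.
move=> Hc m0 Hk kk k1; have [g Hg [g1 g2 g3]] := order3_symmetry.
have C (X : 'rV[R]_3) : X *m g *m k = X *m k *m g by rewrite -!mulmxA Hc.
case: hE => h11 h22 h33 [h12 h13 h23]; case: KE1 => k11 k12 k13.
case: KE2 => k22 k23 k33; case: (Hk) => _ hk _ Kk.
have ce : c3 = - 2^-1 by [].
have cE x1 x2 x3 p1 p2 p3 : comb x1 x2 x3 (p1, p2, p3) = p1 *: x1 + p2 *: x2 +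
  p3 *: x3 by [].
have [[[p1 p2] p3] E1] := combE (e1 *m k).
have [[[q1 q2] q3] E2] := combE (e2 *m k).
have [[[r1 r2] r3] E3] := combE (e3 *m k).
have ss := s3_sq; have s0 := s3_neq0.
have gX x y z : comb e1 e2 e3 (x, y, z) *m g =
    comb e1 e2 e3 (x, c3 * y - s3 * z, s3 * y + c3 * z).
  rewrite mul_comb g1 g2 g3 !cE; move: (e1) (e2) (e3) => y1 y2 y3.
  by apply/rowP => j; rewrite !mxE; ring.
(* The image of e1 under [k] is fixed by [g], whose fixed vectors are the multiples of e1. *)
have [p20 p30] : p2 = 0 /\ p3 = 0.
  have := C e1; rewrite g1 E1 gX => /indep [/= u v].
  have u' : s3 * p3 = (c3 - 1) * p2 by move: u; lra.
  have v' : s3 * p2 = (1 - c3) * p3 by move: v; lra.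
  have w : s3 * (s3 * p2) = - (1 - c3) ^+ 2 * p2.
    by rewrite v' mulrCA u'; ring.
  have : (s3 ^+ 2 + (1 - c3) ^+ 2) * p2 = 0 by move: w; nra.
  rewrite ss ce => /eqP; rewrite mulf_eq0.
  have -> : (3 / 4 + (1 - - 2^-1) ^+ 2 == 0 :> R) = false.
    by apply/negbTE/lt0r_neq0; lra.
  move=> /= /eqP p20; split=> //; move/eqP: u'; rewrite p20 mulr0 mulf_eq0.
  by rewrite (negPf s0) => /eqP.
have p11 : p1 * p1 = 1.
  have := hk e1 e1; rewrite E1 p20 p30 cE !scale0r !addr0 h11.
  have -> : p1 *: e1 = p1 *: e1 + 0 *: e1 by rewrite scale0r addr0.
  by rewrite hlin lin2 h11 => H1; lra.
(* Isometry leaves p1 = 1 or p1 = -1, and K(e1, e1) = 2 mu1 e1 with mu1 <> 0 excludes -1. *)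
have p1E : p1 = 1.
  have := Kk e1 e1; rewrite k11 -scalemxAl E1 p20 p30 cE !scale0r !addr0.
  have -> : p1 *: e1 = p1 *: e1 + 0 *: e1 by rewrite scale0r addr0.
  rewrite Klin !Klin2 k11 !scale0r !addr0 => E.
  have : comb e1 e2 e3 (2 * mu1, 0, 0) = comb e1 e2 e3 (2 * mu1 * p1, 0, 0).
    rewrite !cE !scale0r !addr0 -[RHS]scalerA -E !scalerA.
    by congr (_ *: _); rewrite p11 mul1r.
  case/indep => E'; apply: (mulfI m0); lra.
have e1k : e1 *m k = e1 by rewrite E1 p20 p30 p1E cE !scale0r !addr0 scale1r.
have q10 : q1 = 0.
  have := hk e2 e1; rewrite e1k E2 h_comb /= h11 (hsym e2) (hsym e3) h12 h13.
  by rewrite !mulr0 !addr0 mulr1.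
have r10 : r1 = 0.
  have := hk e3 e1; rewrite e1k E3 h_comb /= h11 (hsym e2) (hsym e3) h12 h13.
  by rewrite !mulr0 !addr0 mulr1.
(* Commuting with the rotation makes [k] complex linear on the plane of e2, e3. *)
have [r2E r3E] : r2 = - q3 /\ r3 = q2.
  have := C e2; rewrite g2 mulmxDl -!scalemxAl E2 E3 gX q10 r10.
  have -> : c3 *: comb e1 e2 e3 (0, q2, q3) + s3 *: comb e1 e2 e3 (0, r2, r3) =
      comb e1 e2 e3 (0, c3 * q2 + s3 * r2, c3 * q3 + s3 * r3).
    rewrite !cE; move: (e1) (e2) (e3) => y1 y2 y3.
    by apply/rowP => j; rewrite !mxE; ring.
  case/indep => u v; split; apply: (mulfI s0); lra.
have [q30 q22] : q3 = 0 /\ q2 * q2 = 1.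
  have := congr1 (mulmx e2) kk; rewrite mulmx1 mulmxA E2 mul_comb e1k E2 E3.
  rewrite q10 r10 r2E r3E.
  have -> : comb e1 (comb e1 e2 e3 (0, q2, q3)) (comb e1 e2 e3 (0, - q3, q2))
      (0, q2, q3) = comb e1 e2 e3 (0, q2 * q2 - q3 * q3, 2 * q2 * q3).
    rewrite !cE; move: (e1) (e2) (e3) => y1 y2 y3.
    by apply/rowP => j; rewrite !mxE; ring.
  have -> : e2 = comb e1 e2 e3 (0, 1, 0) by rewrite cE !scale0r addr0 add0r
    scale1r.
  rewrite [in comb e1 (comb _ _ _ _)]cE !scale0r addr0 add0r scale1r.
  case/indep => u v.
  have q3z : q3 = 0.
    have : q2 * q3 = 0 by lra.
    move/eqP; rewrite mulf_eq0 => /orP[/eqP z|/eqP //].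
    by move: u; rewrite z; nra.
  by split=> //; move: u; rewrite q3z; lra.
have e2k : e2 *m k = q2 *: e2 by rewrite E2 q10 q30 cE !scale0r addr0 add0r.
have e3k : e3 *m k = q2 *: e3 by rewrite E3 r10 r2E q30 r3E oppr0 cE !scale0r
  !add0r.
have q21 : q2 <> 1.
  move=> q1'; apply: k1; apply: (can_inj (mulKmx Ef_unit)).
  rewrite mulmx1; apply/row_matrixP => i; rewrite row_mul rowK.
  case: i => [[|[|[|//]]] ?] /=; first by rewrite e1k.
    by rewrite e2k q1' scale1r.
  by rewrite e3k q1' scale1r.
have q2m : q2 = -1.
  have : (q2 - 1) * (q2 + 1) = 0 by lra.
  move/eqP; rewrite mulf_eq0 => /orP[/eqP u|/eqP u]; last by lra.
  by case: q21; lra.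
have := Kk e2 e2; rewrite e2k q2m k22 mulmxDl -!scalemxAl e1k e2k q2m.
have -> : -1 *: e2 = -1 *: e2 + 0 *: e1 by rewrite scale0r addr0.
rewrite Klin !Klin2 k22 !scale0r !addr0 scalerA mulN1r opprK scale1r => /addrI.
move=> E; have : comb e1 e2 e3 (0, mu2, 0) = comb e1 e2 e3 (0, - mu2, 0).
  by rewrite !cE !scale0r !addr0 !add0r E scalerA mulrN1.
by case/indep => ?; lra.
Qed.

End TensorSymmetry.

(** * Propagation of the normal position *)

(** Near [x] the matrix [Th] is bounded, so on each segment of a small ball |m'| <= C m. For a
    nonnegative [m], vanishing at one point of the ball then implies vanishing on the whole ball. *)
Lemma gronwall_ball (R : realType) n p (D : set 'rV[R]_n) (m : 'rV[R]_n -> R)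
    (Th : 'rV[R]_n -> 'M[R]_(n, p)) (x : 'rV[R]_n) :
  open D -> D x -> smooth_on D m -> {for x, continuous Th} ->
  (forall y, D y -> 0 <= m y) ->
  (forall y X, D y -> `|dd X m y| <= (\sum_k `|(X *m Th y) 0 k|) * m y) ->
  exists2 r : R, 0 < r & ball x r `<=` D /\
    forall y y', ball x r y -> ball x r y' -> m y <= 0 -> m y' <= 0.
Proof.
move=> oD Dx sm cTh m0 dm.
pose C0 := `|Th x| + 1.
have nearD : \forall y \near x, D y by exact: open_nbhs_nbhs.
have nearC : \forall y \near x, `|Th y| <= C0.
  have /cvgrPdist_lt /(_ _ ltr01) := cTh; apply: filterS => y /ltW Ty.
  rewrite -[Th y](subrK (Th x)) /C0 addrC; apply: (le_trans (ler_normD _ _)).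
  by rewrite lerD2l distrC.
have [r /= r0 rb] : nbhs_ball x [set y | D y /\ `|Th y| <= C0].
  by apply/nbhs_ballP; near=> y; split; near: y.
exists r => //; split; first by move=> y /rb [].
move=> y y' By By' my; pose v := y' - y.
have seg s : 0 <= s <= 1 -> D (y + s *: v) /\ `|Th (y + s *: v)| <= C0.
  by move=> s01; apply: rb; exact: ball_line.
have -> : y' = y + v by rewrite /v addrC subrK.
apply: (@gronwall_line _ _ _ _ _ (\sum_(k < p) \sum_i `|v 0 i| * C0)) => // s
  s01.
  by have [Ds _] := seg s s01; exact: smooth_on_differentiable sm Ds.
have [Ds Ts] := seg s s01.
have -> : 'D_v m (y + s *: v) = dd v m (y + s *: v) by rewrite ddE.
apply: (le_trans (ler_norm _)); apply: (le_trans (dm _ _ Ds)).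
apply: ler_wpM2r; first exact: m0.
apply: ler_sum => k _; rewrite mxE; apply: (le_trans (ler_norm_sum _ _ _)).
apply: ler_sum => i _; rewrite normrM; apply: ler_wpM2l => //.
exact: (le_trans (mx_entry_le_norm _ _ _)).
Unshelve. all: by end_near. Qed.

Lemma constant_ball (R : realType) n (D : set 'rV[R]_n) (f : 'rV[R]_n -> R)
    (x y y' : 'rV[R]_n) (r : R) : smooth_on D f -> ball x r `<=` D ->
  (forall z X, ball x r z -> dd X f z = 0) ->
  ball x r y -> ball x r y' -> f y' = f y.
Proof.
move=> sf rD df By By'; have -> : y' = y + (y' - y) by rewrite addrC subrK.
apply: derive0_line => s s01; have Bs := ball_line By By' s01.
  by exact: smooth_on_differentiable sf (rD _ Bs).
by rewrite -(df _ (y' - y) Bs) ddE.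
Qed.

(** All equations are linear in the vector fields and contain [G] only through derivatives; only the
    volume changes, by the determinant. *)
Lemma cone_frame_affine (R : realType) (D : set 'rV[R]_3)
    (G Z E1 E2 E3 : 'rV[R]_3 -> 'rV[R]_4) (e1 e2 e3 : 'rV[R]_3 -> 'rV[R]_3)
    (sg tu mu1 mu2 rho al be : 'rV[R]_3 -> R) (vol : R)
    (Q : 'M[R]_4) (b : 'rV[R]_4) :
  cone_frame D G Z E1 E2 E3 e1 e2 e3 sg tu mu1 mu2 rho al be vol ->
  cone_frame D (fun y => G y *m Q + b) (fun y => Z y *m Q) (fun y => E1 y *m Q)
    (fun y => E2 y *m Q) (fun y => E3 y *m Q) e1 e2 e3 sg tu mu1 mu2 rho al be
    (vol * `|\det Q|).
Proof.
case=> oD [sG sZ [sE1 sE2 sE3]] sf sg0 tuE fr vl dE d1 d2 d3 dZ dsg.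
have sQ (f : 'rV[R]_3 -> 'rV[R]_4) : smooth_on D f -> smooth_on D (fun y => f y
  *m Q).
  by move=> sf'; apply: smooth_on_mulmx => //; exact: smooth_on_cst.
have dQ (f : 'rV[R]_3 -> 'rV[R]_4) X y : smooth_on D f -> D y ->
    dd X (fun y => f y *m Q) y = dd X f y *m Q.
  by move=> sf' Dy; rewrite (dd_mulmxr oD).
have linQ := (mulmxDl, mulNmx, scalemxAl).
split=> //.
- split; [|exact: sQ|by split; exact: sQ].
  by apply: smooth_onD => //; [exact: sQ|exact: smooth_on_cst].
- by move=> y Dy; rewrite -rows4_mul det_mulmx normrM vl.
- move=> y Dy; have [q1 q2 q3] := dE y Dy.
  have dG X : dd X (fun y => G y *m Q + b) y = dd X G y *m Q.
    rewrite (ddD oD) //; first by rewrite dQ // dd_cst addr0.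
      exact: sQ.
    exact: smooth_on_cst.
  by rewrite !dG q1 q2 q3.
- by move=> y Dy; have [q1 q2 q3] := d1 y Dy; rewrite !dQ // q1 q2 q3 !linQ.
- by move=> y Dy; have [q1 q2 q3] := d2 y Dy; rewrite !dQ // q1 q2 q3 !linQ.
- by move=> y Dy; have [q1 q2 q3] := d3 y Dy; rewrite !dQ // q1 q2 q3 !linQ.
- by move=> y Dy; have [q1 q2 q3] := dZ y Dy;
    rewrite !dQ // q1 q2 q3 !linQ mul0mx.
Qed.

Lemma norm_comb6 (R : realDomainType) (M x1 x2 x3 x4 x5 x6 q1 q2 q3 q4 q5 q6 :
  R) :
  `|q1| <= M -> `|q2| <= M -> `|q3| <= M -> `|q4| <= M -> `|q5| <= M ->
  `|q6| <= M -> `|x1 * q1 + x2 * q2 + x3 * q3 + x4 * q4 + x5 * q5 + x6 * q6| <=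
  (`|x1| + `|x2| + `|x3| + `|x4| + `|x5| + `|x6|) * M.
Proof.
move=> *; rewrite !mulrDl; have H (x q : R) : `|q| <= M -> `|x * q| <= `|x| * M.
  by move=> ?; rewrite normrM; exact: ler_wpM2l.
do 5![apply: (le_trans (ler_normD _ _)); apply: lerD; last exact: H].
exact: H.
Qed.

(** Left is the derivative of the energy in a direction with frame components w0, w1, w2. The
    rotation rates [rho], [al], [be] cancel by skewness, leaving six weights times quadratic forms
    dominated by the energy. *)
Lemma cone_energy_bound (R : realFieldType)
    (w0 w1 w2 tu mu1 mu2 rho al be m1 m2 m3 u2 u3 : R) :
  `|w0 * (2 * (m1 * (- tu * m1) + m2 * (- tu * m2) + m3 * (- tu * m3) +
      u2 * (- mu1 * u2 + rho * u3) + u3 * (- rho * u2 - mu1 * u3))) +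
    w1 * (2 * (u2 * (mu2 * u2 + al * u3 + m3) + u3 * (- al * u2 - mu2 * u3))) +
    w2 * (2 * (u2 * ((be - mu2) * u3) + u3 * (- (be + mu2) * u2 + m3)))| <=
  (`|w0 * (2 * tu)| + `|w0 * (2 * mu1)| + `|w1 * (2 * mu2)| +
    `|w2 * (2 * mu2)| + `|w1| + `|w2|) *
  (m1 ^+ 2 + m2 ^+ 2 + m3 ^+ 2 + (u2 ^+ 2 + u3 ^+ 2)).
Proof.
(* Mixed products are dominated through squares of sums and differences; each goal keeps only the
   squares it uses. *)
have M0 := sqr_ge0 m1; have M1 := sqr_ge0 m2; have M2 := sqr_ge0 m3.
have M3 := sqr_ge0 u2; have M4 := sqr_ge0 u3.
have M5 := sqr_ge0 (u2 + u3); have M6 := sqr_ge0 (u2 - u3).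
have M7 := sqr_ge0 (u2 + m3); have M8 := sqr_ge0 (u2 - m3).
have M9 := sqr_ge0 (u3 + m3); have M10 := sqr_ge0 (u3 - m3).
set M := m1 ^+ 2 + m2 ^+ 2 + m3 ^+ 2 + (u2 ^+ 2 + u3 ^+ 2).
have := @norm_comb6 _ M (w0 * (2 * tu)) (w0 * (2 * mu1)) (w1 * (2 * mu2))
  (w2 * (2 * mu2)) w1 w2 (- (m1 ^+ 2 + m2 ^+ 2 + m3 ^+ 2))
  (- (u2 ^+ 2 + u3 ^+ 2)) (u2 ^+ 2 - u3 ^+ 2) (- 2 * u2 * u3)
  (2 * u2 * m3) (2 * u3 * m3).
move=> H; apply: le_trans (H _ _ _ _ _ _); clear H.
- by rewrite le_eqVlt; apply/orP; left; apply/eqP; congr (`|_|); ring.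
- by clear M5 M6 M7 M8 M9 M10; rewrite ler_norml /M; apply/andP; split; lra.
- by clear M5 M6 M7 M8 M9 M10; rewrite ler_norml /M; apply/andP; split; lra.
- by clear M5 M6 M7 M8 M9 M10; rewrite ler_norml /M; apply/andP; split; lra.
- by clear M7 M8 M9 M10; rewrite ler_norml /M; apply/andP; split; lra.
- by clear M5 M6 M9 M10; rewrite ler_norml /M; apply/andP; split; lra.
- by clear M5 M6 M7 M8; rewrite ler_norml /M; apply/andP; split; lra.
Qed.

Section ConeFrame.
Variables (R : realType) (D : set 'rV[R]_3)
    (G Z E1 E2 E3 : 'rV[R]_3 -> 'rV[R]_4) (e1 e2 e3 : 'rV[R]_3 -> 'rV[R]_3)
    (sg tu mu1 mu2 rho al be : 'rV[R]_3 -> R) (vol : R).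
Hypothesis C : cone_frame D G Z E1 E2 E3 e1 e2 e3 sg tu mu1 mu2 rho al be vol.

Let oD : open D. Proof. exact: cf_open C. Qed.
Let sG : smooth_on D G. Proof. by case: (cf_smooth C). Qed.
Let sZ : smooth_on D Z. Proof. by case: (cf_smooth C). Qed.
Let sE1 : smooth_on D E1. Proof. by case: (cf_smooth C) => _ _ []. Qed.
Let sE2 : smooth_on D E2. Proof. by case: (cf_smooth C) => _ _ []. Qed.
Let sE3 : smooth_on D E3. Proof. by case: (cf_smooth C) => _ _ []. Qed.
Let ssg : smooth_on D sg. Proof. by case: (cf_smooth_fun C). Qed.
Let stu : smooth_on D tu. Proof. by case: (cf_smooth_fun C). Qed.
Let smu1 : smooth_on D mu1. Proof. by case: (cf_smooth_fun C). Qed.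
Let smu2 : smooth_on D mu2. Proof. by case: (cf_smooth_fun C). Qed.
Let sE (f : 'rV[R]_3 -> 'rV[R]_4) j : smooth_on D f ->
  smooth_on D (fun y => f y 0 j : R).
Proof. exact: smooth_on_mxE. Qed.
Let dj (f : 'rV[R]_3 -> 'rV[R]_4) j X y : smooth_on D f -> D y ->
  dd X (fun y => f y 0 j : R) y = dd X f y 0 j.
Proof. by move=> sf Dy; rewrite (dd_mxE oD). Qed.

(* The graph-of-a-cone normal form of the moving frame: its preservation is a
   linear total differential system. *)
Definition cone_position y :=
  [/\ [/\ Z y 0 0 = 0, Z y 0 1 = 0 & Z y 0 3 = 0],
      [/\ G y 0 0 = E1 y 0 0 / sg y, G y 0 1 = E1 y 0 1 / sg y
        & G y 0 3 = E1 y 0 3 / sg y],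
      E2 y 0 3 = 0 /\ E3 y 0 3 = 0
    & `|Z y 0 2 ^+ 2 * G y 0 3 ^+ 2 * sg y| = vol].

Lemma dd_cone_frame (W : normedModType R) (f : 'rV[R]_3 -> W) :
  smooth_on D f -> exists2 B : 'rV[R]_3 -> 'M[R]_3, smooth_on D B &
  forall X y, D y -> dd X f y = (X *m B y) 0 0 *: dd (e1 y) f y +
     (X *m B y) 0 1 *: dd (e2 y) f y + (X *m B y) 0 2 *: dd (e3 y) f y.
Proof.
move=> sf; have [B sB fr] := cf_frame C; exists B => // X y Dy.
by rewrite {1}(fr y X Dy) !(dd_dirD _ _ sf Dy) !(dd_dirZ _ _ sf Dy).
Qed.

Lemma dd_cone_eq0 (f : 'rV[R]_3 -> R) y X : smooth_on D f -> D y ->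
  dd (e1 y) f y = 0 -> dd (e2 y) f y = 0 -> dd (e3 y) f y = 0 -> dd X f y = 0.
Proof.
move=> sf Dy d1 d2 d3; have [B _ ->] := dd_cone_frame sf => //.
by rewrite d1 d2 d3 !scaler0 !addr0.
Qed.

Let m y : R := Z y 0 0 ^+ 2 + Z y 0 1 ^+ 2 + Z y 0 3 ^+ 2 +
  (E2 y 0 3 ^+ 2 + E3 y 0 3 ^+ 2).

Let sm : smooth_on D m.
Proof.
by rewrite /m; do !apply: smooth_onD => //; apply: smooth_onX => //; exact: sE.
Qed.

Let dd_m X y : D y -> dd X m y = 2 * (Z y 0 0 * dd X Z y 0 0 +
  Z y 0 1 * dd X Z y 0 1 + Z y 0 3 * dd X Z y 0 3 + E2 y 0 3 * dd X E2 y 0 3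
  + E3 y 0 3 * dd X E3 y 0 3).
Proof.
move=> Dy; have sq (f : 'rV[R]_3 -> 'rV[R]_4) j : smooth_on D f ->
    dd X (fun y => f y 0 j ^+ 2 : R) y = 2 * (f y 0 j * dd X f y 0 j).
  move=> sf; have -> : (fun y => f y 0 j ^+ 2 : R) = (fun y => f y 0 j * f y 0
    j).
    by apply/funext => z; rewrite expr2.
  by rewrite (ddM oD) ?dj //; [ring|exact: sE|exact: sE].
have s2 (f : 'rV[R]_3 -> 'rV[R]_4) j : smooth_on D f ->
    smooth_on D (fun y => f y 0 j ^+ 2 : R).
  by move=> sf; apply: smooth_onX => //; exact: sE.
have z0 := s2 Z 0 sZ; have z1 := s2 Z 1 sZ; have z3 := s2 Z 3 sZ.
have u2 := s2 E2 3 sE2; have u3 := s2 E3 3 sE3.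
rewrite /m (ddD oD X (smooth_onD oD (smooth_onD oD z0 z1) z3) (smooth_onD oD u2
  u3)) //.
rewrite (ddD oD X (smooth_onD oD z0 z1) z3) // (ddD oD X z0 z1) // (ddD oD X u2
  u3) //.
by rewrite !sq //; ring.
Qed.

(** Gronwall's inequality, applied to the sum of the squares of the components of Z, E2, E3 that
    should vanish, propagates these. Once they vanish on the ball, the remaining conditions compare
    quantities with zero derivative. *)
Lemma cone_position_ball x : D x ->
  exists2 r : R, 0 < r & ball x r `<=` D /\ forall y y', ball x r y ->
    ball x r y' -> cone_position y -> cone_position y'.
Proof.
move=> Dx; have [B sB fr] := cf_frame C.
have dm X y : D y -> dd X m y =
    (X *m B y) 0 0 * dd (e1 y) m y + (X *m B y) 0 1 * dd (e2 y) m y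
    + (X *m B y) 0 2 * dd (e3 y) m y.
  move=> Dy; rewrite {1}(fr y X Dy) !(dd_dirD _ _ sm Dy).
  by rewrite !(dd_dirZ _ _ sm Dy).
(* The six columns are the weights of [cone_energy_bound], as linear functions of the frame
   components of a direction. *)
pose P y : 'M[R]_(3, 6) := \matrix_(i < 3, j < 6)
  (nth [::] [:: [:: 2 * tu y; 2 * mu1 y; 0; 0; 0; 0]; [:: 0; 0; 2 * mu2 y; 0;
    1; 0];
      [:: 0; 0; 0; 2 * mu2 y; 0; 1]] i)`_j.
have sP : smooth_on D P.
  have s2 (f : 'rV[R]_3 -> R) : smooth_on D f -> smooth_on D (fun y => 2 * f y).
    by move=> sf; apply: smooth_onM => //; exact: smooth_on_cst.
  have s0 : smooth_on D (fun=> 0 : R) by exact: smooth_on_cst.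
  have s1 : smooth_on D (fun=> 1 : R) by exact: smooth_on_cst.
  apply: smooth_on_mx => // i j.
  apply: (@smooth_on_eq _ _ _ _ (fun y => (nth [::] [:: [:: 2 * tu y;
    2 * mu1 y; 0; 0; 0; 0]; [:: 0; 0; 2 * mu2 y; 0; 1; 0];
      [:: 0; 0; 0; 2 * mu2 y; 0; 1]] i)`_j)) => //; first by move=> y _;
        rewrite mxE.
  case: i => [[|[|[|//]]] ?]; case: j => [[|[|[|[|[|[|//]]]]]] ?] //=;
    exact: s2.
have [r r0 [rD prop]] : exists2 r : R, 0 < r & ball x r `<=` D /\
    forall y y', ball x r y -> ball x r y' -> m y <= 0 -> m y' <= 0.
  have cT : {for x, continuous (fun y => B y *m P y)}.
    by apply: (@smooth_on_continuous _ _ _ D) => //; exact: smooth_on_mulmx.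
  apply: (gronwall_ball oD Dx sm cT).
  - by move=> y _; rewrite /m !addr_ge0 // sqr_ge0.
  move=> y X Dy; rewrite mulmxA; move: (dm X y Dy) => ->.
  move: (X *m B y) => W.
  have WP : (\sum_k `|(W *m P y) 0 k|) = `|W 0 0 * (2 * tu y)| +
      `|W 0 0 * (2 * mu1 y)| + `|W 0 1 * (2 * mu2 y)| + `|W 0 2 * (2 * mu2 y)|
      + `|W 0 1| + `|W 0 2|.
    rewrite !big_ord_recl big_ord0 !mxE !big_ord_recl !big_ord0 !mxE /=.
    have -> : lift ord0 ord0 = 1 :> 'I_3 by apply: val_inj.
    have -> : lift ord0 (lift ord0 ord0) = 2 :> 'I_3 by apply: val_inj.
    have -> : ord0 = 0 :> 'I_3 by [].
    by rewrite !(mulr0, mulr1, addr0, add0r) !addrA.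
  rewrite WP !dd_m //.
  have [z1 z2 z3] := cf_dZ C Dy; have [q12 q22 q32] := cf_dE2 C Dy.
  have [q13 q23 q33] := cf_dE3 C Dy.
  rewrite z1 z2 z3 q12 q22 q32 q13 q23 q33 !mxE.
  by rewrite !(mulr0, mulr1, addr0, add0r) /m; exact: cone_energy_bound.
exists r => //; split=> // y y' By By' [[z0 z1 z3] [g0 g1 g3] [u2 u3] vy].
have m0 : m y <= 0 by rewrite /m z0 z1 z3 u2 u3 expr0n /= !addr0.
have Bm z : ball x r z -> [/\ Z z 0 0 = 0, Z z 0 1 = 0, Z z 0 3 = 0,
    E2 z 0 3 = 0 & E3 z 0 3 = 0].
  move=> Bz; have := prop y z By Bz m0; rewrite /m.
  have M0 := sqr_ge0 (Z z 0 0); have M1 := sqr_ge0 (Z z 0 1).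
  have M2 := sqr_ge0 (Z z 0 3).
  have M3 := sqr_ge0 (E2 z 0 3); have M4 := sqr_ge0 (E3 z 0 3).
  by move=> H; split; apply/eqP; rewrite -sqrf_eq0 eq_le sqr_ge0 andbT; lra.
have [z0' z1' z3' u2' u3'] := Bm y' By'.
have sV : smooth_on D (fun y => (sg y)^-1) by exact: smooth_onV (cf_sg_neq0 C).
have sEV j : smooth_on D (fun y => E1 y 0 j / sg y).
  by apply: smooth_onM => //; exact: sE.
have gc j z : ball x r z -> (forall z, ball x r z -> Z z 0 j = 0) ->
    G y 0 j = E1 y 0 j / sg y -> G z 0 j = E1 z 0 j / sg z.
  (* As tu = sg + 2 mu1, the derivative of G - E1 / sg along [e1] is - Z / sg, and along [e2], [e3]
     it is 0; so component [j] is constant where that of Z vanishes. *)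
  move=> Bz zj gj; pose f z : R := G z 0 j - E1 z 0 j / sg z.
  have sf : smooth_on D f by apply: smooth_onB => //; exact: sE.
  have fc : f z = f y.
    apply: (constant_ball sf rD) => // w X Bw; have Dw := rD _ Bw.
    have sg0 := cf_sg_neq0 C Dw.
    have dfE e : dd e f w = dd e G w 0 j - (dd e E1 w 0 j / sg w
        - E1 w 0 j * dd e sg w / sg w ^+ 2).
      rewrite /f (ddB oD) ?dj ?(ddM oD) ?(ddV oD) ?dj //; try exact: sE.
      by field.
    have [d1 d2 d3] := cf_E C Dw; have [k1 k2 k3] := cf_dE1 C Dw.
    have [l1 l2 l3] := cf_dsg C Dw; have tE := cf_tuE C Dw.
    apply: dd_cone_eq0 => //; rewrite dfE ?d1 ?d2 ?d3 ?k1 ?k2 ?k3 ?l1 ?l2 ?l3.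
    - by rewrite !mxE zj // tE; field.
    - by rewrite !mxE; field.
    - by rewrite !mxE; field.
  by move/eqP: fc; rewrite /f gj subrr subr_eq0 => /eqP.
have g3' z : ball x r z -> G z 0 3 = E1 z 0 3 / sg z.
  by move=> Bz; apply: gc => // w /Bm [].
split=> //.
  by split; [apply: gc => // z /Bm []|apply: gc => // z /Bm []|exact: g3'].
rewrite -vy; congr (`|_|).
(* Along [e1] the factors contribute the rates - 2 tu, 2 sg and 4 mu1, which add up to 0; along
   [e2], [e3] every factor is constant. *)
pose f z : R := Z z 0 2 * Z z 0 2 * (G z 0 3 * G z 0 3) * sg z.
have sZ2 := sE 2 sZ; have sG3 := sE 3 sG.
have sZZ := smooth_onM oD sZ2 sZ2; have sGG := smooth_onM oD sG3 sG3.
have sZG := smooth_onM oD sZZ sGG.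
have sf : smooth_on D f by exact: smooth_onM.
rewrite !expr2; apply: (constant_ball sf rD) => // z X Bz; have Dz := rD _ Bz.
have dfE e : dd e f z = (2 * (Z z 0 2 * dd e Z z 0 2) * (G z 0 3 * G z 0 3) +
    Z z 0 2 * Z z 0 2 * (2 * (G z 0 3 * dd e G z 0 3))) * sg z +
    Z z 0 2 * Z z 0 2 * (G z 0 3 * G z 0 3) * dd e sg z.
  rewrite /f (ddM oD e sZG ssg Dz) (ddM oD e sZZ sGG Dz) (ddM oD e sZ2 sZ2 Dz).
  by rewrite (ddM oD e sG3 sG3 Dz) !dj //; ring.
have [d1 d2 d3] := cf_E C Dz; have [k1 k2 k3] := cf_dZ C Dz.
have [l1 l2 l3] := cf_dsg C Dz; have tE := cf_tuE C Dz.
have [_ _ _ w2 w3] := Bm z Bz; have sg0 := cf_sg_neq0 C Dz.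
have e13 : E1 z 0 3 = sg z * G z 0 3 by rewrite g3' // mulrC divfK.
apply: dd_cone_eq0 => //; rewrite dfE ?d1 ?d2 ?d3 ?k1 ?k2 ?k3 ?l1 ?l2 ?l3.
- by rewrite !mxE e13 tE; ring.
- by rewrite !mxE w2; ring.
- by rewrite !mxE w3; ring.
Qed.

End ConeFrame.

(** * Changes of chart and of frame *)

(** Sealed so that metrics of two charts are compared by their arguments and never unfold to second
    derivatives. *)
HB.lock Definition metric (R : realType) (n : nat)
  (G xi : 'rV[R]_n -> 'rV[R]_n.+1) (x X Y : 'rV[R]_n) : R :=
  affine_metric G xi x X Y.

Lemma metricE (R : realType) (n : nat) (G xi : 'rV[R]_n -> 'rV[R]_n.+1)
  (x X Y : 'rV[R]_n) : affine_metric G xi x X Y = metric G xi x X Y.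
Proof. by rewrite metric.unlock. Qed.

Lemma dd_comp (R : realType) (V V' W : normedModType R) (D : set V)
    (D' : set V') (f : V -> V') (g : V' -> W) (x v : V) :
  smooth_on D f -> smooth_on D' g -> D x -> D' (f x) ->
  dd v (fun y => g (f y)) x = dd (dd v f x) g (f x).
Proof.
move=> sf sg Dx Dfx; rewrite !ddE; apply: derive_comp.
  exact: smooth_on_differentiable sf Dx.
exact: smooth_on_differentiable sg Dfx.
Qed.

Section Transition.
Variables (R : realType) (n : nat) (D D' : set 'rV[R]_n)
  (G xi G' xi' : 'rV[R]_n -> 'rV[R]_n.+1) (tau : 'rV[R]_n -> 'rV[R]_n).
Hypotheses (oD : open D) (oD' : open D') (hB : blaschke_hypersurface D G xi)
  (hB' : blaschke_hypersurface D' G' xi') (st : smooth_on D tau)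
  (tD : forall y, D y -> D' (tau y))
  (GE : forall y, D y -> G y = G' (tau y))
  (xiE : forall y, D y -> xi y = xi' (tau y)).

Let sG : smooth_on D G. Proof. by case: hB. Qed.
Let sG' : smooth_on D' G'. Proof. by case: hB'. Qed.

Lemma dd_transition X y : D y -> dd X G y = dd (dd X tau y) G' (tau y).
Proof.
move=> Dy; rewrite (dd_eq oD (g := fun y => G' (tau y))) //.
exact: (dd_comp _ st sG' Dy (tD Dy)).
Qed.

Lemma transversal_part_transition w y : D y ->
  transversal_part G xi y w = transversal_part G' xi' (tau y) w.
Proof.
move=> Dy; have := frame_decomp hB w Dy.
rewrite (dd_transition _ Dy) (xiE Dy) => wE.
by rewrite {2}wE (transversal_partE hB' _ _ (tD Dy)).
Qed.

(** The second derivatives of the coordinate change only multiply tangent vectors, so they disappear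
    from the transversal part. *)
Lemma metric_transition X Y y : D y ->
  metric G xi y X Y = metric G' xi' (tau y) (dd X tau y) (dd Y tau y).
Proof.
move=> Dy; have D'y := tD Dy.
have hdd H zeta z U V : metric H zeta z U V = transversal_part H zeta z (dd U
  (dd V H) z).
  by rewrite metric.unlock /affine_metric !ddE.
pose tk k z : R := dd Y tau z 0 k; pose dk k := dd (delta_mx 0 k) G'.
have sk k : smooth_on D (tk k).
  exact: smooth_on_mxE oD (smooth_dd Y st).
have sdk k : smooth_on D' (dk k) by exact: smooth_dd.
have sdt k : smooth_on D (fun z => dk k (tau z)).
  exact: (@smooth_on_comp _ _ _ _ D D' tau (dk k)).
rewrite [LHS]hdd.
have -> : dd X (dd Y G) y = dd X (fun z => \sum_k tk k z *: dk k (tau z)) y.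
  apply: (dd_eq oD) => // z Dz.
  by rewrite dd_transition // (dd_rV _ sG' (tD Dz)).
have sS k : smooth_on D (fun z => tk k z *: dk k (tau z)) by exact: smooth_onZ.
rewrite (dd_sum oD _ X sS Dy).
pose h k := transversal_part G' xi' (tau y) (dd (dd X tau y) (dk k) (tau y)).
pose V k := tangential_part G' xi' (tau y) (dd (dd X tau y) (dk k) (tau y)).
have E k : dd X (fun z => tk k z *: dk k (tau z)) y =
    dd (dd X (tk k) y *: delta_mx 0 k + tk k y *: V k) G' (tau y)
    + (tk k y * h k) *: xi' (tau y).
  rewrite (ddZ oD _ (sk k) (sdt k) Dy) (dd_comp _ st (sdk k) Dy D'y).
  rewrite {1}(frame_decomp hB' (dd (dd X tau y) (dk k) (tau y)) D'y).
  rewrite -/(V k) -/(h k) (dd_dirD _ _ sG' D'y) !(dd_dirZ _ _ sG' D'y) -/(dk k).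
  by rewrite scalerDr scalerA addrA.
have dd_dir_sum (u : 'I_n -> 'rV[R]_n) (r : seq 'I_n) :
    dd (\sum_(k <- r) u k) G' (tau y) = \sum_(k <- r) dd (u k) G' (tau y).
  elim: r => [|k r IH]; first by rewrite !big_nil dd_dir0.
  by rewrite !big_cons (dd_dirD _ _ sG' D'y) IH.
rewrite (eq_bigr _ (fun k _ => E k)) big_split /= -dd_dir_sum -scaler_suml.
rewrite transversal_part_transition // (transversal_partE hB' _ _ D'y).
rewrite [dd Y tau y]row_sum_delta.
rewrite (metric_sumr oD' hB' (metricE G' xi') _ _ _ _ D'y);
  apply: eq_bigr => k _.
by rewrite hdd.
Qed.

End Transition.

(* Where [eta - mu1] vanishes nowhere, [a = mu1^2 - eta^2] forces the cone
   structure. *)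
Record adapted_patch (R : realType) (D : set 'rV[R]_3)
    (G xi : 'rV[R]_3 -> 'rV[R]_4) (e1 e2 e3 : 'rV[R]_3 -> 'rV[R]_3)
    (lambda a mu1 mu2 eta : 'rV[R]_3 -> R) : Prop := AdaptedPatch {
  ap_open : open D;
  ap_blaschke : blaschke_hypersurface D G xi;
  ap_smooth : [/\ smooth_on D e1, smooth_on D e2 & smooth_on D e3];
  ap_frame : forall y, D y -> adapted_frame G xi e1 e2 e3 (lambda y) (a y)
    (mu1 y) (mu2 y) (eta y) y;
  ap_a : forall y, D y -> a y = - eta y ^+ 2 + mu1 y ^+ 2;
  ap_mu1 : forall y, D y -> mu1 y != 0;
  ap_sg : forall y, D y -> eta y - mu1 y != 0 }.

Section Patch.
Variables (R : realType) (D : set 'rV[R]_3) (G xi : 'rV[R]_3 -> 'rV[R]_4)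
  (e1 e2 e3 : 'rV[R]_3 -> 'rV[R]_3) (lambda a mu1 mu2 eta : 'rV[R]_3 -> R).

Let Z y := xi y - (eta y + mu1 y) *: dd (e1 y) G y.

Lemma adapted_patch_cone :
  adapted_patch D G xi e1 e2 e3 lambda a mu1 mu2 eta ->
  exists rho al be, cone_frame D G Z (fun y => dd (e1 y) G y)
    (fun y => dd (e2 y) G y) (fun y => dd (e3 y) G y) e1 e2 e3
    (fun y => eta y - mu1 y) (fun y => eta y + mu1 y) mu1 mu2 rho al be 1.
Proof.
case=> oD hB [se1 se2 se3] hA ha hmu1 hsg.
do 3 eexists.
exact: (cone_frame_of_adapted oD hB se1 se2 se3 hA (metricE G xi)
  (fun _ _ _ => erefl) (fun _ _ _ => erefl) ha hmu1 hsg).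
Qed.

Lemma adapted_patch_expand y X :
  adapted_patch D G xi e1 e2 e3 lambda a mu1 mu2 eta -> D y ->
  X = metric G xi y X (e1 y) *: e1 y + metric G xi y X (e2 y) *: e2 y
    + metric G xi y X (e3 y) *: e3 y.
Proof.
case=> oD hB [se1 se2 se3] hA ha hmu1 hsg Dy.
exact: (orthonormal_expand oD hB hA (metricE G xi) X Dy).
Qed.

Lemma adapted_patch_dd_sg y X :
  adapted_patch D G xi e1 e2 e3 lambda a mu1 mu2 eta -> D y ->
  dd X (fun y => eta y - mu1 y) y =
  4 * mu1 y * (eta y - mu1 y) * metric G xi y X (e1 y).
Proof.
case=> oD hB [se1 se2 se3] hA ha hmu1 hsg Dy.
exact: (dd_sg oD hB se1 se2 se3 hA (metricE G xi)
  (fun _ _ _ => erefl) (fun _ _ _ => erefl) ha hmu1 hsg X Dy).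
Qed.

End Patch.

Section FrameTransition.
Variables (R : realType) (D D' : set 'rV[R]_3)
  (G xi G' xi' : 'rV[R]_3 -> 'rV[R]_4)
  (e1 e2 e3 e1' e2' e3' : 'rV[R]_3 -> 'rV[R]_3)
  (lambda a mu1 mu2 eta lambda' a' mu1' mu2' eta' : 'rV[R]_3 -> R)
  (tau : 'rV[R]_3 -> 'rV[R]_3).
Hypotheses (P : adapted_patch D G xi e1 e2 e3 lambda a mu1 mu2 eta)
  (P' : adapted_patch D' G' xi' e1' e2' e3' lambda' a' mu1' mu2' eta')
  (st : smooth_on D tau) (tD : forall y, D y -> D' (tau y))
  (GE : forall y, D y -> G y = G' (tau y))
  (xiE : forall y, D y -> xi y = xi' (tau y))
  (mu1E : forall y, D y -> mu1 y = mu1' (tau y))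
  (etaE : forall y, D y -> eta y = eta' (tau y)).

Let oD : open D := ap_open P.
Let oD' : open D' := ap_open P'.
Let hB := ap_blaschke P.
Let hB' := ap_blaschke P'.
Let sg y := eta y - mu1 y.
Let sg' y := eta' y - mu1' y.
Let h := metric G xi.
Let h' := metric G' xi'.

(** Both sides are the differential of the chart independent function [sg], divided by the nonzero
    factor 4 mu1 sg. *)
Let h'_e1 X y : D y -> h' (tau y) (dd X tau y) (e1' (tau y)) = h y X (e1 y).
Proof.
move=> Dy; have D'y := tD Dy.
have [rho' [al' [be' C']]] := adapted_patch_cone P'.
have ssg' : smooth_on D' sg' by case: (cf_smooth_fun C').
have := adapted_patch_dd_sg X P Dy.
rewrite -/(sg y) (dd_eq oD (g := fun z => sg' (tau z))) //; last first.
  by move=> z Dz; rewrite etaE // mu1E.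
rewrite (dd_comp X st ssg' Dy D'y) (adapted_patch_dd_sg _ P' D'y).
have -> : eta' (tau y) - mu1' (tau y) = sg y by rewrite /sg etaE // mu1E.
rewrite -mu1E // -/h -/h'; apply: mulfI.
by rewrite !mulf_neq0 ?(ap_mu1 P) ?(ap_sg P) // pnatr_eq0.
Qed.

Let h'_tau X Y y : D y -> h' (tau y) (dd X tau y) (dd Y tau y) = h y X Y.
Proof.
by move=> Dy; rewrite /h (metric_transition oD oD' hB hB' st tD GE xiE X Y Dy).
Qed.

(** The image of e1 is a unit vector whose component along e1' is 1, so its other components vanish;
    the images of e2 and e3 have component 0 along e1'. *)
Lemma frame_transition y : D y ->
  [/\ dd (e1 y) tau y = e1' (tau y),
      exists p q, dd (e2 y) tau y = p *: e2' (tau y) + q *: e3' (tau y)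
    & exists p q, dd (e3 y) tau y = p *: e2' (tau y) + q *: e3' (tau y)].
Proof.
move=> Dy; have D'y := tD Dy.
have x' X := adapted_patch_expand X P' D'y.
have [[+ + + [+ + +]] _ _ _ _] := ap_frame P Dy.
rewrite !metricE -/h => h11 h22 h33 h12 h13 h23.
have [[+ + + [+ + +]] _ _ _ _] := ap_frame P' D'y.
rewrite !metricE -/h' => k11 k22 k33 k12 k13 k23.
have hs X Y : h y X Y = h y Y X by exact: (metric_sym oD hB (metricE G xi) X Y
  Dy).
have hs' X Y : h' (tau y) X Y = h' (tau y) Y X.
  exact: (metric_sym oD' hB' (metricE G' xi') X Y D'y).
have hD' X Y Z : h' (tau y) (X + Y) Z = h' (tau y) X Z + h' (tau y) Y Z.
  exact: (metricDl hB' (metricE G' xi') X Y Z D'y).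
have hZ' X Z c : h' (tau y) (c *: X) Z = c * h' (tau y) X Z.
  exact: (metricZl hB' (metricE G' xi') X Z c D'y).
have leaf X : h y X (e1 y) = 0 ->
    exists p q, dd X tau y = p *: e2' (tau y) + q *: e3' (tau y).
  move=> X0; exists (h' (tau y) (dd X tau y) (e2' (tau y))).
  exists (h' (tau y) (dd X tau y) (e3' (tau y))).
  have := h'_e1 X Dy; rewrite X0; move: (dd X tau y) => v v0.
  by rewrite {1}(x' v) -/h' v0 scale0r add0r.
split; last by apply: leaf; rewrite hs.
  have := h'_tau (e1 y) (e1 y) Dy; have := h'_e1 (e1 y) Dy; rewrite h11.
  move: (dd (e1 y) tau y) => v v1.
  rewrite {1}(x' v) -/h' !hD' !hZ' ![h' _ _ v]hs' v1 => E.
  have : h' (tau y) v (e2' (tau y)) ^+ 2 + h' (tau y) v (e3' (tau y)) ^+ 2 = 0.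
    by rewrite !expr2; lra.
  move/eqP; rewrite paddr_eq0 ?sqr_ge0 // !sqrf_eq0 => /andP[/eqP z2 /eqP z3].
  by rewrite (x' v) -/h' v1 z2 z3 !scale0r !addr0 scale1r.
by apply: leaf; rewrite hs.
Qed.

Variables (Q : 'M[R]_4) (b : 'rV[R]_4).

(** E2 and E3 occur in the conditions only through a linear equation, which passes to every
    combination of them. *)
Lemma cone_position_transition y : D y ->
  cone_position (fun y => G' y *m Q + b)
    (fun y => (xi' y - (eta' y + mu1' y) *: dd (e1' y) G' y) *m Q)
    (fun y => dd (e1' y) G' y *m Q) (fun y => dd (e2' y) G' y *m Q)
    (fun y => dd (e3' y) G' y *m Q) sg' `|\det Q| (tau y) ->
  cone_position (fun y => G y *m Q + b)
    (fun y => (xi y - (eta y + mu1 y) *: dd (e1 y) G y) *m Q)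
    (fun y => dd (e1 y) G y *m Q) (fun y => dd (e2 y) G y *m Q)
    (fun y => dd (e3 y) G y *m Q) sg `|\det Q| y.
Proof.
move=> Dy; have D'y := tD Dy; have [t1 [p2 [q2 t2]] [p3 [q3 t3]]] :=
  frame_transition Dy.
have sG' : smooth_on D' G' by case: hB'.
have T X := dd_transition oD hB' st tD GE X Dy.
rewrite /cone_position !T t1 t2 t3 GE // xiE // mu1E // etaE //.
have -> : sg y = sg' (tau y) by rewrite /sg etaE // mu1E.
move=> [z g [u2 u3] v]; split=> //.
rewrite !(dd_dirD _ _ sG' D'y) !(dd_dirZ _ _ sG' D'y).
move: u2 u3; move: (dd (e2' _) G' _) (dd (e3' _) G' _) => x2 x3 u2 u3.
have lin p q : ((p *: x2 + q *: x3) *m Q) 0 3 = 0.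
  rewrite mulmxDl -!scalemxAl; move: u2 u3; move: (x2 *m Q) (x3 *m Q) => w2 w3.
  by rewrite !mxE => -> ->; rewrite !mulr0 addr0.
by split; exact: lin.
Qed.

End FrameTransition.

(** * Global affine coordinates *)

(** The local hypothesis is symmetric in q and q', so the set where P holds and its complement are
    both open. *)
Lemma connected_propagation (T : topologicalType) (P : T -> Prop) (p0 : T) :
  connected [set: T] ->
  (forall p, exists O : set T, [/\ open O, O p &
     forall q q', O q -> O q' -> P q -> P q']) ->
  P p0 -> forall p, P p.
Proof.
move=> cT loc P0 p; suff -> : P p = [set: T] p by [].
have oP : open [set q | P q].
  rewrite openE => q Pq; have [B [oB Bq H]] := loc q.
  by apply: filterS (open_nbhs_nbhs (conj oB Bq)) => q' Bq'; exact: H Pq.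
have oN : open (~` [set q | P q]).
  rewrite openE => q Pq; have [B [oB Bq H]] := loc q.
  by apply: filterS (open_nbhs_nbhs (conj oB Bq)) => q' Bq' Pq'; apply: Pq;
    exact: H Pq'.
rewrite -(cT [set q | P q]) //; first by exists p0.
  by exists [set q | P q] => //; rewrite setTI.
by exists [set q | P q]; [rewrite -openC|rewrite setTI].
Qed.

Lemma open_preimage_in (T U : topologicalType) (S : set T) (f : T -> U)
    (B : set U) : open S -> (forall x, S x -> {for x, continuous f}) ->
  open B -> open (S `&` f @^-1` B).
Proof.
move=> oS cf oB; rewrite openE => x [Sx Bx].
apply: filterI; first exact: open_nbhs_nbhs.
by apply: (cf x Sx); exact: open_nbhs_nbhs.
Qed.

Section FrameSymmetry.
Variables (R : realType) (D : set 'rV[R]_3) (G xi : 'rV[R]_3 -> 'rV[R]_4)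
  (e1 e2 e3 : 'rV[R]_3 -> 'rV[R]_3) (lambda a mu1 mu2 eta : 'rV[R]_3 -> R).
Hypotheses (oD : open D) (hB : blaschke_hypersurface D G xi)
  (hA : forall y, D y -> adapted_frame G xi e1 e2 e3 (lambda y) (a y) (mu1 y)
     (mu2 y) (eta y) y).

Let tensors x : D x ->
  [/\ forall X Y, affine_metric G xi x X Y = affine_metric G xi x Y X,
      forall b c X Y Z, affine_metric G xi x (b *: X + c *: Y) Z =
        b * affine_metric G xi x X Z + c * affine_metric G xi x Y Z,
      forall b c X Y, shape_operator G xi x (b *: X + c *: Y) =
        b *: shape_operator G xi x X + c *: shape_operator G xi x Y,
      forall X Y, difference_tensor G xi x X Y = difference_tensor G xi x Y X
    & forall b c X Y Z, difference_tensor G xi x (b *: X + c *: Y) Z =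
        b *: difference_tensor G xi x X Z + c *: difference_tensor G xi x Y Z].
Proof.
move=> Dx; have sxi : smooth_on D xi by case: hB.
split.
- move=> X Y; rewrite !metricE.
  exact: (metric_sym oD hB (metricE G xi) X Y Dx).
- move=> b c X Y Z; rewrite !metricE.
  exact: (metric_linl hB (metricE G xi) X Y Z b c Dx).
- have SE X : shape_operator G xi x X = - tangential_part G xi x (dd X xi x).
    by rewrite ddE.
  move=> b c X Y; rewrite !SE.
  rewrite (dd_dirD _ _ sxi Dx) !(dd_dirZ _ _ sxi Dx) tangential_part_lin.
  by rewrite opprD -!scalerN.
- exact: (fun X Y => difference_tensor_sym oD hB (metricE G xi)
    (fun _ _ _ => erefl) (fun _ _ _ => erefl) X Y Dx).
- exact: (fun b c X Y Z => difference_tensor_linl oD hB (metricE G xi)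
    (fun _ _ _ => erefl) (fun _ _ _ => erefl) b c X Y Z Dx).
Qed.

Let expand x X : D x -> X = affine_metric G xi x X (e1 x) *: e1 x +
  affine_metric G xi x X (e2 x) *: e2 x + affine_metric G xi x X (e3 x) *: e3 x.
Proof.
move=> Dx; rewrite !metricE.
exact: (orthonormal_expand oD hB hA (metricE G xi) X Dx).
Qed.

Lemma abelian_symmetry_mu1_neq0 x : D x ->
  (forall g k, symmetry_group G xi x g -> symmetry_group G xi x k ->
     g *m k = k *m g) -> mu1 x != 0.
Proof.
move=> Dx; have [hs hl Sl Ks Kl] := tensors Dx; case: (hA Dx) => hE K1 K2 SE _.
exact: (symmetry_mu1_neq0 hs hl Sl Ks Kl hE K1 K2 SE (fun X => expand X Dx)).
Qed.

(** The isomorphism carries - 1 to a nontrivial involution commuting with the whole group; that it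
    carries 1 to 1 is derived from multiplicativity. *)
Lemma SO2_symmetry_mu2_eq0 x : D x ->
  isomorphic_to_SO2 (symmetry_group G xi x) -> mu2 x = 0.
Proof.
move=> Dx [phi [phiH phi_inj phi_surj] phiM].
have ab g k : symmetry_group G xi x g -> symmetry_group G xi x k ->
    g *m k = k *m g.
  move=> /phi_surj [u Su <-] /phi_surj [v Sv <-].
  by rewrite -!phiM // SO2_commutative.
have SO1 : SO2 (1%:M : 'M[R]_2) by split; rewrite ?trmx1 ?mulmx1 ?det1.
have SON : SO2 (- 1%:M : 'M[R]_2).
  split; first by rewrite linearN /= trmx1 mulNmx mulmxN mulmx1 opprK.
  by rewrite -scaleN1r detZ det1 mulr1 sqrrN expr1n.
have H1 := phiH _ SO1; have HN := phiH _ SON.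
have [[hs hl Sl Ks Kl] [hE K1 K2 SE _]] := (tensors Dx, hA Dx).
have Hsym : symmetry_group G xi x 1%:M.
  split; first by rewrite det1 ltr01.
  - by move=> X Y; rewrite !mulmx1.
  - by move=> X; rewrite !mulmx1.
  - by move=> X Y; rewrite !mulmx1.
have [u Su uE] := phi_surj _ Hsym.
have phi1 : phi 1%:M = 1%:M.
  have := phiM u 1%:M Su SO1; rewrite mulmx1 uE mul1mx.
  by move=> {1}->.
apply: (symmetry_mu2_eq0 hs hl Sl Ks Kl hE K1 K2 SE (fun X => expand X Dx)
  (k := phi (- 1%:M))) => //.
- by move=> g Hg; exact: ab.
- exact: abelian_symmetry_mu1_neq0 Dx ab.
- by rewrite -phiM // mulNmx mulmxN mulmx1 opprK phi1.
- rewrite -phi1 => /phi_inj; rewrite !inE => /(_ SON SO1).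
  move/(congr1 (fun B : 'M[R]_2 => B 0 0)); rewrite !mxE /= => /eqP.
  by rewrite eq_sym -subr_eq0 opprK -mulr2n mulrn_eq0 oner_eq0.
Qed.

Hypotheses (se1 : smooth_on D e1) (se2 : smooth_on D e2) (se3 : smooth_on D e3)
  (ha : forall y, D y -> a y = - eta y ^+ 2 + mu1 y ^+ 2)
  (hmu1 : forall y, D y -> mu1 y != 0).

Let sg y := eta y - mu1 y.

(** Gronwall's inequality for sg^2, used contrapositively: a zero of [sg] in the ball would force
    [sg] to vanish on the whole ball. *)
Lemma sg_neq0_ball x : D x ->
  exists2 r : R, 0 < r & ball x r `<=` D /\
    forall y y', ball x r y -> ball x r y' -> sg y != 0 -> sg y' != 0.
Proof.
move=> Dx.
have [smu1 _ seta _ _] := smooth_structure oD hB se1 se2 se3 hA (metricE G xi)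
  (fun _ _ _ => erefl) (fun _ _ _ => erefl).
have ssg : smooth_on D sg by exact: smooth_onB.
have sm : smooth_on D (fun y => sg y * sg y) by exact: smooth_onM.
pose D0 := D `&` [set y | sg y != 0].
have oD0 : open D0.
  have o0 : open [set z : R | z != 0] by exact: open_neq.
  exact: (open_preimage_in oD (fun y Dy => smooth_on_continuous ssg Dy) o0).
have P : adapted_patch D0 G xi e1 e2 e3 lambda a mu1 mu2 eta.
  have sub : D0 `<=` D by move=> y [].
  split=> //.
  - case: hB => sG sxi B; split; [exact: smooth_on_sub sG|exact: smooth_on_sub
      sxi|].
    by move=> y [Dy _]; exact: B.
  - by split; [exact: smooth_on_sub se1|exact: smooth_on_sub se2|exact:
      smooth_on_sub se3].
  - by move=> y [Dy _]; exact: hA.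
  - by move=> y [Dy _]; exact: ha.
  - by move=> y [Dy _]; exact: hmu1.
  - by move=> y [].
(* This column turns X into 8 mu1 h(X, e1); 8 is the 4 of the equation for [sg], doubled by
   squaring. *)
pose Th y : 'M[R]_(3, 1) := (8 * mu1 y) *: (metric_mx G xi y *m (e1 y)^T).
have sTh : smooth_on D Th.
  apply: smooth_onZ => //.
    by apply: smooth_onM => //; exact: smooth_on_cst.
  apply: smooth_on_mulmx => //; first exact: (smooth_on_metric_mx oD hB
    (metricE G xi)).
  apply: smooth_on_mx => // i j.
  by apply: smooth_on_eq (smooth_on_mxE j i oD se1) => // y _; rewrite mxE.
have dm X y : D y -> dd X (fun y => sg y * sg y) y = (X *m Th y) 0 0 * (sg y *
  sg y).
  move=> Dy; rewrite (ddM oD) //.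
  (* The formula for the derivative of [sg] is available only where [sg] is nonzero; at a zero both
     sides vanish because sg^2 is differentiated. *)
  have [sy|sy] := eqVneq (sg y) 0; first by rewrite sy !mulr0 mul0r addr0.
  have D0y : D0 y by [].
  rewrite (adapted_patch_dd_sg X P D0y).
  have -> : metric G xi y X (e1 y) = (X *m (metric_mx G xi y *m (e1 y)^T)) 0 0.
    by rewrite mulmxA; exact: (metric_mxE oD hB (metricE G xi)).
  rewrite /Th -scalemxAr [in RHS]mxE /sg.
  by move: ((X *m _) 0 0) => z; ring.
have [r r0 [rD H]] : exists2 r : R, 0 < r & ball x r `<=` D /\
    forall y y', ball x r y -> ball x r y' -> sg y * sg y <= 0 -> sg y' * sg y'
      <= 0.
  apply: (gronwall_ball oD Dx sm (smooth_on_continuous sTh Dx)).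
    by move=> y _; rewrite -expr2 sqr_ge0.
  move=> y X Dy; rewrite dm // normrM big_ord1.
  by rewrite [X in _ * X]ger0_norm // -expr2 sqr_ge0.
exists r => //; split=> // y y' By By'; apply: contraNN => /eqP s0.
have := H y' y By' By; rewrite s0 mulr0 lexx => /(_ isT).
by rewrite -expr2 => k; rewrite -sqrf_eq0 eq_le k sqr_ge0.
Qed.

End FrameSymmetry.

Lemma adapted_patch_sub (R : realType) (D D' : set 'rV[R]_3)
    (G xi : 'rV[R]_3 -> 'rV[R]_4) (e1 e2 e3 : 'rV[R]_3 -> 'rV[R]_3)
    (lambda a mu1 mu2 eta : 'rV[R]_3 -> R) : open D' -> D' `<=` D ->
  adapted_patch D G xi e1 e2 e3 lambda a mu1 mu2 eta ->
  adapted_patch D' G xi e1 e2 e3 lambda a mu1 mu2 eta.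
Proof.
move=> oD' sub [oD [sG sxi B] [se1 se2 se3] hA ha hmu1 hsg].
split=> //; [|by split; exact: smooth_on_sub sub _|..].
- split; [exact: smooth_on_sub sG|exact: smooth_on_sub sxi|].
  by move=> y /sub; exact: B.
- by move=> y /sub; exact: hA.
- by move=> y /sub; exact: ha.
- by move=> y /sub; exact: hmu1.
- by move=> y /sub; exact: hsg.
Qed.

Section Manifold.
Variables (R : realType) (M : topologicalType) (A : set (chart R M 3))
  (F xi : M -> 'rV[R]_4) (a mu1 eta : M -> R).
Hypotheses (hM : smooth_manifold A) (hconn : connected [set: M])
  (hF : positive_definite_hypersurface A F xi)
  (hsym : SO2_symmetry A F xi \/ Z3_symmetry A F xi)
  (hfun : structure_functions A F xi a mu1 eta)
  (ha : forall p, a p = - eta p ^+ 2 + mu1 p ^+ 2)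
  (ha0 : exists p, a p != 0).

Let chart_at p : exists2 c, A c & cdom c p.
Proof. by case: hM => _ _ [_ + _]; apply. Qed.

Let chartP c : A c -> [/\ open (cdom c), open (cim c),
  forall p, cdom c p -> cparam c (ccoord c p) = p,
  forall p, cdom c p -> {for p, continuous (ccoord c)}
  & forall x, cim c x -> {for x, continuous (cparam c)}].
Proof. by case: hM => _ _ [+ _ _]; apply. Qed.

Let cimP c x : A c -> cim c x -> cdom c (cparam c x) /\ ccoord c (cparam c x) =
  x.
Proof. by move=> /chartP [_ _ cK _ _] [p cp <-]; rewrite cK. Qed.

Let chart_nbhs c p B : A c -> cdom c p -> open B -> B (ccoord c p) ->
  [/\ open (cdom c `&` ccoord c @^-1` B), (cdom c `&` ccoord c @^-1` B) p &
    forall q, (cdom c `&` ccoord c @^-1` B) q -> cdom c q /\ B (ccoord c q)].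
Proof.
move=> /chartP [oc _ _ cc _] cp oB Bp; split=> //.
exact: open_preimage_in.
Qed.

(** Both symmetry types enter the proof that [mu1] is nonzero only through commutativity. *)
Let abelian c x : A c -> cim c x ->
  forall g k, symmetry_group (F \o cparam c) (xi \o cparam c) x g ->
    symmetry_group (F \o cparam c) (xi \o cparam c) x k -> g *m k = k *m g.
Proof.
move=> Ac cx g k; case: hsym => /(_ c Ac x cx) [phi [_ _ surj] phiM].
  move=> /surj [u Su <-] /surj [v Sv <-].
  by rewrite -!phiM // SO2_commutative.
move=> /surj [u Su <-] /surj [v Sv <-].
by rewrite -!phiM addrC.
Qed.

Let blaschke_sub c (V : set 'rV[R]_3) : A c -> V `<=` cim c ->
  blaschke_hypersurface V (F \o cparam c) (xi \o cparam c).
Proof.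
move=> Ac Vc; have [[sF sxi B] _] := hF Ac; split.
- exact: smooth_on_sub sF.
- exact: smooth_on_sub sxi.
- by move=> x /Vc; exact: B.
Qed.

Let mu1_neq0 p : mu1 p != 0.
Proof.
have [c Ac cp] := chart_at p; have [_ _ cK _ _] := chartP Ac.
have cx : cim c (ccoord c p) by exists p.
have [V [e1 [e2 [e3 [lam [mu2 [oV Vx Vc se hA]]]]]]] := hfun Ac cx.
have := @abelian_symmetry_mu1_neq0 _ V _ _ e1 e2 e3 lam (a \o cparam c)
  (mu1 \o cparam c) mu2 (eta \o cparam c) oV (blaschke_sub Ac Vc) hA _ Vx
  (abelian Ac cx).
by rewrite /= cK.
Qed.

Let sg_neq0 p : eta p - mu1 p != 0.
Proof.
have [p0 ap0] := ha0.
have sg0 : eta p0 - mu1 p0 != 0.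
  apply: contraNneq ap0 => /eqP; rewrite subr_eq0 => /eqP E.
  by rewrite ha E addrC subrr.
apply: (@connected_propagation _ (fun q => eta q - mu1 q != 0) p0 hconn _ sg0)
  => q.
have [c Ac cq] := chart_at q; have [_ _ cK _ _] := chartP Ac.
have cx : cim c (ccoord c q) by exists q.
have [V [e1 [e2 [e3 [lam [mu2 [oV Vx Vc [se1 se2 se3] hA]]]]]]] := hfun Ac cx.
have [r r0 [_ H]] := @sg_neq0_ball _ V _ _ e1 e2 e3 lam (a \o cparam c)
  (mu1 \o cparam c) mu2 (eta \o cparam c) oV (blaschke_sub Ac Vc) hA se1 se2 se3
  (fun y _ => ha _) (fun y _ => mu1_neq0 _) _ Vx.
have [oO Oq OP] := chart_nbhs Ac cq (ball_open _ _) (ballxx (ccoord c q) r0).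
exists (cdom c `&` ccoord c @^-1` ball (ccoord c q) r); split=> //.
move=> q1 q2 /OP [c1 B1] /OP [c2 B2].
by have := H _ _ B1 B2; rewrite /= !cK.
Qed.

Definition chart_patch c V e1 e2 e3 lambda mu2 :=
  [/\ A c, V `<=` cim c & adapted_patch V (F \o cparam c) (xi \o cparam c)
    e1 e2 e3 lambda (a \o cparam c) (mu1 \o cparam c) mu2 (eta \o cparam c)].

Lemma chart_patch_exists p : exists c V e1 e2 e3 lambda mu2,
  [/\ chart_patch c V e1 e2 e3 lambda mu2, cdom c p & V (ccoord c p)].
Proof.
have [c Ac cp] := chart_at p; have cx : cim c (ccoord c p) by exists p.
have [V [e1 [e2 [e3 [lam [mu2 [oV Vx Vc se hA]]]]]]] := hfun Ac cx.
exists c, V, e1, e2, e3, lam, mu2; split=> //; split=> //; split=> //.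
- exact: blaschke_sub.
- by move=> y _; exact: ha.
- by move=> y _; exact: mu1_neq0.
- by move=> y _; exact: sg_neq0.
Qed.

Lemma chart_patch_mu2_eq0 c V e1 e2 e3 lambda mu2 y : SO2_symmetry A F xi ->
  chart_patch c V e1 e2 e3 lambda mu2 -> V y -> mu2 y = 0.
Proof.
move=> hS [Ac Vc P] Vy.
exact: (SO2_symmetry_mu2_eq0 (ap_open P) (ap_blaschke P) (ap_frame P) Vy
  (hS c Ac y (Vc y Vy))).
Qed.

Definition chart_position (Q : 'M[R]_4) (b : 'rV[R]_4) (c : chart R M 3)
    (e1 e2 e3 : 'rV[R]_3 -> 'rV[R]_3) :=
  let G := F \o cparam c in
  cone_position (fun y => G y *m Q + b)
    (fun y => ((xi \o cparam c) y - ((eta \o cparam c) y + (mu1 \o cparam c) y)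
      *: dd (e1 y) G y) *m Q)
    (fun y => dd (e1 y) G y *m Q) (fun y => dd (e2 y) G y *m Q)
    (fun y => dd (e3 y) G y *m Q)
    (fun y => (eta \o cparam c) y - (mu1 \o cparam c) y) `|\det Q|.

Lemma chart_position_transition Q b p c V e1 e2 e3 lambda mu2
    c' V' e1' e2' e3' lambda' mu2' :
  chart_patch c V e1 e2 e3 lambda mu2 ->
  chart_patch c' V' e1' e2' e3' lambda' mu2' ->
  cdom c p -> V (ccoord c p) -> cdom c' p -> V' (ccoord c' p) ->
  chart_position Q b c' e1' e2' e3' (ccoord c' p) ->
  chart_position Q b c e1 e2 e3 (ccoord c p).
Proof.
move=> [Ac Vc P] [Ac' Vc' P'] cp Vp cp' Vp'.
pose tau := ccoord c' \o cparam c.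
pose T := cim c `&` cparam c @^-1` cdom c'.
have [oc oi cK _ cp_c] := chartP Ac; have [oc' oi' cK' cc_c' _] := chartP Ac'.
have oT : open T by exact: open_preimage_in.
have st : smooth_on T tau by case: hM => _ _ [_ _]; apply.
have oW : open (T `&` tau @^-1` V').
  exact: (open_preimage_in oT (fun y Ty => smooth_on_continuous st Ty) (ap_open
    P')).
(* The overlap is cut down to the points of [V] that the coordinate change sends into [V'], so that
   it compares two patches. *)
pose W := V `&` (T `&` tau @^-1` V').
have oW' : open W by apply: openI => //; exact: ap_open P.
have PW := adapted_patch_sub oW' (@subIsetl _ _ _) P.
have stW : smooth_on W tau by apply: smooth_on_sub st => y [_ []].
have tW y : W y -> V' (tau y) by move=> [_ []].
have E y : W y -> cparam c' (tau y) = cparam c y.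
  by move=> [_ [[_ /= cy] _]]; rewrite /tau /= cK'.
have tp : tau (ccoord c p) = ccoord c' p by rewrite /tau /= cK.
have Wp : W (ccoord c p).
  split=> //; split; last by rewrite /preimage /= tp.
  by split; [exists p|rewrite /= cK].
rewrite -tp.
apply: (cone_position_transition PW P' stW tW _ _ _ _ Wp) => y Wy /=.
- by rewrite E.
- by rewrite E.
- by rewrite E.
- by rewrite E.
Qed.

(** Asking for some patch is enough: by the transition lemma the condition then holds in every patch
    around [p]. *)
Definition in_position Q b p := exists c V e1 e2 e3 lambda mu2,
  [/\ chart_patch c V e1 e2 e3 lambda mu2, cdom c p, V (ccoord c p)
    & chart_position Q b c e1 e2 e3 (ccoord c p)].

(** Position at q, given in an unknown patch, is moved to a fixed patch around p, propagated there
    over a ball, and read off at q'. *)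
Lemma in_position_local Q b p : exists O : set M, [/\ open O, O p &
  forall q q', O q -> O q' -> in_position Q b q -> in_position Q b q'].
Proof.
have [c [V [e1 [e2 [e3 [lam [mu2 [hP cp Vp]]]]]]]] := chart_patch_exists p.
have [Ac Vc P] := hP.
have [rho [al [be /(cone_frame_affine Q b)]]] := adapted_patch_cone P.
rewrite mul1r => C.
have [r r0 [rV H]] := cone_position_ball C Vp.
have [oO Op OP] := chart_nbhs Ac cp (ball_open _ _) (ballxx (ccoord c p) r0).
exists (cdom c `&` ccoord c @^-1` ball (ccoord c p) r); split=> //.
move=> q q' /OP [cq Bq] /OP [cq' Bq'].
move=> [c' [V' [e1' [e2' [e3' [lam' [mu2' [hP' c'q Vq' pos]]]]]]]].
exists c, V, e1, e2, e3, lam, mu2; split=> //; first exact: rV.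
apply: (H _ _ Bq Bq'); exact: (chart_position_transition hP hP' cq (rV _ Bq)
  c'q Vq' pos).
Qed.

(** Normal position is arranged at one point by linear algebra and then spread by connectedness. *)
Lemma in_position_exists : exists (Q : 'M[R]_4) (b : 'rV[R]_4),
  Q \in unitmx /\ forall p, in_position Q b p.
Proof.
have [p0 _] := ha0.
have [c [V [e1 [e2 [e3 [lam [mu2 [hP cp Vp]]]]]]]] := chart_patch_exists p0.
have [Ac Vc P] := hP; have [rho [al [be C]]] := adapted_patch_cone P.
have sg0 := cf_sg_neq0 C Vp; have := cf_vol C Vp.
set x := ccoord c p0 in Vp sg0 *; set sg := _ - _ in sg0.
set W := rows4 _ _ _ _ => detW.
have uW : W \in unitmx by rewrite unitmxE unitfE -normr_eq0 detW oner_eq0.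
(* The rows E2, E3, Z, E1 go to multiples of the standard basis. The factor 1 / sg in the first
   makes |det Q| agree with the required value of Z_2^2 G_3^2 sg at the base point, where Z_2 = 1
   and G_3 = 1 / sg. *)
pose dv : 'rV[R]_4 := \row_j [:: sg^-1; 1; 1; 1]`_j.
pose Q := invmx W *m diag_mx dv.
have detQ : `|\det Q| = `|sg^-1|.
  rewrite /Q det_mulmx det_inv normrM normfV detW invr1 mul1r det_diag.
  by rewrite !big_ord_recl big_ord0 !mxE /= !mulr1.
(* The translation puts the transformed point at E1 / sg. *)
pose b := sg^-1 *: (dd (e1 x) (F \o cparam c) x *m Q) - (F (cparam c x)) *m Q.
exists Q, b; split.
  by rewrite unitmxE unitfE -normr_eq0 detQ normr_eq0 invr_eq0.
apply: (connected_propagation hconn (in_position_local Q b) (p0 := p0)).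
exists c, V, e1, e2, e3, lam, mu2; split=> //; rewrite -/x.
have WQ : W *m Q = diag_mx dv by rewrite /Q mulmxA mulmxV // mul1mx.
have row_WQ i j : (row i W *m Q) 0 j = [:: sg^-1; 1; 1; 1]`_i *+ (i == j).
  by rewrite -row_mul WQ [LHS]mxE [LHS]mxE mxE.
have r0 := row_WQ 0; have r1 := row_WQ 1; have r2 := row_WQ 2;
  have r3 := row_WQ 3.
rewrite !rowK /= in r0 r1 r2 r3.
rewrite /chart_position /cone_position -/sg; split.
- by rewrite !r2 /=.
- have E j : ((F \o cparam c) x *m Q + b) 0 j = (dd (e1 x) (F \o cparam c) x *m
    Q) 0 j / sg.
    rewrite /b addrC subrK mxE mulrC; congr (_ / _).
  by rewrite !E.
- by rewrite r0 r1.
- have -> : ((F \o cparam c) x *m Q + b) 0 3 = sg^-1.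
    by rewrite /b addrC subrK mxE r3 /= mulr1.
  by rewrite r2 /= expr1n mul1r expr2 -mulrA mulVf // mulr1 detQ.
Qed.

End Manifold.

(** * The local parametrization *)

Definition pack3 (R : realType) (t : R) (w : 'rV[R]_2) : 'rV[R]_3 :=
  \row_j [:: t; w 0 0; w 0 1]`_j.

Definition tail2 (R : realType) (z : 'rV[R]_3) : 'rV[R]_2 :=
  \row_j [:: z 0 1; z 0 2]`_j.

Lemma pack3K (R : realType) (t : R) w : (pack3 t w) 0 0 = t /\ tail2 (pack3 t
  w) = w.
Proof.
split; first by rewrite mxE.
by apply/rowP => -[[|[|//]] ?]; rewrite !mxE /=; congr (w _ _); apply: val_inj.
Qed.

Lemma tail2K (R : realType) (z : 'rV[R]_3) : pack3 (z 0 0) (tail2 z) = z.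
Proof.
apply/rowP => -[[|[|[|//]]] ?]; rewrite !mxE /=;
  by congr (z _ _); apply: val_inj.
Qed.

Lemma row2_sum (R : realType) (u v X : 'rV[R]_2) :
  u 0 0 * v 0 1 - u 0 1 * v 0 0 != 0 -> exists p q, X = p *: u + q *: v.
Proof.
set d := _ - _ => d0.
exists ((X 0 0 * v 0 1 - X 0 1 * v 0 0) / d), ((u 0 0 * X 0 1 - u 0 1 * X 0 0)
  / d).
have o2 (A B : 'rV[R]_2) : A 0 0 = B 0 0 -> A 0 1 = B 0 1 -> A = B.
  move=> h0 h1; apply/rowP => -[[|[|//]] i].
    by rewrite (_ : Ordinal i = 0) //; apply: val_inj.
  by rewrite (_ : Ordinal i = 1) //; apply: val_inj.
by apply: o2; rewrite !mxE; move: d0; rewrite /d => d0; field.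
Qed.

Lemma cone_frame_sub (R : realType) (D D' : set 'rV[R]_3)
    (G Z E1 E2 E3 : 'rV[R]_3 -> 'rV[R]_4) (e1 e2 e3 : 'rV[R]_3 -> 'rV[R]_3)
    (sg tu mu1 mu2 rho al be : 'rV[R]_3 -> R) (vol : R) :
  open D' -> D' `<=` D ->
  cone_frame D G Z E1 E2 E3 e1 e2 e3 sg tu mu1 mu2 rho al be vol ->
  cone_frame D' G Z E1 E2 E3 e1 e2 e3 sg tu mu1 mu2 rho al be vol.
Proof.
move=> oD' sub [oD [sG sZ [sE1 sE2 sE3]] [f1 f2 f3 f4] sg0 tuE fr
  vl dE d1 d2 d3 dZ dsg].
have S (W : normedModType R) (f : 'rV[R]_3 -> W) : smooth_on D f -> smooth_on
  D' f.
  exact: smooth_on_sub.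
split=> //; try by move=> y /sub; auto.
- by split; [exact: S|exact: S|split; exact: S].
- by split; exact: S.
- by have [B sB H] := fr; exists B => [|y X /sub]; [exact: S|exact: H].
Qed.

Lemma second_dd_bilin (R : realType) (V : normedModType R) (N : set V)
    (f : V -> R) (w u u' v v' : V) (p p' q q' : R) :
  open N -> smooth_on N f -> N w ->
  dd (p *: u + p' *: u') (dd (q *: v + q' *: v') f) w =
  p * q * dd u (dd v f) w + p * q' * dd u (dd v' f) w +
  p' * q * dd u' (dd v f) w + p' * q' * dd u' (dd v' f) w.
Proof.
move=> oN sf Nw; have sv := smooth_dd v sf; have sv' := smooth_dd v' sf.
have sq : smooth_on N (fun=> q : R) by exact: smooth_on_cst.
have sq' : smooth_on N (fun=> q' : R) by exact: smooth_on_cst.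
have E X : dd X (dd (q *: v + q' *: v') f) w = q * dd X (dd v f) w + q' * dd X
  (dd v' f) w.
  rewrite (dd_eq oN (g := fun w => q * dd v f w + q' * dd v' f w)) //;
    last first.
    by move=> z Nz; rewrite (dd_dirD _ _ sf Nz) !(dd_dirZ _ _ sf Nz).
  have s1 := smooth_onM oN sq sv; have s2 := smooth_onM oN sq' sv'.
  by rewrite (ddD oN _ s1 s2 Nw) !(ddM oN) // !dd_cst !mul0r !add0r.
have sE := smooth_dd (q *: v + q' *: v') sf.
rewrite (dd_dirD _ _ sE Nw) !(dd_dirZ _ _ sE Nw) !E /GRing.scale /=; ring.
Qed.

(** * Graphs with Hessian determinant one *)

Section GraphSurface.
Variables (R : realType) (N : set 'rV[R]_2) (f : 'rV[R]_2 -> R).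
Hypotheses (oN : open N) (sf : smooth_on N f).

Let nu : 'rV[R]_3 := \row_j [:: 0; 0; 1]`_j.
Let d0 : 'rV[R]_2 := delta_mx 0 0.
Let d1 : 'rV[R]_2 := delta_mx 0 1.

Let row2E (w : 'rV[R]_2) : w = w 0 0 *: d0 + w 0 1 *: d1.
Proof.
apply/rowP => -[[|[|//]] i]; rewrite !mxE /=;
  rewrite ?mulr0 ?mulr1 ?addr0 ?add0r;
  by congr (w _ _); apply: val_inj.
Qed.

Let sid : smooth_on N (id : 'rV[R]_2 -> 'rV[R]_2). Proof. exact: smooth_on_id.
  Qed.

Lemma smooth_graph_surface : smooth_on N (graph_surface f).
Proof.
apply: smooth_on_mx => // i j.
apply: (@smooth_on_eq _ _ _ _ (fun w : 'rV[R]_2 => [:: w 0 0; w 0 1;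
  f w]`_j)) => //.
  by move=> y _; rewrite /graph_surface [RHS]mxE.
case: j => [[|[|[|//]]] ?] //=.
  exact: (smooth_on_mxE 0 0 oN sid).
exact: (smooth_on_mxE 0 1 oN sid).
Qed.

Lemma dd_graph_surface v w : N w ->
  dd v (graph_surface f) w = \row_j [:: v 0 0; v 0 1; dd v f w]`_j.
Proof.
move=> Nw; have sg := smooth_graph_surface.
apply/rowP => j; rewrite -(dd_mxE oN) // [RHS]mxE.
rewrite (dd_eq oN (g := fun w : 'rV[R]_2 => [:: w 0 0; w 0 1; f w]`_j)) //;
  last first.
  by move=> y _; rewrite /graph_surface [LHS]mxE.
case: j => [[|[|[|//]]] ?] //=.
  by rewrite (dd_mxE oN _ _ _ sid Nw) ddE derive_id.
by rewrite (dd_mxE oN _ _ _ sid Nw) ddE derive_id.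
Qed.

Let dd2_graph u v w : N w ->
  dd u (dd v (graph_surface f)) w = dd u (dd v f) w *: nu.
Proof.
move=> Nw; have sv := smooth_dd v sf.
have sv' := smooth_dd v smooth_graph_surface.
apply/rowP => j; rewrite -(dd_mxE oN) // [RHS]mxE.
rewrite (dd_eq oN (g := fun w : 'rV[R]_2 => [:: v 0 0; v 0 1;
  dd v f w]`_j)) //; last first.
  by move=> y Ny; rewrite dd_graph_surface // [LHS]mxE.
by rewrite mxE; case: j => [[|[|[|//]]] ?] /=; rewrite ?dd_cst ?mulr0 ?mulr1.
Qed.

Lemma det_graph_frame (X : 'I_2 -> 'rV[R]_2) (g : 'I_2 -> R) :
  \det (col_mx (nu : 'M[R]_(1, 1 + 2))
    (\matrix_(i < 2) (\row_(j < 3) [:: X i 0 0; X i 0 1;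
      g i]`_j : 'rV[R]_(1 + 2)))) =
  X 0 0 0 * X 1 0 1 - X 0 0 1 * X 1 0 0.
Proof.
pose o1 : 'I_2 := 1.
pose A i j : R := nth 0 (nth [::] [:: [:: 0; 0; 1];
  [:: X 0 0 0; X 0 0 1; g 0]; [:: X o1 0 0; X o1 0 1; g o1]] i) j.
have -> : col_mx (nu : 'M[R]_(1, 1 + 2))
    (\matrix_(i < 2) (\row_(j < 3) [:: X i 0 0; X i 0 1;
      g i]`_j : 'rV[R]_(1 + 2)))
    = \matrix_(i < 3, j < 3) A i j.
  apply/matrixP => i j; rewrite [RHS]mxE.
  rewrite -[i]splitK; case: (fintype.split i) => k /=.
    by rewrite col_mxEu !mxE; case: k => [[]].
  rewrite col_mxEd !mxE /A; case: k => [[|[|//]] ik] /=.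
    have -> : Ordinal ik = 0 by apply: val_inj.
    by [].
  have -> : Ordinal ik = o1 by apply: val_inj.
  by [].
rewrite (det_expand_nat 2 A) !big_ord_recl big_ord0 /= /A /= !mul0r !add0r
  !addr0.
rewrite (det_expand_nat 1 (fun i j => A i.+1 (bump 2 j))).
rewrite !big_ord_recl big_ord0 !det_mx11 !mxE /= /A /bump /=.
by rewrite !exprS !expr0; ring.
Qed.

(** Second derivatives of the graph are vertical, so the affine metric is the Hessian of [f]; the
    Blaschke volume condition is then the Monge-Ampere equation with right side 1. *)
Lemma graph_improper_affine_sphere :
  (forall w, N w -> dd d0 (dd d0 f) w * dd d1 (dd d1 f) w -
     dd d0 (dd d1 f) w * dd d1 (dd d0 f) w = 1) ->
  improper_affine_sphere N (graph_surface f) nu.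
Proof.
move=> hess; have sg := smooth_graph_surface.
split=> //; first exact: smooth_on_cst.
move=> w Nw; have hw := hess w Nw.
have detF (X : 'I_2 -> 'rV[R]_2) : \det (col_mx (nu : 'M[R]_(1, 1 + 2))
    (\matrix_(i < 2) (dd (X i) (graph_surface f) w : 'rV[R]_(1 + 2)))) =
    X 0 0 0 * X 1 0 1 - X 0 0 1 * X 1 0 0.
  rewrite -(det_graph_frame X (fun i => dd (X i) f w));
    congr (\det (col_mx _ _)).
  by apply/row_matrixP => i; rewrite !rowK dd_graph_surface.
have uM : moving_frame (graph_surface f) (cst nu) w \in unitmx.
  have -> : moving_frame (graph_surface f) (cst nu) w = col_mx (nu : 'M[R]_(1,
    1 + 2))
      (\matrix_(i < 2) (dd (delta_mx 0 i) (graph_surface f) w : 'rV[R]_(1 +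
        2))).
    rewrite /moving_frame; congr col_mx; apply/row_matrixP => i.
    by rewrite rowK (dd_jacobian _ sg Nw) rowE.
  rewrite unitmxE detF !mxE /= mulr1 mul0r subr0.
  by rewrite unitr1.
have tv c : transversal_part (graph_surface f) (cst nu) w (c *: nu) = c.
  rewrite /transversal_part /frame_coords.
  have -> : (c *: nu : 'rV[R]_(1 + 2)) = row_mx (c%:M : 'M[R]_1) (0 : 'rV[R]_2)
    *m
      moving_frame (graph_surface f) (cst nu) w.
    by rewrite /moving_frame mul_row_col mul0mx addr0 mul_scalar_mx.
  by rewrite mulmxK // row_mxKl mxE eqxx mulr1n.
have hE X Y : affine_metric (graph_surface f) (cst nu) w X Y = dd X (dd Y f) w.
  by rewrite -[RHS]tv -dd2_graph // /affine_metric !ddE.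
have det2 (B : 'M[R]_2) : \det B = B 0 0 * B 1 1 - B 0 1 * B 1 0.
  rewrite (expand_det_row _ 0) !big_ord_recl big_ord0 /cofactor !det_mx11 !mxE
    /=.
  have -> : lift (0 : 'I_2) 0 = 1 by apply: val_inj.
  have -> : lift (1 : 'I_2) 0 = 0 by apply: val_inj.
  by rewrite /= expr0 expr1; ring.
have hX (X Y : 'rV[R]_2) : affine_metric (graph_surface f) (cst nu) w X Y =
    X 0 0 * Y 0 0 * dd d0 (dd d0 f) w + X 0 0 * Y 0 1 * dd d0 (dd d1 f) w +
    X 0 1 * Y 0 0 * dd d1 (dd d0 f) w + X 0 1 * Y 0 1 * dd d1 (dd d1 f) w.
  by rewrite hE {1}(row2E X) {1}(row2E Y) (second_dd_bilin _ _ _ _ _ _ _ _ oN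
    sf Nw).
split=> //.
- by rewrite unitmxE det2 !mxE !hE -/d0 -/d1 hw unitr1.
- move=> X; have := tv 0; rewrite scale0r => <-; congr transversal_part.
  by rewrite -[RHS](dd_cst nu w X) ddE.
move=> X; have -> : \matrix_(i < 2) ('D_(X i) (graph_surface f) w : 'rV[R]_(1 +
  2)) =
    \matrix_(i < 2) (dd (X i) (graph_surface f) w : 'rV[R]_(1 + 2)).
  by apply/row_matrixP => i; rewrite !rowK ddE.
rewrite detF det2 !mxE !hX.
set D := X 0 0 0 * _ - _.
rewrite (_ : _ - _ = D ^+ 2); first by rewrite normrX sqrtr_sqr normr_id.
by rewrite -[RHS]mulr1 -hw /D; ring.
Qed.

End GraphSurface.

(** * Cone coordinates on a frame in normal position *)

Section ConeChart.
Variables (R : realType) (D : set 'rV[R]_3)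
    (G Z E1 E2 E3 : 'rV[R]_3 -> 'rV[R]_4) (e1 e2 e3 : 'rV[R]_3 -> 'rV[R]_3)
    (sg tu mu1 mu2 rho al be : 'rV[R]_3 -> R) (vol : R).
Hypothesis C : cone_frame D G Z E1 E2 E3 e1 e2 e3 sg tu mu1 mu2 rho al be vol.
Hypothesis vol0 : vol != 0.
Hypothesis P : forall y, D y -> cone_position G Z E1 E2 E3 sg vol y.

Let oD : open D. Proof. exact: cf_open C. Qed.
Let sG : smooth_on D G. Proof. by case: (cf_smooth C). Qed.
Let sZ : smooth_on D Z. Proof. by case: (cf_smooth C). Qed.
Let sE1 : smooth_on D E1. Proof. by case: (cf_smooth C) => _ _ []. Qed.
Let sE2 : smooth_on D E2. Proof. by case: (cf_smooth C) => _ _ []. Qed.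
Let sE3 : smooth_on D E3. Proof. by case: (cf_smooth C) => _ _ []. Qed.
Let ssg : smooth_on D sg. Proof. by case: (cf_smooth_fun C). Qed.
Let sE (f : 'rV[R]_3 -> 'rV[R]_4) j : smooth_on D f ->
  smooth_on D (fun y => f y 0 j : R).
Proof. exact: smooth_on_mxE. Qed.
Let dj (f : 'rV[R]_3 -> 'rV[R]_4) j X y : smooth_on D f -> D y ->
  dd X (fun y => f y 0 j : R) y = dd X f y 0 j.
Proof. by move=> sf Dy; rewrite (dd_mxE oD). Qed.

Let t y : R := G y 0 3.
Let s y : R := Z y 0 2.
(** Applied to [G] this gives the coordinates u, v; applied to E2 and E3 it gives their derivatives
    along [e2] and [e3], since [t] is constant in these directions. *)
Let J (E : 'rV[R]_3 -> 'rV[R]_4) y : 'rV[R]_2 :=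
  \row_j [:: E y 0 0 / t y; E y 0 1 / t y]`_j.
Definition cone_coord y := pack3 (G y 0 3) (J G y).
Let T := cone_coord.

Let st : smooth_on D t. Proof. exact: sE. Qed.
Let s_neq0 y : D y -> [/\ s y != 0, t y != 0 & sg y != 0].
Proof.
move=> Dy; have [_ _ _ v] := P Dy; have sg0 := cf_sg_neq0 C Dy.
split=> //; apply: contraNneq vol0; rewrite -v /s /t => ->.
  by rewrite expr0n /= !mul0r normr0.
by rewrite expr0n /= mulr0 mul0r normr0.
Qed.
Let stV : smooth_on D (fun y => (t y)^-1).
Proof. by apply: smooth_onV => // y /s_neq0 []. Qed.

Let sJ E : smooth_on D E -> smooth_on D (J E).
Proof.
move=> sE'; apply: smooth_on_mx => // i j.
have q k : smooth_on D (fun y => E y 0 k / t y).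
  by apply: smooth_onM => //; exact: sE.
apply: (@smooth_on_eq _ _ _ _ (fun y => [:: E y 0 0 / t y;
  E y 0 1 / t y]`_j)) => //.
  by move=> y _; rewrite mxE.
by case: j => [[|[|//]] ?] /=.
Qed.

Let sT : smooth_on D T.
Proof.
apply: smooth_on_mx => // i j.
apply: (@smooth_on_eq _ _ _ _ (fun y => [:: G y 0 3; J G y 0 0;
  J G y 0 1]`_j)) => //.
  by move=> y _; rewrite /T /cone_coord /pack3 [RHS]mxE.
have sJG := sJ sG.
case: j => [[|[|[|//]]] ?] /=; first exact: sE.
  exact: smooth_on_mxE.
exact: smooth_on_mxE.
Qed.

Let E13 y : D y -> E1 y 0 3 = sg y * t y.
Proof.
move=> Dy; have [_ [_ _ g] _ _] := P Dy; have [_ _ sg0] := s_neq0 Dy.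
by rewrite /t g mulrC divfK.
Qed.

Let dt y : D y -> [/\ dd (e1 y) t y = sg y * t y, dd (e2 y) t y = 0
  & dd (e3 y) t y = 0].
Proof.
move=> Dy; have [q1 q2 q3] := cf_E C Dy; have [_ _ [u2 u3] _] := P Dy.
by rewrite !dj // q1 q2 q3 E13.
Qed.

Let dJ E X y : smooth_on D E -> D y -> dd X (J E) y =
  \row_j [:: dd X E y 0 0 / t y - E y 0 0 * dd X t y / t y ^+ 2;
             dd X E y 0 1 / t y - E y 0 1 * dd X t y / t y ^+ 2]`_j.
Proof.
move=> sE' Dy; have [_ t0 _] := s_neq0 Dy.
have q k : dd X (fun y => E y 0 k / t y) y =
    dd X E y 0 k / t y - E y 0 k * dd X t y / t y ^+ 2.
  rewrite (ddM oD) ?(ddV oD) ?dj //; last exact: sE.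
  by field.
apply/rowP => j; rewrite -(dd_mxE oD) //; last exact: sJ.
rewrite (dd_eq oD (g := fun y => [:: E y 0 0 / t y; E y 0 1 / t y]`_j)) //;
  last first.
  by move=> z _; rewrite mxE.
by rewrite [RHS]mxE; case: j => [[|[|//]] ?] /=; rewrite q.
Qed.

Let dJ_leaf E X y : smooth_on D E -> D y -> dd X t y = 0 ->
  dd X (J E) y = \row_j [:: dd X E y 0 0 / t y; dd X E y 0 1 / t y]`_j.
Proof. by move=> sE' Dy d; rewrite dJ // d !mulr0 !mul0r !subr0. Qed.

Let dTE X y : D y -> dd X T y = pack3 (dd X t y) (dd X (J G) y).
Proof.
move=> Dy; have sJG := sJ sG.
apply/rowP => j; rewrite -(dd_mxE oD) // /pack3 [RHS]mxE.
rewrite (dd_eq oD (g := fun y => [:: G y 0 3; J G y 0 0; J G y 0 1]`_j)) //;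
  last first.
  by move=> z _; rewrite /T /cone_coord /pack3 [LHS]mxE.
by case: j => [[|[|[|//]]] ?] //=; rewrite (dd_mxE oD).
Qed.

(** Along [e1] the first two components of [G] and [t] itself grow at the same rate [sg], so the
    quotients u, v stay fixed. *)
Let dT y : D y -> [/\ dd (e1 y) T y = pack3 (sg y * t y) 0,
  dd (e2 y) T y = pack3 0 (J E2 y) & dd (e3 y) T y = pack3 0 (J E3 y)].
Proof.
move=> Dy; rewrite !dTE //; have [t1 t2 t3] := dt Dy.
have [q1 q2 q3] := cf_E C Dy; have [_ t0 sg0] := s_neq0 Dy.
rewrite (dJ_leaf sG Dy t2) (dJ_leaf sG Dy t3) t1 t2 t3 q2 q3 dJ // q1 t1;
  split=> //.
congr pack3; have [_ [g0 g1 _] _ _] := P Dy.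
by apply/rowP => -[[|[|//]] ?]; rewrite !mxE /= ?g0 ?g1; field; rewrite t0.
Qed.

Let det_J y := J E2 y 0 0 * J E3 y 0 1 - J E2 y 0 1 * J E3 y 0 0.

(** The zeros of normal position reduce the frame determinant to det_J t^2 times s times sg t, up to
    sign; comparison with the normalized volume s^2 t^2 sg leaves s / t. *)
Let det_J_sq y : D y -> det_J y ^+ 2 = (s y / t y) ^+ 2.
Proof.
move=> Dy; have [s0 t0 sg0] := s_neq0 Dy; have e13 := E13 Dy.
have := cf_vol C Dy; have [[z0 z1 z3] _ [u2 u3] <-] := P Dy.
rewrite det_rows4 /= !big_ord_recl !big_ord0 /= /bump /=.
have i0 : inord 0 = 0 :> 'I_4 by apply: val_inj; rewrite /= inordK.
have i1 : inord 1 = 1 :> 'I_4 by apply: val_inj; rewrite /= inordK.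
have i2 : inord 2 = 2 :> 'I_4 by apply: val_inj; rewrite /= inordK.
have i3 : inord 3 = 3 :> 'I_4 by apply: val_inj; rewrite /= inordK.
rewrite !(i0, i1, i2, i3) u2 u3 z0 z1 z3 e13 -/(s y) -/(t y).
move/(congr1 (fun z : R => z ^+ 2)); rewrite !real_normK ?num_real // => E.
rewrite /det_J !mxE /=.
have c0 : (s y * t y ^+ 3 * sg y) ^+ 2 != 0 by rewrite !(expf_neq0, mulf_neq0).
apply: (mulfI c0).
transitivity ((s y ^+ 2 * t y ^+ 2 * sg y) ^+ 2); last by field.
rewrite -E; field.
by [].
Qed.

Let det_J_neq0 y : D y -> det_J y != 0.
Proof.
move=> Dy; rewrite -sqrf_eq0 det_J_sq // sqrf_eq0.
by have [s0 t0 _] := s_neq0 Dy; rewrite mulf_neq0 ?invr_eq0.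
Qed.

Let jacobian_T y : D y -> jacobian T y \in unitmx.
Proof.
move=> Dy; rewrite -row_free_unit -kermx_eq0; apply/eqP/row_matrixP => i;
  rewrite row0.
set v := row i _; have vE : v *m jacobian T y = 0 by rewrite /v -row_mul
  mulmx_ker row0.
have [B _ /(_ y v Dy) fr] := cf_frame C; move: fr.
set x1 := (v *m B y) 0 0; set x2 := (v *m B y) 0 1;
  set x3 := (v *m B y) 0 2 => fr.
have [s0 t0 sg0] := s_neq0 Dy; have [q1 q2 q3] := dT Dy.
have : dd v T y = 0 by rewrite (dd_jacobian _ sT Dy).
rewrite {1}fr !(dd_dirD _ _ sT Dy) !(dd_dirZ _ _ sT Dy) q1 q2 q3 => E.
have F j := congr1 (fun A : 'rV[R]_3 => A 0 j) E.
have := F 0; have := F 1; have := F 2; rewrite !mxE /= !(mulr0, addr0, add0r).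
move=> h2 h1 /eqP; rewrite !mulf_eq0 (negPf sg0) (negPf t0) !orbF => /eqP x10.
have dJ0 := det_J_neq0 Dy.
have x20 : x2 = 0.
  apply: (mulfI dJ0); rewrite mulr0 /det_J !mxE /=.
  by move/(congr1 (fun z => z * (E3 y 0 0 / t y))): h2;
     move/(congr1 (fun z => z * (E3 y 0 1 / t y))): h1;
       rewrite !mul0r => h1 h2; lra.
have x30 : x3 = 0.
  apply: (mulfI dJ0); rewrite mulr0 /det_J !mxE /=.
  by move/(congr1 (fun z => z * (E2 y 0 0 / t y))): h2;
     move/(congr1 (fun z => z * (E2 y 0 1 / t y))): h1;
       rewrite !mul0r => h1 h2; lra.
by rewrite fr x10 x20 x30 !scale0r !addr0.
Qed.

Lemma cone_coord_inverse x : D x ->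
  exists (U W : set 'rV[R]_3) (phi : 'rV[R]_3 -> 'rV[R]_3),
    [/\ open U /\ open W, U x /\ U `<=` D,
        forall y, U y -> W (T y) /\ phi (T y) = y,
        forall z, W z -> U (phi z) /\ T (phi z) = z
      & smooth_on W phi /\ smooth_on U T].
Proof.
move=> Dx; have [U [W [phi [oUW [Ux UD] H1 H2 sp]]]] := inverse_function oD Dx
  sT jacobian_T.
exists U, W, phi; split=> //; split=> //; exact: smooth_on_sub sT.
Qed.

Section Inverse.
Variables (U W : set 'rV[R]_3) (phi : 'rV[R]_3 -> 'rV[R]_3).
Hypotheses (oU : open U) (oW : open W) (UD : U `<=` D)
  (UW : forall y, U y -> W (T y) /\ phi (T y) = y)
  (WU : forall z, W z -> U (phi z) /\ T (phi z) = z)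
  (sphi : smooth_on W phi).

Let WD z : W z -> D (phi z). Proof. by move=> /WU [/UD]. Qed.

Let dphi X z : W z -> dd (dd X T (phi z)) phi z = X.
Proof.
move=> Wz; have [Uz Tz] := WU Wz;
  have sTU : smooth_on U T by exact: smooth_on_sub sT.
have Wz' : W (T (phi z)) by rewrite Tz.
have := dd_comp X sTU sphi Uz Wz'; rewrite Tz => <-.
rewrite (dd_eq oU (g := id)) //; last by move=> y /UW [].
by rewrite ddE derive_id.
Qed.

Let dphiE z : W z -> let y := phi z in
  [/\ dd (pack3 1 0) phi z = (sg y * t y)^-1 *: e1 y,
      dd (pack3 0 (J E2 y)) phi z = e2 y & dd (pack3 0 (J E3 y)) phi z = e3 y].
Proof.
move=> Wz y; have Dy : D y by exact: WD.
have [q1 q2 q3] := dT Dy; rewrite -q2 -q3 !dphi //; split=> //.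
have [_ t0 sg0] := s_neq0 Dy.
have -> : pack3 1 0 = (sg y * t y)^-1 *: pack3 (sg y * t y) 0 :> 'rV[R]_3.
  apply/rowP => -[[|[|[|//]]] ?]; rewrite !mxE /= ?mulr0 //.
  by rewrite mulVf // mulf_neq0.
by rewrite (dd_dirZ _ _ sphi Wz) -q1 dphi.
Qed.

Lemma dd_cone_param (V : normedModType R) (g : 'rV[R]_3 -> V) z :
  smooth_on D g -> W z -> let y := phi z in
  [/\ dd (pack3 1 0) (fun z => g (phi z)) z = (sg y * t y)^-1 *: dd (e1 y) g y,
      dd (pack3 0 (J E2 y)) (fun z => g (phi z)) z = dd (e2 y) g y
    & dd (pack3 0 (J E3 y)) (fun z => g (phi z)) z = dd (e3 y) g y].
Proof.
move=> sg' Wz y; have Dy : D y by exact: WD.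
rewrite !(dd_comp _ sphi sg' Wz Dy).
have [-> -> ->] := dphiE Wz.
by rewrite (dd_dirZ _ _ sg' Dy).
Qed.

Definition cone_height z : R := G (phi z) 0 2.
Let H := cone_height.
(** [q] is the slope of the height against [t] along [e1]. [gP] controls the growth of the quotient
    [k] and is annihilated by [e2] and [e3], which makes the height separate. *)
Let q y : R := E1 y 0 2 / E1 y 0 3.
Let gP y : R := E1 y 0 2 / sg y - G y 0 2.
Let k y : R := G y 0 2 / t y.

Let E13_neq0 y : D y -> E1 y 0 3 != 0.
Proof. by move=> Dy; have [_ t0 sg0] := s_neq0 Dy;
  rewrite E13 // mulf_neq0. Qed.

Let sgP : smooth_on D gP.
Proof.
apply: smooth_onB => //; last exact: sE.
by apply: smooth_onM => //; [exact: sE|exact: smooth_onV (cf_sg_neq0 C)].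
Qed.

Let sq : smooth_on D q.
Proof.
by apply: smooth_onM => //; [exact: sE|apply: smooth_onV => //; exact: sE].
Qed.

Let sk : smooth_on D k.
Proof. by apply: smooth_onM => //; exact: sE. Qed.

Let sphi_comp (V : normedModType R) (g : 'rV[R]_3 -> V) :
  smooth_on D g -> smooth_on W (fun z => g (phi z)).
Proof. by move=> sg'; exact: (@smooth_on_comp _ _ _ _ W D phi g). Qed.

Let sH : smooth_on W H. Proof. exact: (sphi_comp (sE 2 sG)). Qed.

Let phiT z : W z -> [/\ G (phi z) 0 3 = z 0 0, J G (phi z) 0 0 = z 0 1
  & J G (phi z) 0 1 = z 0 2].
Proof.
by move=> /WU [_ Tz]; rewrite -[in RHS]Tz -[in X in [/\ _, _ = X & _]]Tz -[in X
  in [/\ _, _ & _ = X]]Tz /T /cone_coord /pack3 !mxE.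
Qed.

Let dgP y : D y -> dd (e2 y) gP y = 0 /\ dd (e3 y) gP y = 0.
Proof.
move=> Dy; have sgn0 := cf_sg_neq0 C Dy.
have sV : smooth_on D (fun y => (sg y)^-1) by exact: smooth_onV (cf_sg_neq0 C).
have [d1 d2 d3] := cf_E C Dy; have [k1 k2 k3] := cf_dE1 C Dy.
have [l1 l2 l3] := cf_dsg C Dy.
have dE e : dd e gP y = dd e E1 y 0 2 / sg y - E1 y 0 2 * dd e sg y / sg y ^+ 2
    - dd e G y 0 2.
  rewrite /gP (ddB oD) ?dj ?(ddM oD) ?(ddV oD) ?dj //; try exact: sE.
    by field.
  by apply: smooth_onM => //; exact: sE.
by rewrite !dE d2 d3 k2 k3 l2 l3 !mxE; split; field.
Qed.

Let dq y : D y -> dd (e1 y) q y = s y / (sg y * t y).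
Proof.
move=> Dy; have e13 := E13 Dy; have [_ t0 sg0] := s_neq0 Dy.
have sV : smooth_on D (fun y => (E1 y 0 3)^-1) by apply: smooth_onV => //;
  exact: sE.
have [k1 _ _] := cf_dE1 C Dy; have tE := cf_tuE C Dy.
have [[_ _ z3] _ _ _] := P Dy.
rewrite /q (ddM oD) ?(ddV oD) ?dj //; try exact: sE; last exact: E13_neq0.
by rewrite k1 !mxE z3 e13 tE -/(s y); field; rewrite t0.
Qed.

Let dk y : D y -> dd (e1 y) k y = sg y * gP y / t y.
Proof.
move=> Dy; have [_ t0 sg0] := s_neq0 Dy; have [t1 _ _] := dt Dy.
have [d1 _ _] := cf_E C Dy.
rewrite /k (ddM oD) ?(ddV oD) ?dj //; last exact: sE.
by rewrite d1 E13 // /gP; field; rewrite t0.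
Qed.

Let leaf_dir y v : D y -> exists p1 p2, v = p1 *: J E2 y + p2 *: J E3 y.
Proof. by move=> Dy; apply: row2_sum; exact: det_J_neq0. Qed.

Let pack3_0D p1 p2 u v :
  pack3 0 (p1 *: u + p2 *: v) = p1 *: pack3 0 u + p2 *: pack3 0 v :> 'rV[R]_3.
Proof. by apply/rowP => -[[|[|[|//]]] ?]; rewrite !mxE /= ?mulr0 ?addr0. Qed.

Let dgP_leaf z v : W z -> dd (pack3 0 v) (fun z => gP (phi z)) z = 0.
Proof.
move=> Wz; have Dy := WD Wz; have [p1 [p2 ->]] := leaf_dir v Dy.
have sg' := sphi_comp sgP; rewrite pack3_0D.
rewrite (dd_dirD _ _ sg' Wz) !(dd_dirZ _ _ sg' Wz).
have [_ -> ->] := dd_cone_param sgP Wz; have [-> ->] := dgP Dy.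
by rewrite !scaler0 addr0.
Qed.

Variables (t0 r : R) (w0 : 'rV[R]_2).
Hypotheses (r0 : 0 < r)
  (tN : forall t w, ball t0 r t -> ball w0 r w -> W (pack3 t w)).

Let I : set R := ball t0 r.
Let N : set 'rV[R]_2 := ball w0 r.
Let It0 : I t0. Proof. exact: ballxx. Qed.
Let Nw0 : N w0. Proof. exact: ballxx. Qed.
Let oI : open (I : set R^o). Proof. exact: ball_open. Qed.
Let oN : open N. Proof. exact: ball_open. Qed.

Let line w (tau : R^o) := pack3 tau w.
Let slice tau (w : 'rV[R]_2) := pack3 tau w.

Let sline w : smooth_on (I : set R^o) (line w).
Proof.
apply: smooth_on_mx => // i j.
apply: (@smooth_on_eq _ _ _ _ (fun tau : R^o => [:: tau : R; w 0 0;
  w 0 1]`_j)) => //.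
  by move=> y _; rewrite /line /pack3 mxE.
case: j => [[|[|[|//]]] ?] /=; [exact: smooth_on_id|exact: smooth_on_cst|exact:
  smooth_on_cst].
Qed.

Let sslice tau : smooth_on N (slice tau).
Proof.
have sid : smooth_on N (id : 'rV[R]_2 -> 'rV[R]_2) by exact: smooth_on_id.
apply: smooth_on_mx => // i j.
apply: (@smooth_on_eq _ _ _ _ (fun w : 'rV[R]_2 => [:: tau; w 0 0;
  w 0 1]`_j)) => //.
  by move=> y _; rewrite /slice /pack3 [RHS]mxE.
case: j => [[|[|[|//]]] ?] /=; first exact: smooth_on_cst.
  exact: (smooth_on_mxE 0 0 oN sid).
exact: (smooth_on_mxE 0 1 oN sid).
Qed.

Let dline w tau : I tau -> dd (1 : R^o) (line w) tau = pack3 1 0.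
Proof.
move=> Itau; apply/rowP => j; rewrite -(dd_mxE oI) // /pack3 [RHS]mxE.
rewrite (dd_eq oI (g := fun tau : R^o => [:: tau : R; w 0 0; w 0 1]`_j)) //;
  last first.
  by move=> y _; rewrite /line /pack3 mxE.
case: j => [[|[|[|//]]] ?] /=; rewrite ?mxE ?dd_cst //.
by rewrite ddE derive_id.
Qed.

Let dslice tau v w : N w -> dd v (slice tau) w = pack3 0 v.
Proof.
have sid : smooth_on N (id : 'rV[R]_2 -> 'rV[R]_2) by exact: smooth_on_id.
move=> Nw; apply/rowP => j; rewrite -(dd_mxE oN) // /pack3 [RHS]mxE.
rewrite (dd_eq oN (g := fun w : 'rV[R]_2 => [:: tau; w 0 0; w 0 1]`_j)) //;
  last first.
  by move=> y _; rewrite /slice /pack3 [LHS]mxE.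
case: j => [[|[|[|//]]] ?] /=; rewrite ?dd_cst //.
  by rewrite (dd_mxE oN _ _ _ sid Nw) ddE derive_id.
by rewrite (dd_mxE oN _ _ _ sid Nw) ddE derive_id.
Qed.

Let dd_line (V : normedModType R) (g : 'rV[R]_3 -> V) w tau : smooth_on D g ->
  I tau -> N w -> let y := phi (pack3 tau w) in
  dd (1 : R^o) (fun tau => g (phi (pack3 tau w))) tau =
  (sg y * t y)^-1 *: dd (e1 y) g y.
Proof.
move=> sg' Itau Nw y; have Wz := tN Itau Nw.
have [<- _ _] := dd_cone_param sg' Wz.
have := dd_comp (1 : R^o) (@sline w) (sphi_comp sg') Itau Wz.
by rewrite /line dline.
Qed.

Let dd_slice (V : normedModType R) (g : 'rV[R]_3 -> V) v w tau : smooth_on W g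
  ->
  I tau -> N w ->
  dd v (fun w => g (pack3 tau w)) w = dd (pack3 0 v) g (pack3 tau w).
Proof.
move=> sg' Itau Nw; have Wz := tN Itau Nw.
have := dd_comp v (@sslice tau) sg' Nw Wz.
by rewrite /slice dslice.
Qed.

Let smooth_line (V : normedModType R) (g : 'rV[R]_3 -> V) w : smooth_on D g ->
  N w -> smooth_on (I : set R^o) (fun tau : R^o => g (phi (pack3 tau w))).
Proof.
move=> sg' Nw.
apply: (@smooth_on_comp _ _ _ _ (I : set R^o) W (line w) (fun z => g (phi z)))
  => //.
- by move=> tau Itau; exact: tN.
- exact: sphi_comp.
Qed.

Let smooth_slice (V : normedModType R) (g : 'rV[R]_3 -> V) tau : smooth_on W g
  ->
  I tau -> smooth_on N (fun w => g (pack3 tau w)).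
Proof.
move=> sg' Itau.
apply: (@smooth_on_comp _ _ _ _ N W (slice tau) g) => //.
by move=> w Nw; exact: tN.
Qed.

Let line_constant (f : R^o -> R) tau : smooth_on (I : set R^o) f ->
  (forall tau, I tau -> dd (1 : R^o) f tau = 0) -> I tau -> f tau = f t0.
Proof.
move=> sf df Itau.
have seg c : 0 <= c <= 1 -> I (t0 + c *: ((tau : R^o) - t0)).
  by move=> c01; exact: (@ball_line _ R^o t0 t0 tau r c).
have -> : tau = t0 + (tau - t0) by rewrite addrC subrK.
apply: (@derive0_line _ R^o f t0 (tau - t0)) => c /seg Ic.
  exact: smooth_on_differentiable sf Ic.
have := dd_dirZ (1 : R^o) (tau - t0) sf Ic.
by rewrite df // scaler0 /GRing.scale /= mulr1 ddE.
Qed.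

Let slice_constant (f : 'rV[R]_2 -> R) w : smooth_on N f ->
  (forall v w, N w -> dd v f w = 0) -> N w -> f w = f w0.
Proof. by move=> sf df Nw; exact: (constant_ball sf (fun _ => id) (fun w v =>
  df v w)). Qed.

Let t_phi tau w : I tau -> N w -> t (phi (pack3 tau w)) = tau.
Proof.
by move=> Itau Nw; have [h _ _] := phiT (tN Itau Nw); rewrite /t h;
  case: (pack3K tau w).
Qed.

Let I_neq0 tau : I tau -> tau != 0.
Proof.
move=> Itau; have Wz := tN Itau Nw0; rewrite -(t_phi Itau Nw0).
by case: (s_neq0 (WD Wz)).
Qed.

(** A constant may be moved between f and g_2 (t) / t; the choice made here amounts to g_2 (t0) =
    0. *)
Definition leaf_graph w : R := H (pack3 t0 w) / t0.
Let f := leaf_graph.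
Definition cone_profile (tau : R) : R := H (pack3 tau w0) - tau * f w0.
Let g2 := cone_profile.

(** The t-derivative of height over t is gP / t^2, and gP depends on t alone. The difference of
    these quotients at w and w0 is therefore independent of t, and equals its value f w - f w0 at
    t0. *)
Lemma cone_height_split tau w : I tau -> N w ->
  H (pack3 tau w) = tau * f w + g2 tau.
Proof.
move=> Itau Nw.
pose m (tau : R^o) := k (phi (pack3 tau w)) - k (phi (pack3 tau w0)).
have sm1 := smooth_line sk Nw; have sm2 := smooth_line sk Nw0.
have sm : smooth_on (I : set R^o) m by exact: smooth_onB.
have gc tau' : I tau' -> gP (phi (pack3 tau' w)) = gP (phi (pack3 tau' w0)).
  move=> It'; have sg' := sphi_comp sgP.
  apply: (slice_constant (f := fun w => gP (phi (pack3 tau' w)))) => //.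
    exact: (smooth_slice sg').
  move=> v w' Nw'; rewrite (dd_slice v sg' It' Nw').
  by apply: dgP_leaf; exact: tN.
have mc : m tau = m t0.
  apply: line_constant => // tau' It'; rewrite /m (ddB oI) //.
  rewrite !dd_line // !dk ?t_phi //; try by apply: WD; exact: tN.
  rewrite gc // /GRing.scale /=.
  have It0' := I_neq0 It'.
  have s1 := cf_sg_neq0 C (WD (tN It' Nw)).
  have s2 := cf_sg_neq0 C (WD (tN It' Nw0)).
  by field; rewrite ?It0' ?s1 ?s2.
have ke tau' w' : I tau' -> N w' -> k (phi (pack3 tau' w')) = H (pack3 tau' w')
  / tau'.
  by move=> It' Nw'; rewrite /k t_phi.
have i0 := I_neq0 Itau; have i1 := I_neq0 It0.
move: mc; rewrite /m !ke // => mc.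
have -> : H (pack3 tau w) = tau * (H (pack3 tau w) / tau - H (pack3 tau w0) /
  tau)
    + H (pack3 tau w0) by field.
by rewrite mc /g2 /cone_profile /f /leaf_graph; field.
Qed.

Lemma cone_param_immersion tau w : I tau -> N w ->
  G (phi (pack3 tau w)) = cone_immersion f id g2 tau w.
Proof.
move=> Itau Nw; have Wz := tN Itau Nw; have [h3 h0 h1] := phiT Wz.
have [p0 pT] := pack3K tau w; have i0 := I_neq0 Itau.
have tE := t_phi Itau Nw.
apply/rowP => j; rewrite [RHS]mxE.
have G0 : G (phi (pack3 tau w)) 0 0 = tau * w 0 0.
  move: h0; rewrite !mxE /= tE => h0.
  by rewrite -[RHS]mulrC -h0 divfK.
have G1 : G (phi (pack3 tau w)) 0 1 = tau * w 0 1.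
  move: h1; rewrite !mxE /= tE => h1.
  by rewrite -[RHS]mulrC -h1 divfK.
case: j => [[|[|[|[|//]]]] ij] /=.
- by rewrite -G0; congr (G _ _ _); apply: val_inj.
- by rewrite -G1; congr (G _ _ _); apply: val_inj.
- rewrite -cone_height_split // /H /cone_height.
  by congr (G _ _ _); apply: val_inj.
- by rewrite -[RHS]tE; congr (G _ _ _); apply: val_inj.
Qed.

(** With g_1 = t nondegeneracy means that g_2'' is nonzero; g_2' is the slope [q] up to a constant,
    and the derivative of [q] is a nonzero multiple of the component [s] of Z. *)
Lemma cone_profile_affine_curve : affine_curve I id g2.
Proof.
have sHl := smooth_line (sE 2 sG) Nw0.
have sid : smooth_on (I : set R^o) (id : R^o -> R^o) by exact: smooth_on_id.
have sg2 : smooth_on (I : set R^o) (g2 : R^o -> R^o).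
  apply: smooth_onB => //; apply: smooth_onM => //; exact: smooth_on_cst.
split=> // tau Itau; rewrite derive1_id /=.
pose q0 (tau : R) := q (phi (pack3 tau w0)).
have d1 tau' : I tau' -> derive1 g2 tau' = q0 tau' - f w0.
  move=> It'; rewrite derive1E -[LHS]/('D_1 (g2 : R^o -> R^o) tau').
  have <- : dd (1 : R^o) (g2 : R^o -> R^o) tau' = 'D_1 (g2 : R^o -> R^o) tau'
    by rewrite ddE.
  rewrite /g2 /cone_profile (ddB oI) //; last first.
    by apply: smooth_onM => //; exact: smooth_on_cst.
  rewrite (dd_line (sE 2 sG) It' Nw0) dj //; last by apply: WD; exact: tN.
  rewrite (ddM oI) //; last exact: smooth_on_cst.
  rewrite dd_cst mulr0 addr0.
  have -> : dd (1 : R^o) (id : R^o -> R) tau' = 1 by rewrite ddE derive_id.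
  rewrite mul1r; congr (_ - _).
  have Dy := WD (tN It' Nw0); have [-> _ _] := cf_E C Dy.
  by rewrite /q0 /q E13 // /GRing.scale /= mulrC.
have -> : derive1 (derive1 (id : R -> R)) tau = 0.
  rewrite (_ : derive1 id = cst 1); first by rewrite derive1_cst.
  by apply/funext => u; rewrite derive1_id.
rewrite mul0r subr0 mul1r derive1E.
have -> : 'D_1 (derive1 g2) tau = dd (1 : R^o) (derive1 g2 : R^o -> R) tau by
  rewrite ddE.
rewrite (dd_eq oI (g := fun tau : R^o => q0 tau - f w0)) //.
have sq0 : smooth_on (I : set R^o) (q0 : R^o -> R) by exact: (smooth_line sq
  Nw0).
have sc : smooth_on (I : set R^o) (fun=> f w0 : R) by exact: smooth_on_cst.
rewrite (ddB oI _ sq0 sc Itau).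
rewrite dd_cst subr0 /q0 dd_line // dq; last by apply: WD; exact: tN.
have [s1 t1 sg1] := s_neq0 (WD (tN Itau Nw0)).
by rewrite scaler_eq0 !(mulf_eq0, invr_eq0) !negb_or sg1 t1 s1.
Qed.

Let Y w := phi (pack3 t0 w).
Let YD w : N w -> D (Y w). Proof. by move=> Nw; apply: WD; exact: tN. Qed.
Let sY (V : normedModType R) (g : 'rV[R]_3 -> V) : smooth_on D g ->
  smooth_on N (fun w => g (Y w)).
Proof. by move=> sg'; exact: (smooth_slice (sphi_comp sg')). Qed.

Let dY (V : normedModType R) (g : 'rV[R]_3 -> V) w : smooth_on D g -> N w ->
  dd (J E2 (Y w)) (fun w => g (Y w)) w = dd (e2 (Y w)) g (Y w) /\
  dd (J E3 (Y w)) (fun w => g (Y w)) w = dd (e3 (Y w)) g (Y w).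
Proof.
move=> sg' Nw; rewrite !(dd_slice _ (sphi_comp sg') It0 Nw).
by have [_ -> ->] := dd_cone_param sg' (tN It0 Nw).
Qed.

Let sf : smooth_on N f.
Proof.
apply: smooth_onM => //; last exact: smooth_on_cst.
exact: (sY (sE 2 sG)).
Qed.

Let df w : N w -> dd (J E2 (Y w)) f w = E2 (Y w) 0 2 / t0 /\
  dd (J E3 (Y w)) f w = E3 (Y w) 0 2 / t0.
Proof.
move=> Nw; have sGY := sY (sE 2 sG);
  have sc : smooth_on N (fun=> t0^-1 : R) by exact: smooth_on_cst.
have [g2' g3'] := dY (sE 2 sG) Nw; have [_ q2 q3] := cf_E C (YD Nw).
have dE v : dd v f w = dd v (fun w => G (Y w) 0 2 : R) w / t0.
  by rewrite /f /leaf_graph (ddM oN) // dd_cst mulr0 addr0.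
by rewrite !dE g2' g3' !dj ?q2 ?q3 //; exact: YD.
Qed.

(** A Hessian entry needs the direction frozen at w, so the derivative of the moving direction is
    subtracted. *)
Let dd_gradient (Ei : 'rV[R]_3 -> 'rV[R]_4) u w : smooth_on D Ei -> N w ->
  (forall w, N w -> dd (J Ei (Y w)) f w = Ei (Y w) 0 2 / t0) ->
  dd u (dd (J Ei (Y w)) f) w =
  dd u (fun w => Ei (Y w) 0 2 : R) w / t0 - dd (dd u (fun w => J Ei (Y w)) w) f
    w.
Proof.
move=> sEi Nw dfE; have sc : smooth_on N (fun=> t0^-1 : R) by exact:
  smooth_on_cst.
have su : smooth_on N (fun=> u) by exact: smooth_on_cst.
have := dd_field oN Nw su (sY (sJ sEi)) sf.
rewrite (dd_eq oN (g := fun w => Ei (Y w) 0 2 / t0)) //.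
have sEY := sY (sE 2 sEi).
by rewrite (ddM oN) // dd_cst mulr0 addr0 => ->; rewrite addrAC subrr add0r.
Qed.

(** The E2 and E3 parts of the frame derivatives contribute equally to both terms and cancel. Only
    the Z part is left, which is vertical, so the Hessian is s / t0 times the identity in the basis
    J E2, J E3. *)
Lemma leaf_hessian w : N w -> let y := Y w in
  [/\ dd (J E2 y) (dd (J E2 y) f) w = s y / t0,
      dd (J E2 y) (dd (J E3 y) f) w = 0,
      dd (J E3 y) (dd (J E2 y) f) w = 0
    & dd (J E3 y) (dd (J E3 y) f) w = s y / t0].
Proof.
move=> Nw y; have Dy : D y by exact: YD.
have df2 w' Nw' := (@df w' Nw').1; have df3 w' Nw' := (@df w' Nw').2.
rewrite !dd_gradient // -/y.
have [j22 j32] := dY (sJ sE2) Nw; have [j23 j33] := dY (sJ sE3) Nw.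
have [k22 k32] := dY (sE 2 sE2) Nw; have [k23 k33] := dY (sE 2 sE3) Nw.
rewrite -/y in j22 j32 j23 j33 k22 k32 k23 k33.
rewrite j22 j32 j23 j33 k22 k32 k23 k33 !dj //.
have [_ t2 t3] := dt Dy.
rewrite !dJ_leaf //.
have [_ q22 q32] := cf_dE2 C Dy; have [_ q23 q33] := cf_dE3 C Dy.
have [[z0 z1 _] _ _ _] := P Dy.
rewrite q22 q32 q23 q33.
have comb c1 c2 : dd (\row_j [:: (c1 * E2 y 0 0 + c2 * E3 y 0 0) / t y;
     (c1 * E2 y 0 1 + c2 * E3 y 0 1) / t y]`_j) f w =
     (c1 * E2 y 0 2 + c2 * E3 y 0 2) / t0.
  have -> : \row_j [:: (c1 * E2 y 0 0 + c2 * E3 y 0 0) / t y;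
      (c1 * E2 y 0 1 + c2 * E3 y 0 1) / t y]`_j = c1 *: J E2 y + c2 *: J E3 y
        :> 'rV[R]_2.
    by apply/rowP => -[[|[|//]] ?]; rewrite !mxE /=; ring.
  rewrite (dd_dirD _ _ sf Nw) !(dd_dirZ _ _ sf Nw) df2 // df3 // -/y.
  by rewrite /GRing.scale /=; ring.
have c22 := comb (mu2 y) (al y); have c32 := comb 0 (be y - mu2 y).
have c23 := comb (- al y) (- mu2 y); have c33 := comb (- (be y + mu2 y)) 0.
have rw (u v u' v' : R) : u = u' -> v = v' ->
   \row_j [:: u; v]`_j = \row_j [:: u'; v']`_j :> 'rV[R]_2 by move=> -> ->.
split.
- rewrite (rw _ _ _ _ _ _ : \row_j [:: _; _]`_j = \row_j [::
    (mu2 y * E2 y 0 0 + al y * E3 y 0 0) / t y;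
      (mu2 y * E2 y 0 1 + al y * E3 y 0 1) / t y]`_j).
    by rewrite c22 !mxE; rewrite /s; ring.
  by rewrite !mxE ?z0 ?z1 ?addr0; ring.
  by rewrite !mxE ?z0 ?z1 ?addr0; ring.
- rewrite (rw _ _ _ _ _ _ : \row_j [:: _; _]`_j = \row_j [::
    (- al y * E2 y 0 0 + - mu2 y * E3 y 0 0) / t y;
      (- al y * E2 y 0 1 + - mu2 y * E3 y 0 1) / t y]`_j).
    by rewrite c23 !mxE; ring.
  by rewrite !mxE ?z0 ?z1 ?addr0; ring.
  by rewrite !mxE ?z0 ?z1 ?addr0; ring.
- rewrite (rw _ _ _ _ _ _ : \row_j [:: _; _]`_j = \row_j [::
    (0 * E2 y 0 0 + (be y - mu2 y) * E3 y 0 0) / t y;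
      (0 * E2 y 0 1 + (be y - mu2 y) * E3 y 0 1) / t y]`_j).
    by rewrite c32 !mxE; ring.
  by rewrite !mxE ?z0 ?z1 ?addr0; ring.
  by rewrite !mxE ?z0 ?z1 ?addr0; ring.
- rewrite (rw _ _ _ _ _ _ : \row_j [:: _; _]`_j = \row_j [::
    (- (be y + mu2 y) * E2 y 0 0 + 0 * E3 y 0 0) / t y;
      (- (be y + mu2 y) * E2 y 0 1 + 0 * E3 y 0 1) / t y]`_j).
    by rewrite c33 !mxE; rewrite /s; ring.
  by rewrite !mxE ?z0 ?z1 ?addr0; ring.
  by rewrite !mxE ?z0 ?z1 ?addr0; ring.
Qed.

Let d0 : 'rV[R]_2 := delta_mx 0 0.
Let d1 : 'rV[R]_2 := delta_mx 0 1.

Let row2E (w : 'rV[R]_2) : w = w 0 0 *: d0 + w 0 1 *: d1.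
Proof.
apply/rowP => -[[|[|//]] i]; rewrite !mxE /=;
  rewrite ?mulr0 ?mulr1 ?addr0 ?add0r;
  by congr (w _ _); apply: val_inj.
Qed.

Let ja w := J E2 (Y w) 0 0.
Let jb w := J E2 (Y w) 0 1.
Let jc w := J E3 (Y w) 0 0.
Let jd w := J E3 (Y w) 0 1.
Let Del w := ja w * jd w - jb w * jc w.

Let t_Y w : N w -> t (Y w) = t0. Proof. exact: t_phi. Qed.

Let Del_sq w : N w -> Del w ^+ 2 = (s (Y w) / t0) ^+ 2.
Proof. by move=> Nw; rewrite -(t_Y Nw) -det_J_sq //; exact: YD. Qed.

Let Del_neq0 w : N w -> Del w != 0.
Proof. by move=> Nw; exact: det_J_neq0 (YD Nw). Qed.

Let s_t0_neq0 w : N w -> s (Y w) / t0 != 0.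
Proof.
move=> Nw; have [s0 _ _] := s_neq0 (YD Nw).
by rewrite mulf_neq0 // invr_eq0 I_neq0.
Qed.

(** Inverting the basis J E2, J E3 divides by Del^2, which equals the square of s / t0; hence the
    single power of s / t0 below. *)
Let hessian_entries w : N w ->
  [/\ dd d0 (dd d0 f) w = (jd w ^+ 2 + jb w ^+ 2) / (s (Y w) / t0),
      dd d0 (dd d1 f) w = - (jc w * jd w + ja w * jb w) / (s (Y w) / t0),
      dd d1 (dd d0 f) w = - (jc w * jd w + ja w * jb w) / (s (Y w) / t0)
    & dd d1 (dd d1 f) w = (jc w ^+ 2 + ja w ^+ 2) / (s (Y w) / t0)].
Proof.
move=> Nw; have [h22 h23 h32 h33] := leaf_hessian Nw.
have D0 := Del_neq0 Nw; have D2 := Del_sq Nw.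
have J2E : J E2 (Y w) = ja w *: d0 + jb w *: d1 by exact: row2E.
have J3E : J E3 (Y w) = jc w *: d0 + jd w *: d1 by exact: row2E.
have e0 : d0 = (jd w / Del w) *: J E2 (Y w) + (- jb w / Del w) *: J E3 (Y w).
  rewrite J2E J3E; move: (d0) (d1) => u v.
  by apply/rowP => j; rewrite !mxE; move: D0; rewrite /Del => D0; field.
have e1' : d1 = (- jc w / Del w) *: J E2 (Y w) + (ja w / Del w) *: J E3 (Y w).
  rewrite J2E J3E; move: (d0) (d1) => u v.
  by apply/rowP => j; rewrite !mxE; move: D0; rewrite /Del => D0; field.
have s0 := s_t0_neq0 Nw; move: s0 D2 h22 h23 h32 h33.
move: (s (Y w) / t0) => sig s0 D2 h22 h23 h32 h33.
have inv : Del w ^- 2 * sig = sig^-1.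
  by rewrite D2; field.
have bil p p' q1 q' := second_dd_bilin (J E2 (Y w)) (J E3 (Y w)) (J E2 (Y w))
  (J E3 (Y w)) p p' q1 q' oN sf Nw.
rewrite h22 h23 h32 h33 in bil.
rewrite e0 e1' !bil -inv.
by split; field.
Qed.

Lemma leaf_improper_affine_sphere :
  improper_affine_sphere N (graph_surface f) (\row_j [:: 0; 0; 1]`_j).
Proof.
apply: graph_improper_affine_sphere => // w Nw.
have [-> -> -> ->] := hessian_entries Nw.
have s0 := s_t0_neq0 Nw; have := Del_sq Nw; rewrite /Del.
move: (s (Y w) / t0) s0 => sig s0 D2.
(* Lagrange's identity: the numerator of the Hessian determinant is Del^2, and Del^2 = sig^2. *)
apply: (mulIf (expf_neq0 2 s0)); rewrite mul1r -[RHS]D2.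
by field.
Qed.

(** * Vanishing [mu2]: leaves are elliptic paraboloids *)

Section Paraboloid.
Hypothesis mu20 : forall y, D y -> mu2 y = 0.

Let leaf_invariant (g : 'rV[R]_3 -> R) w : smooth_on D g ->
  (forall y, D y -> dd (e2 y) g y = 0 /\ dd (e3 y) g y = 0) ->
  N w -> g (Y w) = g (Y w0).
Proof.
move=> sg' dg Nw; apply: (slice_constant (f := fun w => g (Y w))) => //.
  exact: sY.
move=> v w' Nw'; have [p1 [p2 ->]] := leaf_dir v (YD Nw').
have sgY := sY sg'; rewrite (dd_dirD _ _ sgY Nw') !(dd_dirZ _ _ sgY Nw').
have [-> ->] := dY sg' Nw'; have [-> ->] := dg _ (YD Nw').
by rewrite !scaler0 addr0.
Qed.

Let s_const w : N w -> s (Y w) = s (Y w0).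
Proof.
apply: leaf_invariant; first exact: sE.
move=> y Dy; have [_ z2 z3] := cf_dZ C Dy.
by rewrite !dj // z2 z3 !mxE.
Qed.

(* With [mu2 = 0] the connection rotates [E2], [E3] rigidly along a leaf. *)
Let gram_const i j w : N w ->
  J E2 (Y w) 0 i * J E2 (Y w) 0 j + J E3 (Y w) 0 i * J E3 (Y w) 0 j =
  J E2 (Y w0) 0 i * J E2 (Y w0) 0 j + J E3 (Y w0) 0 i * J E3 (Y w0) 0 j.
Proof.
have s2 l : smooth_on D (fun y => J E2 y 0 l : R) by exact: smooth_on_mxE oD
  (sJ sE2).
have s3 l : smooth_on D (fun y => J E3 y 0 l : R) by exact: smooth_on_mxE oD
  (sJ sE3).
have s22 := smooth_onM oD (s2 i) (s2 j);
  have s33 := smooth_onM oD (s3 i) (s3 j).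
move=> Nw; apply: (leaf_invariant (g := fun y => J E2 y 0 i * J E2 y 0 j +
  J E3 y 0 i * J E3 y 0 j)) => //; first exact: smooth_onD.
move=> y Dy; have [_ t2 t3] := dt Dy.
have [_ q22 q32] := cf_dE2 C Dy; have [_ q23 q33] := cf_dE3 C Dy.
have [[z0 z1 _] _ _ _] := P Dy.
have sJ2 := sJ sE2; have sJ3 := sJ sE3.
have dJ22 l : dd (e2 y) (fun y => J E2 y 0 l : R) y = al y * J E3 y 0 l.
  rewrite (dd_mxE oD _ _ _ sJ2 Dy) dJ_leaf // q22 mu20 // !mxE z0 z1.
  by case: l => [[|[|//]] ?] /=; ring.
have dJ32 l : dd (e3 y) (fun y => J E2 y 0 l : R) y = be y * J E3 y 0 l.
  rewrite (dd_mxE oD _ _ _ sJ2 Dy) dJ_leaf // q32 mu20 // !mxE.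
  by case: l => [[|[|//]] ?] /=; ring.
have dJ23 l : dd (e2 y) (fun y => J E3 y 0 l : R) y = - al y * J E2 y 0 l.
  rewrite (dd_mxE oD _ _ _ sJ3 Dy) dJ_leaf // q23 mu20 // !mxE.
  by case: l => [[|[|//]] ?] /=; ring.
have dJ33 l : dd (e3 y) (fun y => J E3 y 0 l : R) y = - be y * J E2 y 0 l.
  rewrite (dd_mxE oD _ _ _ sJ3 Dy) dJ_leaf // q33 mu20 // !mxE z0 z1.
  by case: l => [[|[|//]] ?] /=; ring.
rewrite !(ddD oD _ s22 s33 Dy) !(ddM oD _ (s2 i) (s2 j) Dy).
rewrite !(ddM oD _ (s3 i) (s3 j) Dy) !dJ22 !dJ32 !dJ23 !dJ33.
by split; ring.
Qed.

Let sig := s (Y w0) / t0.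
Let sig0 : sig != 0. Proof. exact: s_t0_neq0. Qed.
Let h00 := (jd w0 ^+ 2 + jb w0 ^+ 2) / sig.
Let h01 := - (jc w0 * jd w0 + ja w0 * jb w0) / sig.
Let h11 := (jc w0 ^+ 2 + ja w0 ^+ 2) / sig.

Let hessian_const w : N w -> [/\ dd d0 (dd d0 f) w = h00,
  dd d0 (dd d1 f) w = h01, dd d1 (dd d0 f) w = h01 & dd d1 (dd d1 f) w = h11].
Proof.
move=> Nw; have [-> -> -> ->] := hessian_entries Nw.
have g00 := gram_const 0 0 Nw; have g01 := gram_const 0 1 Nw.
have g11 := gram_const 1 1 Nw; rewrite s_const // -/sig /h00 /h01 /h11.
have -> : jd w ^+ 2 + jb w ^+ 2 = jd w0 ^+ 2 + jb w0 ^+ 2.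
  by move: g11; rewrite -!expr2 addrC => ->; rewrite addrC.
have -> : jc w ^+ 2 + ja w ^+ 2 = jc w0 ^+ 2 + ja w0 ^+ 2.
  by move: g00; rewrite -!expr2 addrC => ->; rewrite addrC.
have -> : jc w * jd w + ja w * jb w = jc w0 * jd w0 + ja w0 * jb w0.
  by move: g01; rewrite addrC => ->; rewrite addrC.
by [].
Qed.

Let c0 := dd d0 f w0.
Let c1 := dd d1 f w0.

Let sx i : smooth_on N (fun w : 'rV[R]_2 => w 0 i - w0 0 i : R).
Proof.
apply: smooth_onB => //; last exact: smooth_on_cst.
by apply: smooth_on_mxE => //; exact: smooth_on_id.
Qed.

Let dx i v w : N w -> dd v (fun w : 'rV[R]_2 => w 0 i - w0 0 i : R) w = v 0 i.
Proof.
have sid : smooth_on N (id : 'rV[R]_2 -> 'rV[R]_2) by exact: smooth_on_id.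
move=> Nw; rewrite (ddB oN _ (smooth_on_mxE 0 i oN sid)) //;
  last exact: smooth_on_cst.
by rewrite dd_cst subr0 (dd_mxE oN _ _ _ sid Nw) ddE derive_id.
Qed.

Let scal (b : R) (g : 'rV[R]_2 -> R) : smooth_on N g -> smooth_on N (fun w => b
  * g w).
Proof. by move=> sg'; apply: smooth_onM => //; exact: smooth_on_cst. Qed.

Let dscal (b : R) (g : 'rV[R]_2 -> R) v w : smooth_on N g -> N w ->
  dd v (fun w => b * g w) w = b * dd v g w.
Proof.
move=> sg' Nw; rewrite (ddM oN) //; last exact: smooth_on_cst.
by rewrite dd_cst mul0r add0r.
Qed.

Let gradient_affine (b b0 b1 : R) (g : 'rV[R]_2 -> R) w : smooth_on N g ->
  g w0 = b -> (forall w, N w -> dd d0 g w = b0 /\ dd d1 g w = b1) -> N w ->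
  g w = b + (b0 * (w 0 0 - w0 0 0) + b1 * (w 0 1 - w0 0 1)).
Proof.
move=> sg' gw0 dg Nw.
pose m (w : 'rV[R]_2) := g w - (b0 * (w 0 0 - w0 0 0) + b1 * (w 0 1 - w0 0 1)).
have sa0 := scal b0 (sx 0); have sa1 := scal b1 (sx 1).
have sl := smooth_onD oN sa0 sa1.
have sm : smooth_on N m by exact: smooth_onB.
have : m w = m w0.
  apply: slice_constant => // v w' Nw'.
  rewrite /m (ddB oN _ sg' sl Nw') (ddD oN _ sa0 sa1 Nw') !dscal // !dx //.
  rewrite {1}(row2E v) (dd_dirD _ _ sg' Nw') !(dd_dirZ _ _ sg' Nw').
  by have [-> ->] := dg w' Nw'; rewrite /GRing.scale /=; ring.
rewrite /m !subrr !mulr0 !addr0 subr0 gw0 => <-.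
by rewrite subrK.
Qed.

(** The constant Hessian makes the gradient affine; after subtracting the quadratic part the
    gradient is constant, and the same integration applies once more. *)
Let leaf_quadratic w : N w ->
  f w = f w0 + (c0 * (w 0 0 - w0 0 0) + c1 * (w 0 1 - w0 0 1)) +
    2^-1 * (h00 * (w 0 0 - w0 0 0) ^+ 2 +
      2 * h01 * (w 0 0 - w0 0 0) * (w 0 1 - w0 0 1) + h11 * (w 0 1 - w0 0 1) ^+
        2).
Proof.
move=> Nw.
pose m (w : 'rV[R]_2) := f w - 2^-1 * (h00 * ((w 0 0 - w0 0 0) * (w 0 0 - w0 0
  0)) +
  (2 * h01) * ((w 0 0 - w0 0 0) * (w 0 1 - w0 0 1)) +
  h11 * ((w 0 1 - w0 0 1) * (w 0 1 - w0 0 1))).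
have s00 := smooth_onM oN (sx 0) (sx 0);
  have s01 := smooth_onM oN (sx 0) (sx 1).
have s11 := smooth_onM oN (sx 1) (sx 1).
have k00 := scal h00 s00; have k01 := scal (2 * h01) s01;
  have k11 := scal h11 s11.
have k1 := smooth_onD oN k00 k01; have k2 := smooth_onD oN k1 k11.
have k3 := scal 2^-1 k2; have sm : smooth_on N m by exact: smooth_onB.
have dm v w' : N w' -> dd v m w' = dd v f w' - 2^-1 *
   (h00 * (2 * (v 0 0 * (w' 0 0 - w0 0 0))) +
    2 * h01 * (v 0 0 * (w' 0 1 - w0 0 1) + v 0 1 * (w' 0 0 - w0 0 0)) +
    h11 * (2 * (v 0 1 * (w' 0 1 - w0 0 1)))).
  move=> Nw'; rewrite /m (ddB oN _ sf k3 Nw') (dscal _ _ k2 Nw').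
  rewrite (ddD oN _ k1 k11 Nw') (ddD oN _ k00 k01 Nw').
  rewrite (dscal _ _ s00 Nw') (dscal _ _ s01 Nw') (dscal _ _ s11 Nw').
  rewrite (ddM oN _ (sx 0) (sx 0) Nw') (ddM oN _ (sx 0) (sx 1) Nw').
  by rewrite (ddM oN _ (sx 1) (sx 1) Nw') !dx //; ring.
have grad w' : N w' -> dd d0 f w' = c0 + (h00 * (w' 0 0 - w0 0 0) + h01 * (w' 0
  1 - w0 0 1))
    /\ dd d1 f w' = c1 + (h01 * (w' 0 0 - w0 0 0) + h11 * (w' 0 1 - w0 0 1)).
  move=> Nw'; split; apply: gradient_affine => //; try exact: smooth_dd.
    by move=> w'' /hessian_const [].
  by move=> w'' /hessian_const [].
have := @gradient_affine (f w0) c0 c1 m w sm _ _ Nw.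
rewrite {1 2}/m !subrr !mulr0 !addr0 mulr0 subr0 => /(_ erefl) E.
have dm01 w' : N w' -> dd d0 m w' = c0 /\ dd d1 m w' = c1.
  move=> Nw'; have [g0 g1] := grad w' Nw'; rewrite !dm // g0 g1 !mxE /=.
  by split; field.
have := E dm01.
rewrite /m => E'.
by lra.
Qed.

(** In components of w - w0 with respect to J E2, J E3 the Hessian is sig times the identity, so f
    minus its tangent plane is sig / 2 times a sum of two squares. *)
Lemma leaf_elliptic_paraboloid : elliptic_paraboloid (graph_surface f @` N).
Proof.
have D0 := Del_neq0 Nw0.
pose x0 := w0 0 0; pose z0 := w0 0 1.
(* The first two columns invert the basis J E2, J E3 at w0; the third subtracts the tangent plane
   and rescales by 2 / sig, which also absorbs the sign of sig. *)
pose A i j : R := nth 0 (nth [::] [::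
  [:: jd w0 / Del w0; - jb w0 / Del w0; - 2 / sig * c0];
  [:: - jc w0 / Del w0; ja w0 / Del w0; - 2 / sig * c1];
  [:: 0; 0; 2 / sig]] i) j.
pose Q : 'M[R]_3 := \matrix_(i < 3, j < 3) A i j.
pose b : 'rV[R]_3 := \row_(j < 3) [:: - (jd w0 * x0 - jc w0 * z0) / Del w0;
  - (ja w0 * z0 - jb w0 * x0) / Del w0;
  2 / sig * (c0 * x0 + c1 * z0 - f w0)]`_j.
exists Q, b; split.
  rewrite unitmxE unitfE (det_expand_nat 2 A) !big_ord_recl big_ord0 /=.
  rewrite !(det_expand_nat 1 (fun i j => A i.+1 (bump _ j))).
  rewrite !big_ord_recl !big_ord0 !det_mx11 !mxE /= /A /bump /=.
  rewrite !exprS !expr0.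
  rewrite (_ : _ + _ = 2 / (sig * Del w0)); last first.
    transitivity ((ja w0 * jd w0 - jb w0 * jc w0) / Del w0 ^+ 2 * (2 / sig)).
      by field; rewrite D0 sig0.
    by rewrite -/(Del w0); field; rewrite D0 sig0.
  by rewrite mulf_neq0 // invr_eq0 mulf_neq0.
move=> _ [w Nw <-] z.
have zE (j : 'I_3) : z 0 j = w 0 0 * A 0 j + w 0 1 * A 1 j + f w * A 2 j + b 0
  j.
  rewrite /z mxE; congr (_ + _); rewrite mxE !big_ord_recl big_ord0 !mxE /=
    addr0 addrA.
  by [].
rewrite !zE !mxE /A /= leaf_quadratic //.
rewrite -/x0 -/z0 /h00 /h01 /h11.
have D2 := Del_sq Nw0; rewrite -/sig in D2.
have E : (jd w0 * (w 0 0 - x0) - jc w0 * (w 0 1 - z0)) ^+ 2 / Del w0 ^+ 2 +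
  (ja w0 * (w 0 1 - z0) - jb w0 * (w 0 0 - x0)) ^+ 2 / Del w0 ^+ 2 =
  2 / sig * (2^-1 * ((jd w0 ^+ 2 + jb w0 ^+ 2) / sig * (w 0 0 - x0) ^+ 2 +
   2 * (- (jc w0 * jd w0 + ja w0 * jb w0) / sig) * (w 0 0 - x0) * (w 0 1 - z0) +
   (jc w0 ^+ 2 + ja w0 ^+ 2) / sig * (w 0 1 - z0) ^+ 2)).
  by rewrite D2; field.
transitivity (2 / sig * (2^-1 * ((jd w0 ^+ 2 + jb w0 ^+ 2) / sig * (w 0 0 - x0)
  ^+ 2 +
   2 * (- (jc w0 * jd w0 + ja w0 * jb w0) / sig) * (w 0 0 - x0) * (w 0 1 - z0) +
   (jc w0 ^+ 2 + ja w0 ^+ 2) / sig * (w 0 1 - z0) ^+ 2))).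
  by field.
rewrite -E.
by field; rewrite D0.
Qed.

End Paraboloid.
End Inverse.
End ConeChart.

(** * Proof of the theorem *)

Lemma smooth_on_pair (R : realType) (V W W' : normedModType R) (D : set V)
    (f : V -> W) (g : V -> W') : open D -> smooth_on D f -> smooth_on D g ->
  smooth_on D (fun x => (f x, g x)).
Proof.
move=> oD sf sg.
have linl : linear (fun u : W => (u, 0 : W')).
  by move=> k u v; apply: injective_projections; rewrite /= ?scaler0 ?addr0.
have linr : linear (fun u : W' => (0 : W, u)).
  by move=> k u v; apply: injective_projections; rewrite /= ?scaler0 ?addr0.
pose fl := GRing.isLinear.Build R W (W * W')%type *:%R (fun u : W => (u, 0 :
  W')) linl.
pose fr := GRing.isLinear.Build R W' (W * W')%type *:%R (fun u : W' => (0 : W,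
  u)) linr.
pose L : {linear W -> (W * W')%type} := HB.pack (fun u : W => (u, 0 : W')) fl.
pose L' : {linear W' -> (W * W')%type} := HB.pack (fun u : W' => (0 : W, u)) fr.
have cL : continuous L.
  by move=> u; apply: cvg_pair; [exact: cvg_id|exact: cvg_cst].
have cL' : continuous L'.
  by move=> u; apply: cvg_pair; [exact: cvg_cst|exact: cvg_id].
have s := smooth_onD oD (smooth_on_linear oD cL sf) (smooth_on_linear oD cL'
  sg).
apply: smooth_on_eq s => // x _.
by rewrite /=; congr pair; rewrite ?addr0 ?add0r.
Qed.

Definition join3 (R : realType) (z : R * 'rV[R]_2) : 'rV[R]_3 := pack3 z.1 z.2.

Definition split3 (R : realType) (y : 'rV[R]_3) : R * 'rV[R]_2 := (y 0 0, tail2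
  y).

Lemma join3K (R : realType) : cancel (@join3 R) (@split3 R).
Proof. by move=> [t w]; rewrite /split3 /join3 /=;
  have [-> ->] := pack3K t w. Qed.

Lemma split3K (R : realType) : cancel (@split3 R) (@join3 R).
Proof. by move=> y; rewrite /split3 /join3 /= tail2K. Qed.

Lemma smooth_join3 (R : realType) (S : set (R * 'rV[R]_2)) : open S ->
  smooth_on S (@join3 R).
Proof.
move=> oS; have sid : smooth_on S id by exact: smooth_on_id.
have s1 : smooth_on S (fun z : R * 'rV[R]_2 => z.1 : R).
  by apply: (smooth_on_linear (L := fst) oS _ sid) => z; exact: cvg_fst.
have s2 : smooth_on S (fun z : R * 'rV[R]_2 => z.2).
  by apply: (smooth_on_linear (L := snd) oS _ sid) => z; exact: cvg_snd.
apply: smooth_on_mx => // i j.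
apply: (@smooth_on_eq _ _ _ _ (fun z : R * 'rV[R]_2 => [:: z.1 : R; z.2 0 0;
  z.2 0 1]`_j)) => //.
  by move=> y _; rewrite /join3 /pack3 [RHS]mxE.
case: j => [[|[|[|//]]] ?] //=.
  exact: (smooth_on_mxE 0 0 oS s2).
exact: (smooth_on_mxE 0 1 oS s2).
Qed.

Lemma smooth_split3 (R : realType) (S : set 'rV[R]_3) : open S ->
  smooth_on S (@split3 R).
Proof.
move=> oS; have sid : smooth_on S (id : 'rV[R]_3 -> 'rV[R]_3) by exact:
  smooth_on_id.
apply: smooth_on_pair => //; first exact: (smooth_on_mxE 0 0 oS sid).
apply: smooth_on_mx => // i j.
apply: (@smooth_on_eq _ _ _ _ (fun z : 'rV[R]_3 => [:: z 0 1; z 0 2]`_j)) => //.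
  by move=> y _; rewrite /tail2 [RHS]mxE.
case: j => [[|[|//]] ?] //=.
  exact: (smooth_on_mxE 0 1 oS sid).
exact: (smooth_on_mxE 0 2 oS sid).
Qed.

(** The norms are sup norms, so a product of balls of equal radius lies in the ball of that
    radius. *)
Lemma ball_pack3 (R : realType) (z : 'rV[R]_3) (r t : R) (w : 'rV[R]_2) :
  ball (z 0 0 : R^o) r t -> ball (tail2 z) r w -> ball z r (pack3 t w).
Proof.
move=> bt [r0 bw]; have w0 := bw 0 0; have w1 := bw 0 1.
rewrite !mxE /= in w0 w1.
split=> // i j; rewrite (_ : i = 0); last by apply: val_inj; case: i => [[]].
rewrite mxE; case: j => [[|[|[|//]]] jl] /=.
- by rewrite (_ : Ordinal jl = 0) //; apply: val_inj.
- by rewrite (_ : Ordinal jl = 1) //; apply: val_inj.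
- by rewrite (_ : Ordinal jl = 2) //; apply: val_inj.
Qed.

Lemma ball_is_interval (R : realType) (t r : R) : is_interval (ball t r : set
  R).
Proof.
move=> x y; rewrite -ball_normE /= => tx ty z /andP[xz zy].
by move: tx ty; rewrite !ltr_norml => /andP[? ?] /andP[? ?]; apply/andP;
  split; lra.
Qed.

Section ChartDiffeomorphism.
Variables (R : realType) (M : topologicalType) (A : set (chart R M 3)).
Hypothesis hM : smooth_manifold A.
Variables (c : chart R M 3) (U W : set 'rV[R]_3) (T phi : 'rV[R]_3 -> 'rV[R]_3)
  (S : set (R * 'rV[R]_2)).
Hypotheses (Ac : A c) (oU : open U) (oS : open S)
  (Uc : U `<=` cim c)
  (UW : forall y, U y -> W (T y) /\ phi (T y) = y)
  (WU : forall z, W z -> U (phi z) /\ T (phi z) = z)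
  (sphi : smooth_on W phi) (sT : smooth_on U T)
  (SW : forall z, S z -> W (join3 z)).

Let UT := U `&` (fun y => split3 (T y)) @^-1` S.

Let sUT : smooth_on U (fun y => split3 (T y)).
Proof.
have sS := smooth_split3 (@openT 'rV[R]_3).
exact: (@smooth_on_comp _ _ _ _ U setT T (@split3 R)).
Qed.

Let oUT : open UT.
Proof.
apply: open_preimage_in => // y Uy; exact: smooth_on_continuous sUT Uy.
Qed.

Let sP : smooth_on S (fun z => phi (join3 z)).
Proof.
exact: (@smooth_on_comp _ _ _ _ S W (@join3 R) phi oS SW (smooth_join3 oS)
  sphi).
Qed.

(** In the chart [c] both maps are compositions of smooth ones; any other chart adds a transition
    map of the atlas. *)
Lemma chart_diffeomorphism :
  diffeomorphism A S (cdom c `&` ccoord c @^-1` UT)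
    (fun z => cparam c (phi (join3 z))) (fun p => split3 (T (ccoord c p))).
Proof.
case: hM => _ _ [chartP _ trans]; have [oc oi cK cc cp] := chartP c Ac.
have cimP y : cim c y -> cdom c (cparam c y) /\ ccoord c (cparam c y) = y.
  by move=> [p cp' <-]; rewrite cK.
have phiS z : S z -> [/\ U (phi (join3 z)), T (phi (join3 z)) = join3 z
    & cim c (phi (join3 z))].
  by move=> /SW /WU [Uz Tz]; split=> //; exact: Uc.
have cphi z : S z -> {for z, continuous (fun z => cparam c (phi (join3 z)))}.
  move=> Sz; have [Uz _ cz] := phiS z Sz.
  apply: (@continuous_comp _ _ _ (fun z => phi (join3 z)) (cparam c)).
    exact: smooth_on_continuous sP Sz.
  exact: cp.
have oUM : open (cdom c `&` ccoord c @^-1` UT) by exact: open_preimage_in.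
split=> //.
- split=> [z Sz|p [_ [_ //]]].
  have [Uz Tz cz] := phiS z Sz; have [dz cEz] := cimP _ cz.
  by split=> //; rewrite /preimage /= cEz; split=> //;
    rewrite /preimage /= Tz join3K.
- split=> [z|p]; rewrite inE => Hp.
    have [Uz Tz cz] := phiS z Hp; have [dz cEz] := cimP _ cz.
    by rewrite cEz Tz join3K.
  by case: Hp => cp' [Up _]; rewrite split3K; have [_ ->] := UW Up; rewrite cK.
move=> d Ad; have [od oid dK cd pd] := chartP d Ad; split.
- have oE : open (S `&` (fun z => cparam c (phi (join3 z))) @^-1` cdom d).
    exact: open_preimage_in.
  have sE : smooth_on (S `&` (fun z => cparam c (phi (join3 z))) @^-1` cdom d)
      (fun z => phi (join3 z)) by apply: smooth_on_sub sP => z [].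
  apply: (@smooth_on_comp _ _ _ _ _ (cim c `&` cparam c @^-1` cdom d) _
    (ccoord d \o cparam c) oE _ sE (trans c d Ac Ad)).
  by move=> z [Sz dz]; have [_ _ cz] := phiS z Sz.
have oE : open (cim d `&` cparam d @^-1` (cdom c `&` ccoord c @^-1` UT)).
  exact: open_preimage_in.
have sE : smooth_on (cim d `&` cparam d @^-1` (cdom c `&` ccoord c @^-1` UT))
    (ccoord c \o cparam d).
  by apply: smooth_on_sub (trans d c Ad Ac) => y [cy [cy' _]].
apply: (@smooth_on_comp _ _ _ _ _ U _ (fun y => split3 (T y)) oE _ sE sUT).
by move=> y [_ [_ []]].
Qed.

End ChartDiffeomorphism.

Theorem theorem3 (R : realType) (M : topologicalType)
    (A : set (chart R M 3)) (F xi : M -> 'rV[R]_4) (a mu1 eta : M -> R)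
    (hM : smooth_manifold A)
    (hconn : connected [set: M])
    (hF : positive_definite_hypersurface A F xi)
    (hsym : SO2_symmetry A F xi \/ Z3_symmetry A F xi)
    (hfun : structure_functions A F xi a mu1 eta)
    (ha : forall p, a p = - eta p ^+ 2 + mu1 p ^+ 2)
    (ha0 : exists p, a p != 0) :
  exists (Q : 'M[R]_4) (b : 'rV[R]_4), Q \in unitmx /\
    forall p : M,
      exists (I : set R) (N : set 'rV[R]_2) (f : 'rV[R]_2 -> R)
             (g1 g2 : R -> R) (U : set M)
             (phi : R^o * 'rV[R]_2 -> M) (tau : M -> R^o * 'rV[R]_2),
        [/\ open I /\ is_interval I,
            open N /\ improper_affine_sphere N (graph_surface f)
                        (\row_j [:: 0; 0; 1]`_j),
            affine_curve I g1 g2,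
            [/\ U p, diffeomorphism A (I `*` N) U phi tau
              & forall t w, I t -> N w ->
                  F (phi (t, w)) *m Q + b = cone_immersion f g1 g2 t w]
          & SO2_symmetry A F xi ->
              elliptic_paraboloid (graph_surface f @` N)].
Proof.
have [Q [b [uQ pos]]] := in_position_exists hM hconn hF hsym hfun ha ha0.
exists Q, b; split=> // p.
have [c [V [e1 [e2 [e3 [lam [mu2 [hP cp Vp hpos]]]]]]]] := pos p.
have [Ac Vc P] := hP; have [rho [al [be /(cone_frame_affine Q b) C]]] :=
  adapted_patch_cone P.
rewrite mul1r in C.
set G := fun y => (F \o cparam c) y *m Q + b in C.
have [r1 r10 [rV H]] := cone_position_ball C Vp.
pose x := ccoord c p; pose D := ball x r1.
have Dx : D x by exact: ballxx.
have oD : open D by exact: ball_open.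
have CD := cone_frame_sub oD rV C.
have vol0 : `|\det Q| != 0 by rewrite normr_eq0 -unitfE -unitmxE.
have PD y : D y -> _ := fun Dy => H x y Dx Dy hpos.
have [U [W [phi [[oU oW] [Ux UD] UW WU [sphi sT]]]]] := cone_coord_inverse CD
  vol0 PD Dx.
pose z0 := cone_coord G x.
have Wz0 : W z0 by have [] := UW x Ux.
(* A box inside the image of the coordinates supplies the interval and the disc, with the same
   radius. *)
have [r /= r0 rW] : nbhs_ball z0 W by apply/nbhs_ballP; exact: open_nbhs_nbhs.
pose t0 : R := z0 0 0; pose w0 := tail2 z0.
have tN t w : ball t0 r t -> ball w0 r w -> W (pack3 t w).
  by move=> bt bw; apply: rW; exact: ball_pack3.
pose I : set R := ball t0 r; pose N : set 'rV[R]_2 := ball w0 r.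
have oI : open (I : set R^o) by exact: ball_open.
have oN : open N by exact: ball_open.
pose IN : set (R * 'rV[R]_2) := I `*` N.
have oIN : open IN by exact: (ball_open ((t0, w0) : R * 'rV[R]_2) r).
have Uc : U `<=` cim c by move=> y /UD /rV /Vc.
have SW (z : R * 'rV[R]_2) : IN z -> W (join3 z) by move=> [Iz Nz]; exact: tN.
(* The curve is parametrized by the last coordinate, so g_1 is the identity. *)
exists I, N, (leaf_graph G phi t0), id, (cone_profile G phi t0 w0).
exists (cdom c `&` ccoord c @^-1` (U `&` (fun y => split3 (cone_coord G y))
  @^-1` IN)).
exists (fun z => cparam c (phi (join3 z))), (fun q => split3 (cone_coord G
  (ccoord c q))).
split.
- by split=> //; exact: ball_is_interval.
- split=> //.
  exact: (leaf_improper_affine_sphere CD vol0 PD oU oW UD UW WU sphi r0 tN).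
- exact: (cone_profile_affine_curve CD vol0 PD oU oW UD UW WU sphi r0 tN).
- split.
  + by split=> //; split=> //; split; exact: ballxx.
  + rewrite -/IN.
    exact: (chart_diffeomorphism hM Ac oU oIN Uc UW WU sphi sT SW).
  + move=> t w It Nw.
    exact: (cone_param_immersion CD vol0 PD oU oW UD UW WU sphi r0 tN It Nw).
move=> hS.
apply: (leaf_elliptic_paraboloid CD vol0 PD oU oW UD UW WU sphi r0 tN).
by move=> y /rV Vy; exact: (chart_patch_mu2_eq0 hS hP Vy).
Qed.
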